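(* In the bounded-domain setup assume (E1) and $\Delta_6:=\sup_D(|V|+|\nabla V|+|\nabla^2V|)<\infty$, $\Delta_7:=\sup_{\Gamma\times[0,\infty)}|g|<\infty$. Let $\sigma$ be the classical solution of (Σ) and define the phase velocities $\mathbf v_2=A(\nabla\sigma-\sigma b)+Ac$ and $\mathbf v_1=V-\mathbf v_2$. Then for any open $U'$ with $\overline{U'}\subset U$ there is $\tilde M>0$ such that for $i=1,2$ and all $t>0$, $$\sup_{x\in U'}|\mathbf v_i(x,t)|\le\tilde M\Big(1+\frac1{\sqrt t}\Big)\Big[e^{-\eta_1t}\sup_U|\sigma_0|+\Delta_6+\sqrt{\Delta_6}+\Delta_7\Big],$$ with $\eta_1=\ln(1+\eta_0)/(qR^2)$. Consequently, if $\lim_{t\to\infty}\{\sup_{x\in U}(|V|+|\nabla V|+|\nabla^2V|)(x,t)+\sup_{x\in\Gamma}|g(x,t)|\}=0$, then $\lim_{t\to\infty}\mathbf v_1(x,t)=\lim_{t\to\infty}\mathbf v_2(x,t)=0$ for every $x\in U$.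
   Context: Setup. Fix $n\ge2$. For $i=1,2$: $g_i(s)=a^{(i)}_0+\sum_{j=1}^{N_i}a^{(i)}_js^{\alpha^{(i)}_j}$ ($s\ge0$), $a^{(i)}_0>0$, $a^{(i)}_j\ge0$, real $0<\alpha^{(i)}_1<\dots$; $G_i(u)=g_i(|u|)u$ ($u\in\mathbb R$). $f_1,f_2\in C([0,1])\cap C^1((0,1))$, $f_1(0)=0=f_2(1)$, $f_1'>0>f_2'$ on $(0,1)$; $p_c'\in C^1((0,1))$, $p_c'>0$; $F_i=1/(p_c'f_i)$. Fix $r_0>0$, $c_1,c_2$ with $c_1^2+c_2^2>0$, $s_0\in(0,1)$, and let $\hat S$ be the $C^1$ solution of $\hat S'=G_2(c_2r^{1-n})F_2(\hat S)-G_1(c_1r^{1-n})F_1(\hat S)$, $\hat S(r_0)=s_0$, $0<\hat S<1$, on its maximal interval $[r_0,R_{\max})$. For $r_0\le|x|<R_{\max}$: $S_*(x)=\hat S(|x|)$, $u_i^*(x)=c_i|x|^{-n}x$. For $u\in\mathbb R^n$: $\mathbf G_i(u)=g_i(|u|)u$, Jacobian $\mathbf G_i'(u)=g_i(|u|)I_n+g_i'(|u|)uu^T/|u|$ ($=g_i(0)I_n$ at $u=0$). $B(x)=F_1(S_* )\mathbf G_1'(u_1^* )+F_2(S_* )\mathbf G_2'(u_2^* )$ (symmetric positive definite), $A=B^{-1}$, $b(x)=F_2'(S_* )\mathbf G_2(u_2^* )-F_1'(S_* )\mathbf G_1(u_1^* )$. $C^m_x$: continuous with continuous $x$-derivatives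 up to order $m$. Bounded-domain setup: fix $R\in(r_0,R_{\max})$ with $0<\underline s\le\hat S(r)\le\bar s<1$ on $[r_0,R]$; $U$ open bounded, $U\subset B_R\setminus\overline{B_{r_0}}$, $\Gamma=\partial U$, $D=U\times(0,\infty)$. Constants: $d_0=\min\{g_1(0),g_2(0)\}$, $d_1=\sum_i g_i(|c_i|r_0^{1-n})$, $d_2=\sum_i g_i(|c_i|r_0^{1-n})|c_i|r_0^{1-n}$, $d_3=\sum_i g_i'(|c_i|r_0^{1-n})|c_i|r_0^{1-n}$ (terms with $c_i=0$ read as $0$), $d_4=d_1+d_3$; $\mu_1=\sum_i\max_{[\underline s,\bar s]}F_i$, $\mu_2=\sum_i\min_{[\underline s,\bar s]}F_i$, $\mu_3=\sum_i\max_{[\underline s,\bar s]}|F_i'|$; $C_0=d_4\mu_1$, $C_1=d_0\mu_2$, $C_2=d_2\mu_3$; $\kappa_0=C_0/(2C_1)$, $s_R=\kappa_0(n+C_2R)$, $q=\kappa_0C_0/(2s_R)$, $\eta_0=(r_0/R)^{2s_R}$. Given $V:\overline D\to\mathbb R^n$, $c(x,t)=F_1(S_*(x))\mathbf G_1'(u_1^*(x))V(x,t)$. IBVP (Σ): $\sigma_t=\nabla\cdot[A(\nabla\sigma-\sigma b)]+\nabla\cdot(Ac)$ in $D$, $\sigma=g$ on $\Gamma\times(0,\infty)$, $\sigma(x,0)=\sigma_0(x)$ in $U$, where $\sigma_0\in C(\overline U)$, $g\in C(\Gamma\times[0,\infty))$, $\sigma_0=g(\cdot,0)$ on $\Gamma$.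 Condition (E1): $F_1,F_2\in C^7((0,1))$, $V\in C^6_x(\overline D)$, $V_t\in C^3_x(\overline D)$; under (E1), (Σ) has a unique solution in $C(\overline D)\cap C^{2,1}_{x,t}(D)$. *)

(* Defs.v *)
From mathcomp Require Import ssreflect ssrfun ssrbool eqtype ssrnat seq fintype bigop.
From Stdlib Require Import Reals ClassicalEpsilon.


Open Scope R_scope.

Definition vec (n : nat) := 'I_n -> R.
Definition mat (n : nat) := 'I_n -> 'I_n -> R.
Definition sumI {n : nat} (F : 'I_n -> R) : R := \big[Rplus/R0]_(i < n) F i.
Definition vnorm {n} (x : vec n) : R := sqrt (sumI (fun i => x i * x i)).
Definition vadd {n} (x y : vec n) : vec n := fun i => x i + y i.
Definition vsub {n} (x y : vec n) : vec n := fun i => x i - y i.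
Definition vscal {n} (a : R) (x : vec n) : vec n := fun i => a * x i.
Definition ebasis {n} (i : 'I_n) : vec n := fun j => if j == i then 1 else 0.
Definition idmat (n : nat) : mat n := fun i j => if i == j then 1 else 0.
Definition madd {n} (M N : mat n) : mat n := fun i j => M i j + N i j.
Definition mscal {n} (a : R) (M : mat n) : mat n := fun i j => a * M i j.
Definition matvec {n} (M : mat n) (x : vec n) : vec n :=
  fun i => sumI (fun j => M i j * x j).
Definition matmul {n} (M N : mat n) : mat n :=
  fun i k => sumI (fun j => M i j * N j k).

(* ---------- sup / inf of a real set (is_lub; junk if unbounded) ---------- *)
Definition Rsup_of (E : R -> Prop) : R :=
  epsilon (inhabits R0) (fun m => is_lub E m).
Definition Rinf_of (E : R -> Prop) : R := - Rsup_of (fun y => E (- y)).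
Definition img (P : R -> Prop) (f : R -> R) : R -> Prop :=
  fun y => exists s, P s /\ y = f s.

Definition cont_rel (P : R -> Prop) (f : R -> R) (x : R) : Prop :=
  forall eps, 0 < eps -> exists d, 0 < d /\
    forall y, P y -> Rabs (y - x) < d -> Rabs (f y - f x) < eps.
Fixpoint Ck01 (k : nat) (f : R -> R) : Prop :=
  match k with
  | O => forall s, 0 < s < 1 -> continuity_pt f s
  | S k' => exists f' : R -> R,
      (forall s, 0 < s < 1 -> derivable_pt_lim f s (f' s)) /\ Ck01 k' f'
  end.

Definition has_partial {n} (f : vec n -> R) (x : vec n) (i : 'I_n) (l : R) : Prop :=
  derivable_pt_lim (fun h => f (vadd x (vscal h (ebasis i)))) 0 l.
Definition is_open {n} (P : vec n -> Prop) : Prop :=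
  forall x, P x -> exists d, 0 < d /\ forall y, vnorm (vsub y x) < d -> P y.
Definition closure {n} (P : vec n -> Prop) (x : vec n) : Prop :=
  forall eps, 0 < eps -> exists y, P y /\ vnorm (vsub y x) < eps.
Definition bdry {n} (P : vec n -> Prop) (x : vec n) : Prop := closure P x /\ ~ P x.
Definition cont_xt {n} (Dom : vec n -> R -> Prop) (f : vec n -> R -> R) : Prop :=
  forall x t, Dom x t -> forall eps, 0 < eps -> exists d, 0 < d /\
    forall y s, Dom y s -> vnorm (vsub y x) < d -> Rabs (s - t) < d ->
      Rabs (f y s - f x t) < eps.
(* C^m_x(Dcl): continuous on Dcl with x-derivatives up to order m (taken at the
   points of Dint) extending continuously to Dcl *)
Fixpoint Cmx {n} (m : nat) (Dint Dcl : vec n -> R -> Prop) (f : vec n -> R -> R) : Prop :=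
  match m with
  | O => cont_xt Dcl f
  | S m' => cont_xt Dcl f /\ forall i : 'I_n, exists g : vec n -> R -> R,
      (forall x t, Dint x t -> has_partial (fun y => f y t) x i (g x t)) /\
      Cmx m' Dint Dcl g
  end.

(* g = (a0, [(a_1,alpha_1); ...; (a_N,alpha_N)]),
   g(s) = a0 + sum_j a_j s^alpha_j  (s >= 0, with 0^alpha = 0) *)
Definition gdata := (R * seq (R * R))%type.
Definition rpow (s a : R) : R := if Rlt_dec 0 s then Rpower s a else 0.
Definition gfun (g : gdata) (s : R) : R :=
  g.1 + foldr (fun p acc => p.1 * rpow s p.2 + acc) 0 g.2.
(* g'(s) for s > 0 *)
Definition gder (g : gdata) (s : R) : R :=
  foldr (fun p acc => p.1 * p.2 * rpow s (p.2 - 1) + acc) 0 g.2.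
Fixpoint incr_exps (prev : R) (l : seq (R * R)) : Prop :=
  match l with
  | nil => True
  | p :: l' => prev < p.2 /\ incr_exps p.2 l'
  end.
Fixpoint nonneg_coefs (l : seq (R * R)) : Prop :=
  match l with
  | nil => True
  | p :: l' => 0 <= p.1 /\ nonneg_coefs l'
  end.
Definition admissible (g : gdata) : Prop :=
  0 < g.1 /\ nonneg_coefs g.2 /\ incr_exps 0 g.2.
Definition Gsc (g : gdata) (u : R) : R := gfun g (Rabs u) * u.
Definition Gvec (g : gdata) {n} (u : vec n) : vec n := vscal (gfun g (vnorm u)) u.
Definition Gjac (g : gdata) {n} (u : vec n) : mat n := fun i j =>
  if Req_EM_T (vnorm u) 0 then gfun g 0 * idmat n i j
  else gfun g (vnorm u) * idmat n i j + gder g (vnorm u) * u i * u j / vnorm u.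

Definition Ffun (pc f : R -> R) (s : R) : R := / (pc s * f s).
Definition ustar {n} (c : R) (x : vec n) : vec n := vscal (c / vnorm x ^ n) x.
Definition Bmat (g1 g2 : gdata) (F1 F2 Shat : R -> R) (c1 c2 : R) {n} (x : vec n) : mat n :=
  madd (mscal (F1 (Shat (vnorm x))) (Gjac g1 (ustar c1 x)))
       (mscal (F2 (Shat (vnorm x))) (Gjac g2 (ustar c2 x))).
Definition Amat (g1 g2 : gdata) (F1 F2 Shat : R -> R) (c1 c2 : R) {n} (x : vec n) : mat n :=
  epsilon (inhabits (fun _ _ => R0))
    (fun M : mat n => matmul (Bmat g1 g2 F1 F2 Shat c1 c2 x) M = idmat n).
Definition bvec (g1 g2 : gdata) (dF1 dF2 Shat : R -> R) (c1 c2 : R) {n} (x : vec n) : vec n :=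
  vsub (vscal (dF2 (Shat (vnorm x))) (Gvec g2 (ustar c2 x)))
       (vscal (dF1 (Shat (vnorm x))) (Gvec g1 (ustar c1 x))).
Definition cvec (g1 : gdata) (F1 Shat : R -> R) (c1 : R) {n} (V : vec n -> R -> vec n)
  (x : vec n) (t : R) : vec n :=
  matvec (mscal (F1 (Shat (vnorm x))) (Gjac g1 (ustar c1 x))) (V x t).

Definition rho (n : nat) (r0 : R) : R := Rpower r0 (1 - INR n).
Definition d0c (g1 g2 : gdata) : R := Rmin (gfun g1 0) (gfun g2 0).
Definition d1c (g1 g2 : gdata) n r0 c1 c2 : R :=
  gfun g1 (Rabs c1 * rho n r0) + gfun g2 (Rabs c2 * rho n r0).
Definition d2c (g1 g2 : gdata) n r0 c1 c2 : R :=
  gfun g1 (Rabs c1 * rho n r0) * (Rabs c1 * rho n r0)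
  + gfun g2 (Rabs c2 * rho n r0) * (Rabs c2 * rho n r0).
(* a term with c_i = 0 is 0 (gder at 0 times 0) *)
Definition d3c (g1 g2 : gdata) n r0 c1 c2 : R :=
  gder g1 (Rabs c1 * rho n r0) * (Rabs c1 * rho n r0)
  + gder g2 (Rabs c2 * rho n r0) * (Rabs c2 * rho n r0).
Definition d4c g1 g2 n r0 c1 c2 : R := d1c g1 g2 n r0 c1 c2 + d3c g1 g2 n r0 c1 c2.
Definition Iv (sl sh : R) : R -> Prop := fun s => sl <= s <= sh.
Definition mu1c (F1 F2 : R -> R) sl sh : R :=
  Rsup_of (img (Iv sl sh) F1) + Rsup_of (img (Iv sl sh) F2).
Definition mu2c (F1 F2 : R -> R) sl sh : R :=
  Rinf_of (img (Iv sl sh) F1) + Rinf_of (img (Iv sl sh) F2).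
Definition mu3c (dF1 dF2 : R -> R) sl sh : R :=
  Rsup_of (img (Iv sl sh) (fun s => Rabs (dF1 s)))
  + Rsup_of (img (Iv sl sh) (fun s => Rabs (dF2 s))).
Definition C0c g1 g2 n r0 c1 c2 F1 F2 sl sh : R :=
  d4c g1 g2 n r0 c1 c2 * mu1c F1 F2 sl sh.
Definition C1c g1 g2 F1 F2 sl sh : R := d0c g1 g2 * mu2c F1 F2 sl sh.
Definition C2c g1 g2 n r0 c1 c2 dF1 dF2 sl sh : R :=
  d2c g1 g2 n r0 c1 c2 * mu3c dF1 dF2 sl sh.
Definition kappa0c g1 g2 n r0 c1 c2 F1 F2 sl sh : R :=
  C0c g1 g2 n r0 c1 c2 F1 F2 sl sh / (2 * C1c g1 g2 F1 F2 sl sh).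
Definition sRc g1 g2 n r0 c1 c2 F1 F2 dF1 dF2 sl sh (R0' : R) : R :=
  kappa0c g1 g2 n r0 c1 c2 F1 F2 sl sh
  * (INR n + C2c g1 g2 n r0 c1 c2 dF1 dF2 sl sh * R0').
Definition qc g1 g2 n r0 c1 c2 F1 F2 dF1 dF2 sl sh (R0' : R) : R :=
  kappa0c g1 g2 n r0 c1 c2 F1 F2 sl sh * C0c g1 g2 n r0 c1 c2 F1 F2 sl sh
  / (2 * sRc g1 g2 n r0 c1 c2 F1 F2 dF1 dF2 sl sh R0').
Definition eta0c g1 g2 n r0 c1 c2 F1 F2 dF1 dF2 sl sh (R0' : R) : R :=
  Rpower (r0 / R0') (2 * sRc g1 g2 n r0 c1 c2 F1 F2 dF1 dF2 sl sh R0').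
Definition eta1c g1 g2 n r0 c1 c2 F1 F2 dF1 dF2 sl sh (R0' : R) : R :=
  ln (1 + eta0c g1 g2 n r0 c1 c2 F1 F2 dF1 dF2 sl sh R0')
  / (qc g1 g2 n r0 c1 c2 F1 F2 dF1 dF2 sl sh R0' * R0' ^ 2).

(* Main.v *)
(** Both phase velocities are controlled by the gradient and the supremum of [sigma].

    Supremum: the steady state is radial, so [B x] and [b] are radial fields and
    [A grad psi = - r^N x] can be solved for a radial [psi].  With [Lam' = b], the
    function [e^Lam ((K1 e^(-eta1 t) + K2) psi + K3)] is a supersolution; the choice
    [N = n + C2 R] makes its decay rate at least [eta1].

    Gradient: [sigma] is only of class [C^{2,1}], so the equation is not differentiated.
    One maximizes
    [sigma(x,t) - sigma(y,t) - L (|x-y| - |x-y|^2/(4d)) - K1 |x-x0|^2 - K2 (t0-t)]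
    and splits [A = lam I + P P^T] with [P] Lipschitz.  Second-order tests along
    [(e_k, M e_k)], [M] the reflection in the hyperplane normal to [x-y], produce the negative term
    [- 2 lam L / d], which absorbs the error [O(L |x-y|)] of the tests along
    [(P(x) e_k, P(y) e_k)] and the first-order terms when [d] is small. *)
Require Import Defs.
From HB Require Import structures.
From mathcomp Require Import ssreflect ssrfun ssrbool eqtype ssrnat seq fintype bigop.
From Stdlib Require Import Reals ClassicalEpsilon Lra Lia Psatz FunctionalExtensionality.
From Coquelicot Require Import Coquelicot.
Open Scope R_scope.

(** * Finite sums and Euclidean vectors *)

(** All estimates are linear in the data, with constants that depend neither on the solution nor on
    the starting time. They are used twice: from time 0 for the explicit bound, and from a late time
    [T], after which the data are small, for the convergence to 0. The factor [1 / sqrt t] is the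
    inverse of the radius of a parabolic cylinder below [(x, t)] that has to stay at positive times.
    The obstacle to a plain maximum principle is the zeroth-order coefficient [- div (A b)], which
    has no sign. The weight [e^Lam] removes it: its flux [A (grad e^Lam - e^Lam b)] vanishes, so
    multiples of [e^Lam] play the role of constants. In the gradient estimate the same term is
    harmless, because it is moved to the source, where the supremum already controls it. In
    [A = lam I + P P^T] the number [lam] stays strictly below the spectrum of [A]: the reflected
    tests need a full Laplacian, and the root [P] is Lipschitz because its eigenvalues stay away
    from 0. *)

HB.instance Definition _ :=
  Monoid.isComLaw.Build R 0 Rplus
    (fun x y z => esym (Rplus_assoc x y z)) Rplus_comm Rplus_0_l.
HB.instance Definition _ := Monoid.isMulLaw.Build R 0 Rmult Rmult_0_l Rmult_0_r.
HB.instance Definition _ := Monoid.isAddLaw.Build R Rmult Rplus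
  Rmult_plus_distr_r Rmult_plus_distr_l.

Lemma sumI_ext n (F G : 'I_n -> R) : (forall i, F i = G i) -> sumI F = sumI G.
Proof. by move=> H; apply: eq_bigr => i _. Qed.

Lemma sumI_add n (F G : 'I_n -> R) : sumI (fun i => F i + G i) = sumI F + sumI G.
Proof. exact: big_split. Qed.

Lemma sumI_scal n a (F : 'I_n -> R) : sumI (fun i => a * F i) = a * sumI F.
Proof. by rewrite /sumI big_distrr. Qed.

Lemma sumI_scalr n a (F : 'I_n -> R) : sumI (fun i => F i * a) = sumI F * a.
Proof. by rewrite /sumI big_distrl. Qed.

Lemma sumI_sub n (F G : 'I_n -> R) : sumI (fun i => F i - G i) = sumI F - sumI G.
Proof.
have -> : sumI F - sumI G = sumI F + -1 * sumI G by ring.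
by rewrite -sumI_scal -sumI_add; apply: sumI_ext => i; ring.
Qed.

Lemma sumI_exch n m (F : 'I_n -> 'I_m -> R) :
  sumI (fun i => sumI (fun j => F i j)) = sumI (fun j => sumI (fun i => F i j)).
Proof. exact: exchange_big. Qed.

Lemma sumI_le n (F G : 'I_n -> R) : (forall i, F i <= G i) -> sumI F <= sumI G.
Proof.
move=> H; apply: (big_ind2 (fun s t => s <= t)) => [|x1 x2 y1 y2 ? ?|//]; lra.
Qed.

Lemma sumI_const n a : sumI (fun _ : 'I_n => a) = INR n * a.
Proof.
rewrite /sumI big_const_ord; elim: n => [|n IH] /=; first lra.
by rewrite IH; case: n {IH} => [|n] /=; lra.
Qed.

Lemma sumI_0 n : sumI (fun _ : 'I_n => 0) = 0.
Proof. by rewrite sumI_const Rmult_0_r. Qed.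

Lemma sumI_ge0 n (F : 'I_n -> R) : (forall i, 0 <= F i) -> 0 <= sumI F.
Proof. by move=> H; rewrite -(sumI_0 n); apply: sumI_le. Qed.

Lemma sumI_idl n (i : 'I_n) (F : 'I_n -> R) : sumI (fun j => idmat n i j * F j) = F i.
Proof.
rewrite /sumI (bigD1 i) //= /idmat eqxx big1 => [|j /negbTE]; first by rewrite /=; ring.
by rewrite eq_sym => ->; ring.
Qed.

Lemma idmatC n (i j : 'I_n) : idmat n i j = idmat n j i.
Proof. by rewrite /idmat eq_sym. Qed.

Lemma sumI_idr n (i : 'I_n) (F : 'I_n -> R) : sumI (fun j => F j * idmat n i j) = F i.
Proof. by rewrite -[RHS](sumI_idl n i F); apply: sumI_ext => j; ring. Qed.

Lemma sumI_term_le n (i : 'I_n) (F : 'I_n -> R) : (forall i, 0 <= F i) -> F i <= sumI F.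
Proof.
move=> H; rewrite /sumI (bigD1 i) //=.
rewrite -{1}(Rplus_0_r (F i)); apply: Rplus_le_compat_l.
by apply: (big_ind (fun s => 0 <= s)) => [|x y ? ?|j _]; [lra | exact: Rplus_le_le_0_compat | exact: H].
Qed.

Lemma sumI_Rabs n (F : 'I_n -> R) : Rabs (sumI F) <= sumI (fun i => Rabs (F i)).
Proof.
apply: (big_ind2 (fun s t => Rabs s <= t)) => [|x1 x2 y1 y2 ? ?|i _].
- by rewrite Rabs_R0; lra.
- by apply: Rle_trans (Rabs_triang _ _) _; apply: Rplus_le_compat.
by lra.
Qed.

Ltac vec_ring :=
  let i := fresh in apply: functional_extensionality => i; cbv [vsub vadd vscal]; ring.

Definition dot {n} (x y : vec n) : R := sumI (fun i => x i * y i).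

Lemma dotC n (x y : vec n) : dot x y = dot y x.
Proof. by apply: sumI_ext => i; ring. Qed.

Lemma dot_ge0 n (x : vec n) : 0 <= dot x x.
Proof. by apply: sumI_ge0 => i; nra. Qed.

Lemma vnorm_ge0 n (x : vec n) : 0 <= vnorm x.
Proof. exact: sqrt_pos. Qed.

Lemma vnorm_sq n (x : vec n) : vnorm x * vnorm x = dot x x.
Proof. exact/sqrt_sqrt/dot_ge0. Qed.

Lemma dot_addl n (x y z : vec n) : dot (vadd x y) z = dot x z + dot y z.
Proof. by rewrite -sumI_add; apply: sumI_ext => i; rewrite /vadd; ring. Qed.
Lemma dot_addr n (x y z : vec n) : dot x (vadd y z) = dot x y + dot x z.
Proof. by rewrite dotC dot_addl !(dotC _ x). Qed.
Lemma dot_subl n (x y z : vec n) : dot (vsub x y) z = dot x z - dot y z.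
Proof. by rewrite -sumI_sub; apply: sumI_ext => i; rewrite /vsub; ring. Qed.
Lemma dot_subr n (x y z : vec n) : dot x (vsub y z) = dot x y - dot x z.
Proof. by rewrite dotC dot_subl !(dotC _ x). Qed.
Lemma dot_scall n a (x y : vec n) : dot (vscal a x) y = a * dot x y.
Proof. by rewrite -sumI_scal; apply: sumI_ext => i; rewrite /vscal; ring. Qed.
Lemma dot_scalr n a (x y : vec n) : dot x (vscal a y) = a * dot x y.
Proof. by rewrite dotC dot_scall dotC. Qed.
Lemma dot_ebasis n (x : vec n) i : dot x (ebasis i) = x i.
Proof.
rewrite -(sumI_idr n i x); apply: sumI_ext => j.
by rewrite /ebasis /idmat eq_sym.
Qed.

Definition dotE := (dot_addl, dot_addr, dot_subl, dot_subr, dot_scall, dot_scalr).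

Lemma cauchy_schwarz n (x y : vec n) : Rabs (dot x y) <= vnorm x * vnorm y.
Proof.
have H s : 0 <= dot x x - 2 * s * dot x y + s * s * dot y y.
  by have := dot_ge0 n (vsub x (vscal s y)); rewrite !dotE (dotC n y x); lra.
have Hx := dot_ge0 n x; have Hy := dot_ge0 n y.
have Hsq : dot x y * dot x y <= dot x x * dot y y.
  case: (Req_dec (dot y y) 0) => [E|E].
    case: (Req_dec (dot x y) 0) => [->|E']; first by rewrite E; lra.
    (* For [dot y y = 0] the quadratic in [s] is affine, and at this [s] it takes the value -1. *)
    have H1 := H ((dot x x + 1) / (2 * dot x y)); rewrite E in H1.
    have E1 : 2 * ((dot x x + 1) / (2 * dot x y)) * dot x y = dot x x + 1 by field.
    lra.
  have H1 := H (dot x y / dot y y).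
  have E1 : dot x x - 2 * (dot x y / dot y y) * dot x y
    + dot x y / dot y y * (dot x y / dot y y) * dot y y
    = (dot x x * dot y y - dot x y * dot x y) / dot y y by field.
  rewrite E1 in H1.
  have : 0 <= (dot x x * dot y y - dot x y * dot x y) / dot y y * dot y y.
    exact: Rmult_le_pos.
  by rewrite /Rdiv Rmult_assoc Rinv_l // Rmult_1_r; lra.
have Hn : 0 <= vnorm x * vnorm y by apply: Rmult_le_pos; exact: vnorm_ge0.
rewrite -(Rabs_pos_eq _ Hn); apply: Rsqr_le_abs_0.
rewrite /Rsqr; have -> : vnorm x * vnorm y * (vnorm x * vnorm y)
  = (vnorm x * vnorm x) * (vnorm y * vnorm y) by ring.
by rewrite !vnorm_sq.
Qed.

Lemma vnorm_le_sq n (x : vec n) a : 0 <= a -> dot x x <= a * a -> vnorm x <= a.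
Proof.
move=> Ha H; have := vnorm_ge0 n x; have := vnorm_sq n x; nra.
Qed.

Lemma vnorm_triang n (x y : vec n) : vnorm (vadd x y) <= vnorm x + vnorm y.
Proof.
apply: vnorm_le_sq; first by have := vnorm_ge0 n x; have := vnorm_ge0 n y; lra.
rewrite !dotE (dotC n y x).
have := Rle_abs (dot x y); have := cauchy_schwarz n x y.
have := vnorm_sq n x; have := vnorm_sq n y; nra.
Qed.

Lemma vnorm_scal n a (x : vec n) : vnorm (vscal a x) = Rabs a * vnorm x.
Proof.
apply: Rsqr_inj; [exact: vnorm_ge0 | apply: Rmult_le_pos; [exact: Rabs_pos|exact: vnorm_ge0] |].
rewrite /Rsqr vnorm_sq !dotE -vnorm_sq.
have : Rabs a * Rabs a = a * a by rewrite -Rabs_mult Rabs_pos_eq //; nra.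
nra.
Qed.

Lemma vnorm_sub_sym n (x y : vec n) : vnorm (vsub x y) = vnorm (vsub y x).
Proof. by congr sqrt; apply: sumI_ext => i; rewrite /vsub; ring. Qed.

Lemma vnorm_sub_triang n (x y z : vec n) :
  vnorm (vsub x z) <= vnorm (vsub x y) + vnorm (vsub y z).
Proof.
have -> : vsub x z = vadd (vsub x y) (vsub y z) by vec_ring.
exact: vnorm_triang.
Qed.

Lemma vnorm_diff n (x y : vec n) : Rabs (vnorm x - vnorm y) <= vnorm (vsub x y).
Proof.
have H1 : vnorm x <= vnorm (vsub x y) + vnorm y.
  have {1}-> : x = vadd (vsub x y) y by vec_ring.
  exact: vnorm_triang.
have H2 : vnorm y <= vnorm (vsub y x) + vnorm x.
  have {1}-> : y = vadd (vsub y x) x by vec_ring.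
  exact: vnorm_triang.
by rewrite (vnorm_sub_sym n y x) in H2; apply: Rabs_le; lra.
Qed.

Lemma coord_le_vnorm n (x : vec n) i : Rabs (x i) <= vnorm x.
Proof.
rewrite -(Rabs_pos_eq _ (vnorm_ge0 n x)); apply: Rsqr_le_abs_0.
rewrite /Rsqr vnorm_sq; apply: (sumI_term_le n i (fun i => x i * x i)) => j; nra.
Qed.

Lemma vnorm_le_sum n (x : vec n) : vnorm x <= sumI (fun i => Rabs (x i)).
Proof.
have H0 : 0 <= sumI (fun i => Rabs (x i)) by apply: sumI_ge0 => i; exact: Rabs_pos.
apply: vnorm_le_sq => //.
rewrite -sumI_scal; apply: sumI_le => i.
have H1 := sumI_term_le n i (fun i => Rabs (x i)) (fun i => Rabs_pos (x i)).
have : x i * x i = Rabs (x i) * Rabs (x i) by rewrite -Rabs_mult Rabs_pos_eq //; nra.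
have := Rabs_pos (x i); simpl in H1; nra.
Qed.

Lemma vnorm_le_bound n (x : vec n) a : (forall i, Rabs (x i) <= a) -> vnorm x <= INR n * a.
Proof.
move=> H; apply: Rle_trans (vnorm_le_sum n x) _; rewrite -sumI_const; exact: sumI_le.
Qed.

Lemma vsub_addl n (x y : vec n) : vsub (vadd x y) x = y.
Proof. by vec_ring. Qed.

Lemma vnorm_ebasis n (i : 'I_n) : vnorm (ebasis i) = 1.
Proof.
rewrite -sqrt_1; congr sqrt.
by rewrite -/(dot _ _) dot_ebasis /ebasis eqxx.
Qed.

Lemma vadd_scal0 n (x y : vec n) : vadd x (vscal 0 y) = x.
Proof. by vec_ring. Qed.

Lemma vnorm0 n (x : vec n) : vnorm (vsub x x) = 0.
Proof.
rewrite -sqrt_0; congr sqrt; rewrite -[RHS](sumI_0 n).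
by apply: sumI_ext => i; rewrite /vsub; ring.
Qed.

(** * Sequential compactness *)

Local Notation dist x y := (vnorm (vsub x y)).

Lemma choice_seq (T : Type) (x0 : T) (P : nat -> T -> Prop) :
  (forall k, exists x, P k x) -> exists X : nat -> T, forall k, P k (X k).
Proof.
move=> H; exists (fun k => epsilon (inhabits x0) (P k)) => k.
exact: epsilon_spec (H k).
Qed.

Lemma inv_succ_small eps : 0 < eps -> exists N, forall k, le N k -> / (INR k + 1) < eps.
Proof.
move=> He; have [N [HN HN0]] := archimed_cor1 eps He; exists N => k Hk.
apply: Rle_lt_trans HN; apply: Rinv_le_contravar; first exact: lt_0_INR.
have := le_INR _ _ Hk; lra.
Qed.

Lemma inv_succ_pos k : 0 < / (INR k + 1).
Proof. by apply: Rinv_0_lt_compat; have := pos_INR k; lra. Qed.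

(** The condition [k <= phi k] stands in for strict monotonicity: limits pass to such selections,
    and the condition survives composition. *)
Lemma Un_cv_subseq (u : nat -> R) (l : R) (phi : nat -> nat) :
  (forall k, le k (phi k)) -> Un_cv u l -> Un_cv (fun k => u (phi k)) l.
Proof.
move=> Hphi Hu eps He; have [N HN] := Hu eps He; exists N => k Hk.
by apply: HN; have := Hphi k; rewrite /ge in Hk *; lia.
Qed.

Lemma bolzano_weierstrass_R (u : nat -> R) (B : R) :
  (forall k, Rabs (u k) <= B) ->
  exists (phi : nat -> nat) (l : R), (forall k, le k (phi k)) /\ Un_cv (fun k => u (phi k)) l.
Proof.
move=> HB.
have Hin k : -B <= u k <= B by have := Rabs_def2 _ _ (Rle_lt_trans _ _ _ (HB k) (Rlt_plus_1 B)); have := HB k; split_Rabs; lra.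
have [l Hl] := Bolzano_Weierstrass u (fun x => -B <= x <= B) (compact_P3 _ _) Hin.
have H k : exists p, le k p /\ Rabs (u p - l) < / (INR k + 1).
  have [p [Hp1 Hp2]] := Hl (disc l (mkposreal _ (inv_succ_pos k))) k
    (ex_intro _ (mkposreal _ (inv_succ_pos k)) (fun x Hx => Hx)).
  by exists p; split => //; exact: Hp1.
have [phi Hphi] := choice_seq _ O _ H.
exists phi, l; split=> [k|eps He]; first by have [] := Hphi k.
have [N HN] := inv_succ_small eps He; exists N => k Hk.
by have [_ H2] := Hphi k; apply: Rlt_trans H2 _; apply: HN.
Qed.

Definition vcv {n} (X : nat -> vec n) (x : vec n) :=
  Un_cv (fun k => dist (X k) x) 0.

Lemma vcv_sub n (X : nat -> vec n) x (phi : nat -> nat) :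
  (forall k, le k (phi k)) -> vcv X x -> vcv (fun k => X (phi k)) x.
Proof. by move=> Hphi HX; apply: (Un_cv_subseq (fun k => dist (X k) x)). Qed.

Lemma vcv_eps n (X : nat -> vec n) x : vcv X x -> forall eps, 0 < eps ->
  exists N, forall k, le N k -> dist (X k) x < eps.
Proof.
move=> H eps He; have [N HN] := H eps He; exists N => k Hk.
have := HN k Hk; rewrite /R_dist Rminus_0_r Rabs_pos_eq //; exact: vnorm_ge0.
Qed.

Lemma vcvI n (X : nat -> vec n) x : (forall eps, 0 < eps ->
  exists N, forall k, le N k -> dist (X k) x < eps) -> vcv X x.
Proof.
move=> H eps He; have [N HN] := H eps He; exists N => k Hk.
by rewrite /R_dist Rminus_0_r Rabs_pos_eq; [exact: HN|exact: vnorm_ge0].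
Qed.

Lemma vcv_coord n (X : nat -> vec n) (x : vec n) :
  (forall i, Un_cv (fun k => X k i) (x i)) -> vcv X x.
Proof.
move=> H; apply: vcvI => eps He.
have HN : forall s : seq 'I_n, exists N, forall k, le N k -> forall i, i \in s ->
    Rabs (X k i - x i) < eps / (INR n + 1).
  elim=> [|i s [N HN]]; first by exists O.
  have He' : 0 < eps / (INR n + 1) by apply: Rdiv_lt_0_compat => //; have := pos_INR n; lra.
  have [N1 HN1] := H i _ He'; exists (N + N1)%coq_nat => k Hk j.
  rewrite in_cons => /orP [/eqP ->|Hj]; first by apply: HN1; rewrite /ge; lia.
  by apply: HN => //; lia.
have [N {}HN] := HN (enum 'I_n); exists N => k Hk.
apply: Rle_lt_trans (vnorm_le_bound _ _ (eps / (INR n + 1)) _) _.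
  by move=> i; apply/Rlt_le/HN => //; rewrite mem_enum.
have Hn := pos_INR n.
have -> : INR n * (eps / (INR n + 1)) = eps - eps / (INR n + 1) by field; lra.
have : 0 < eps / (INR n + 1) by apply: Rdiv_lt_0_compat => //; lra.
lra.
Qed.

(** Successive extraction along [enum 'I_n]: a finer selection keeps the limits of the coordinates
    already treated. *)
Lemma bolzano_weierstrass n (X : nat -> vec n) (B : R) :
  (forall k, vnorm (X k) <= B) ->
  exists (phi : nat -> nat) (x : vec n), (forall k, le k (phi k)) /\ vcv (fun k => X (phi k)) x.
Proof.
move=> HB.
have H : forall s : seq 'I_n, exists (phi : nat -> nat) (x : vec n), (forall k, le k (phi k)) /\
    forall i, i \in s -> Un_cv (fun k => X (phi k) i) (x i).
  elim=> [|i s [phi [x [Hphi Hx]]]]; first by exists (fun k => k), (fun=> 0).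
  have [psi [l [Hpsi Hl]]] := bolzano_weierstrass_R (fun k => X (phi k) i) B
    (fun k => Rle_trans _ _ _ (coord_le_vnorm _ _ _) (HB _)).
  exists (fun k => phi (psi k)), (fun j => if j == i then l else x j); split.
    by move=> k; have := Hphi (psi k); have := Hpsi k; lia.
  move=> j; rewrite in_cons; case: eqP => [-> _ //|_ /= Hj].
  exact: (Un_cv_subseq (fun k => X (phi k) j)) (Hx j Hj).
have [phi [x [Hphi Hx]]] := H (enum 'I_n).
by exists phi, x; split => //; apply: vcv_coord => i; apply: Hx; rewrite mem_enum.
Qed.

(** Compactness of [K] and continuity of [f] enter through one joint condition, so that no topology
    on [T] is required. It is applied to points, to points with a time, and to pairs of points with
    a time. *)
Lemma seq_compact_max (T : Type) (K : T -> Prop) (f : T -> R) (x0 : T) :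
  K x0 ->
  (forall X : nat -> T, (forall k, K (X k)) -> exists (phi : nat -> nat) l,
     (forall k, le k (phi k)) /\ K l /\ Un_cv (fun k => f (X (phi k))) (f l)) ->
  exists x, K x /\ forall y, K y -> f y <= f x.
Proof.
move=> Hx0 Hc.
have Hb : bound (fun y => exists x, K x /\ y = f x).
  apply: NNPP => Hnb.
  have H k : exists x, K x /\ INR k < f x.
    apply: NNPP => H; apply: Hnb; exists (INR k) => y [x [HK ->]].
    by apply: Rnot_lt_le => Hlt; apply: H; exists x.
  have [X HX] := choice_seq _ x0 _ H.
  have [phi [l [Hphi [_ Hl]]]] := Hc X (fun k => proj1 (HX k)).
  have [N HN] := Hl 1 Rlt_0_1.
  have [M HM] := INR_unbounded (f l + 1).
  have := HN (N + M)%coq_nat; rewrite /R_dist /ge => /(_ ltac:(lia)).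
  have [_] := HX (phi (N + M)%coq_nat).
  have := le_INR _ _ (Hphi (N + M)%coq_nat); rewrite plus_INR.
  have := pos_INR N; split_Rabs; lra.
have [M [HM1 HM2]] := completeness _ Hb (ex_intro _ (f x0) (ex_intro _ x0 (conj Hx0 erefl))).
have H k : exists x, K x /\ M - / (INR k + 1) < f x.
  apply: NNPP => H.
  have : M <= M - / (INR k + 1).
    apply: HM2 => y [x [HK ->]]; apply: Rnot_lt_le => Hlt; apply: H; exists x; split => //.
  have := inv_succ_pos k; lra.
have [X HX] := choice_seq _ x0 _ H.
have [phi [l [Hphi [HKl Hl]]]] := Hc X (fun k => proj1 (HX k)).
exists l; split => // y Hy; apply: Rle_trans (HM1 _ (ex_intro _ y (conj Hy erefl))) _.
apply: le_epsilon => eps He.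
have [N HN] := Hl (eps / 2) ltac:(lra).
have [N1 HN1] := inv_succ_small (eps / 2) ltac:(lra).
have := HN (N + N1)%coq_nat; rewrite /R_dist /ge => /(_ ltac:(lia)).
have [_] := HX (phi (N + N1)%coq_nat).
have := HN1 (phi (N + N1)%coq_nat); have := Hphi (N + N1)%coq_nat => Hp /(_ ltac:(lia)).
split_Rabs; lra.
Qed.

Lemma cont_xt_cv n (Dom : vec n -> R -> Prop) f (X : nat -> vec n) (u : nat -> R) x t :
  cont_xt Dom f -> Dom x t -> (forall k, Dom (X k) (u k)) -> vcv X x -> Un_cv u t ->
  Un_cv (fun k => f (X k) (u k)) (f x t).
Proof.
move=> Hf Hxt HD HX Hu eps He; have [d [Hd Hfd]] := Hf x t Hxt eps He.
have [N1 HN1] := vcv_eps _ _ _ HX d Hd; have [N2 HN2] := Hu d Hd.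
exists (N1 + N2)%coq_nat => k; rewrite /ge => Hk.
by apply: Hfd => //; [apply: HN1; lia | apply: HN2; rewrite /ge; lia].
Qed.

Lemma closure_cv n (U : vec n -> Prop) (X : nat -> vec n) x :
  (forall k, closure U (X k)) -> vcv X x -> closure U x.
Proof.
move=> HX Hcv eps He; have [N HN] := vcv_eps _ _ _ Hcv (eps / 2) ltac:(lra).
have [y [Hy1 Hy2]] := HX N (eps / 2) ltac:(lra); exists y; split => //.
have := vnorm_sub_triang n y (X N) x; have := HN N (le_n _); lra.
Qed.

Lemma closure_sub n (U : vec n -> Prop) x : U x -> closure U x.
Proof. by move=> Hx eps He; exists x; rewrite vnorm0. Qed.

Lemma Un_cv_bounds (u : nat -> R) l a b :
  Un_cv u l -> (forall k, a <= u k <= b) -> a <= l <= b.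
Proof.
move=> Hu Hb; split; apply: le_epsilon => eps He; have [N HN] := Hu eps He;
  have := HN N (le_n _); have := Hb N; rewrite /R_dist; split_Rabs; lra.
Qed.

Lemma vcv_dist_bound n (X Y : nat -> vec n) x y d :
  vcv X x -> vcv Y y -> (forall k, dist (X k) (Y k) <= d) -> dist x y <= d.
Proof.
move=> HX HY Hd; apply: le_epsilon => eps He.
have [N1 HN1] := vcv_eps _ _ _ HX (eps / 2) ltac:(lra).
have [N2 HN2] := vcv_eps _ _ _ HY (eps / 2) ltac:(lra).
have [k [Hk1 Hk2]] : exists k, le N1 k /\ le N2 k by exists (N1 + N2)%coq_nat; lia.
have := HN1 k Hk1; have := HN2 k Hk2; have := Hd k.
have := vnorm_sub_triang n x (X k) y; have := vnorm_sub_triang n (X k) (Y k) y.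
rewrite (vnorm_sub_sym n x (X k)); lra.
Qed.

Lemma vcv_const n (x : vec n) : vcv (fun=> x) x.
Proof. by apply: vcvI => eps He; exists O => k _; rewrite vnorm0. Qed.

(* Otherwise a limit of points of [U'] would be a limit of points outside the open set [U]. *)
Lemma uniform_interior_radius n (U U' : vec n -> Prop) B :
  is_open U -> (forall x, U x -> vnorm x <= B) -> (forall x, closure U' x -> U x) ->
  exists rho, 0 < rho /\ forall x y, U' x -> dist y x < rho -> U y.
Proof.
move=> HU HB HU'; apply: NNPP => Hno.
have H k : exists p : vec n * vec n,
    U' p.1 /\ vnorm (vsub p.2 p.1) < / (INR k + 1) /\ ~ U p.2.
  apply: NNPP => H; apply: Hno; exists (/ (INR k + 1)); split; first exact: inv_succ_pos.
  by move=> x y Hx Hxy; apply: NNPP => Hy; apply: H; exists (x, y).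
have [X HX] := choice_seq (vec n * vec n) ((fun=> 0), (fun=> 0)) _ H.
have [phi [x [Hphi Hx]]] := bolzano_weierstrass n (fun k => (X k).1) B
  (fun k => HB _ (HU' _ (closure_sub _ _ _ (proj1 (HX k))))).
have HxU : U x.
  by apply: HU'; apply: closure_cv Hx => k; apply: closure_sub; have [] := HX (phi k).
have [d [Hd HdU]] := HU x HxU.
have [N1 HN1] := vcv_eps _ _ _ Hx (d / 2) ltac:(lra).
have [N2 HN2] := inv_succ_small (d / 2) ltac:(lra).
have H1 := HN1 (N1 + N2)%coq_nat ltac:(lia).
move: H1 (Hphi (N1 + N2)%coq_nat); move: (phi _) => k H1 Hk.
have [_ [H2 H3]] := HX k; apply: H3; apply: HdU.
have H4 := HN2 k ltac:(lia).
have := vnorm_sub_triang n (X k).2 (X k).1 x.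
lra.
Qed.

(** * Partial derivatives along lines and second-order tests *)

Lemma derivable_pt_lim_littleo f x l :
  derivable_pt_lim f x l <-> forall eps, 0 < eps -> exists d, 0 < d /\
    forall h, Rabs h < d -> Rabs (f (x + h) - f x - l * h) <= eps * Rabs h.
Proof.
split=> H eps He.
  have [d Hd] := H eps He; exists d; split; first exact: cond_pos.
  move=> h Hh; case: (Req_dec h 0) => [->|Hh0].
    by rewrite Rplus_0_r Rminus_diag Rmult_0_r Rminus_0_r Rabs_R0; lra.
  have -> : f (x + h) - f x - l * h = ((f (x + h) - f x) / h - l) * h by field.
  rewrite Rabs_mult; apply: Rmult_le_compat_r; first exact: Rabs_pos.
  exact/Rlt_le/Hd.
have [d [Hd0 Hd]] := H (eps / 2) ltac:(lra); exists (mkposreal d Hd0) => h Hh0 Hh.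
have -> : (f (x + h) - f x) / h - l = (f (x + h) - f x - l * h) / h by field.
rewrite /Rdiv Rabs_mult Rabs_inv; have Ha := Rabs_pos_lt h Hh0.
apply: (Rle_lt_trans _ (eps / 2)); last lra.
apply: (Rmult_le_reg_r (Rabs h)) => //; rewrite Rmult_assoc Rinv_l; last lra.
by rewrite Rmult_1_r; apply: Hd.
Qed.

Lemma derivable_pt_lim_near f g x l d : 0 < d ->
  (forall y, Rabs (y - x) < d -> f y = g y) ->
  derivable_pt_lim f x l -> derivable_pt_lim g x l.
Proof.
move=> Hd H; apply: (derivable_pt_lim_locally_ext f g x (x - d) (x + d)); first lra.
by move=> y Hy; apply: H; apply: Rabs_def1; lra.
Qed.

Lemma derivable_pt_lim_shift f s l :
  derivable_pt_lim (fun h => f (s + h)) 0 l <-> derivable_pt_lim f s l.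
Proof.
split=> H eps He; have [d Hd] := H eps He; exists d => h H0 Hh;
  by have := Hd h H0 Hh; rewrite ?Rplus_0_l ?Rplus_0_r.
Qed.

Definition cont_on {n} (U : vec n -> Prop) (f : vec n -> R) :=
  forall x, U x -> forall eps, 0 < eps -> exists d, 0 < d /\
    forall y, U y -> dist y x < d -> Rabs (f y - f x) < eps.

Lemma vadd_scal_add n (x y : vec n) s h :
  vadd x (vscal (s + h) y) = vadd (vadd x (vscal s y)) (vscal h y).
Proof. by vec_ring. Qed.

Lemma partial_line n (f : vec n -> R) x i s l :
  has_partial f (vadd x (vscal s (ebasis i))) i l ->
  derivable_pt_lim (fun t => f (vadd x (vscal t (ebasis i)))) s l.
Proof.
move=> H; apply/derivable_pt_lim_shift; apply: derivable_pt_lim_ext H => h.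
by rewrite vadd_scal_add.
Qed.

Lemma partial_mvt n (f : vec n -> R) (g : vec n -> R) x i a :
  (forall s, Rabs s <= Rabs a -> has_partial f (vadd x (vscal s (ebasis i))) i
      (g (vadd x (vscal s (ebasis i))))) ->
  exists s, Rabs s <= Rabs a /\
    f (vadd x (vscal a (ebasis i))) - f x = g (vadd x (vscal s (ebasis i))) * a.
Proof.
move=> H.
pose F s := f (vadd x (vscal s (ebasis i))); pose G s := g (vadd x (vscal s (ebasis i))).
have HF s : Rabs s <= Rabs a -> derivable_pt_lim F s (G s).
  by move=> Hs; apply: partial_line; exact: H.
have -> : f x = F 0 by rewrite /F vadd_scal0.
case: (Rtotal_order a 0) => [Ha|[->|Ha]].
- have [s [H1 H2]] := MVT_cor2 F G a 0 Ha ltac:(by move=> s Hs; apply: HF; split_Rabs; lra).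
  by exists s; split; [split_Rabs; lra | rewrite /F /G in H1 *; lra].
- by exists 0; rewrite /F; split; [lra | ring].
have [s [H1 H2]] := MVT_cor2 F G 0 a Ha ltac:(by move=> s Hs; apply: HF; split_Rabs; lra).
by exists s; split; [split_Rabs; lra | rewrite /F /G in H1 *; lra].
Qed.

(** Passing from [k] to [k + 1] moves along a single basis vector, where a partial derivative is
    available. *)
Definition trunc {n} k (xi : vec n) : vec n := fun i => if (i < k)%nat then xi i else 0.

Lemma vnorm_trunc n k (xi : vec n) : vnorm (trunc k xi) <= vnorm xi.
Proof.
apply: sqrt_le_1_alt; apply: sumI_le => i; rewrite /trunc; case: ifP => _; nra.
Qed.

(* Telescoping over the coordinates, with the mean value theorem in each of them. *)
Lemma line_derivative0 n (U : vec n -> Prop) (f : vec n -> R) (g : vec n -> vec n) x xi :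
  is_open U -> (forall x i, U x -> has_partial f x i (g x i)) ->
  (forall i, cont_on U (fun x => g x i)) -> U x ->
  derivable_pt_lim (fun s => f (vadd x (vscal s xi))) 0 (dot (g x) xi).
Proof.
move=> HU Hp Hc Hx.
have H : forall k, (k <= n)%nat ->
    derivable_pt_lim (fun s => f (vadd x (vscal s (trunc k xi)))) 0 (dot (g x) (trunc k xi)).
  elim=> [_|k IH Hk].
    have -> : trunc 0 xi = vscal 0 xi.
      by apply: functional_extensionality => i; rewrite /trunc ltn0 /vscal; ring.
    rewrite dot_scalr Rmult_0_l; apply: (derivable_pt_lim_ext (fun=> f x)).
      move=> s; congr f; by vec_ring.
    exact: derivable_pt_lim_const.
  pose i := Ordinal Hk.
  have Et : trunc k.+1 xi = vadd (trunc k xi) (vscal (xi i) (ebasis i)).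
    apply: functional_extensionality => j; rewrite /trunc /vadd /vscal /ebasis ltnS.
    rewrite -val_eqE /= leq_eqVlt; case: eqP => [E|_] /=; last by case: ifP => _; ring.
    rewrite E ltnn; have -> : j = i by apply: val_inj.
    by ring.
  apply/derivable_pt_lim_littleo => eps He.
  have Hxi0 := vnorm_ge0 n xi.
  have Hxii := coord_le_vnorm n xi i.
  have HX : 0 < vnorm xi + 1 by lra.
  have [d1 [Hd1 Hk1]] := proj1 (derivable_pt_lim_littleo _ _ _) (IH (ltnW Hk)) (eps / 2) ltac:(lra).
  have [d2 [Hd2 Hk2]] := HU x Hx.
  have He3 : 0 < eps / 2 / (vnorm xi + 1) by apply: Rdiv_lt_0_compat; lra.
  have [d3 [Hd3 Hk3]] := Hc i x Hx _ He3.
  (* The second bound keeps both legs of the detour, of total length at most [2 |s| |xi|], in the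
     ball where [U] holds and [g] has small oscillation in its coordinate [i]. *)
  pose d := Rmin d1 (Rmin d2 d3 / (2 * (vnorm xi + 1))).
  have Hm : 0 < Rmin d2 d3 by apply: Rmin_pos.
  have Hdm : 0 < Rmin d2 d3 / (2 * (vnorm xi + 1)) by apply: Rdiv_lt_0_compat; lra.
  exists d; split; first exact: Rmin_pos.
  move=> s Hs.
  have Hs1 : Rabs s < d1 by apply: Rlt_le_trans Hs (Rmin_l _ _).
  have Hs2 : 2 * Rabs s * (vnorm xi + 1) < Rmin d2 d3.
    have : Rabs s < Rmin d2 d3 / (2 * (vnorm xi + 1)) by apply: Rlt_le_trans Hs (Rmin_r _ _).
    move=> H1; apply (Rmult_lt_compat_r (2 * (vnorm xi + 1))) in H1; last lra.
    have E : Rmin d2 d3 / (2 * (vnorm xi + 1)) * (2 * (vnorm xi + 1)) = Rmin d2 d3 by field; lra.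
    by rewrite E in H1; lra.
  pose y := vadd x (vscal s (trunc k xi)).
  have Hdist t : Rabs t <= Rabs (s * xi i) ->
      vnorm (vsub (vadd y (vscal t (ebasis i))) x) < Rmin d2 d3.
    move=> Ht; apply: Rle_lt_trans Hs2.
    have -> : vsub (vadd y (vscal t (ebasis i))) x
       = vadd (vscal s (trunc k xi)) (vscal t (ebasis i)).
      by apply: functional_extensionality => j; rewrite /y /vsub /vadd; ring.
    apply: Rle_trans (vnorm_triang _ _ _) _; rewrite !vnorm_scal vnorm_ebasis.
    rewrite Rabs_mult in Ht.
    have := vnorm_trunc n k xi; have := Rabs_pos s; nra.
  have HyU t : Rabs t <= Rabs (s * xi i) -> U (vadd y (vscal t (ebasis i))).
    by move=> Ht; apply: Hk2; apply: Rlt_le_trans (Hdist t Ht) (Rmin_l _ _).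
  have [t [Ht E]] := partial_mvt n f (fun z => g z i) y i (s * xi i)
    (fun t Ht => Hp _ _ (HyU t Ht)).
  have Hg := Hk3 _ (HyU t Ht) (Rlt_le_trans _ _ _ (Hdist t Ht) (Rmin_r _ _)).
  have {}Hk1 := Hk1 s Hs1; rewrite !Rplus_0_l in Hk1 *.
  have -> : vadd x (vscal s (trunc k.+1 xi)) = vadd y (vscal (s * xi i) (ebasis i)).
    by rewrite Et; apply: functional_extensionality => j; rewrite /y /vadd /vscal; ring.
  rewrite vadd_scal0 in Hk1; rewrite vadd_scal0.
  rewrite {1}Et dot_addr dot_scalr dot_ebasis.
  move: E Hg Hk1; rewrite -/y; move: (f (vadd y _)) (f y) (f x) (g (vadd y _) i) (g x i) (dot _ _).
  move=> a b c gy gx D E Hg Hk1.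
  have -> : a - c - (D + xi i * gx) * s = (b - c - D * s) + (s * ((gy - gx) * xi i)) by lra.
  apply: Rle_trans (Rabs_triang _ _) _; rewrite !Rabs_mult.
  have Hle : Rabs (gy - gx) * Rabs (xi i) <= eps / 2.
    apply: Rle_trans (Rmult_le_compat _ _ _ _ (Rabs_pos _) (Rabs_pos _) (Rlt_le _ _ Hg)
      (_ : _ <= vnorm xi + 1)) _; first lra.
    have -> : eps / 2 / (vnorm xi + 1) * (vnorm xi + 1) = eps / 2 by field; lra.
    by lra.
  have := Rabs_pos s; nra.
have := H n (leqnn n).
have -> : trunc n xi = xi by apply: functional_extensionality => i; rewrite /trunc ltn_ord.
by [].
Qed.

Lemma line_derivative n (U : vec n -> Prop) (f : vec n -> R) (g : vec n -> vec n) x xi s :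
  is_open U -> (forall x i, U x -> has_partial f x i (g x i)) ->
  (forall i, cont_on U (fun x => g x i)) -> U (vadd x (vscal s xi)) ->
  derivable_pt_lim (fun s => f (vadd x (vscal s xi))) s (dot (g (vadd x (vscal s xi))) xi).
Proof.
move=> HU Hp Hc Hx; apply/derivable_pt_lim_shift.
apply: derivable_pt_lim_ext (line_derivative0 n U f g _ xi HU Hp Hc Hx) => h.
by rewrite vadd_scal_add.
Qed.

Record C2_on {n} (U : vec n -> Prop) (f : vec n -> R) (Df : vec n -> vec n)
    (D2f : vec n -> 'I_n -> 'I_n -> R) : Prop := C2On {
  C2_D : forall x i, U x -> has_partial f x i (Df x i);
  C2_D2 : forall x i j, U x -> has_partial (fun y => Df y i) x j (D2f x i j);
  C2_Dc : forall i, cont_on U (fun x => Df x i);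
  C2_D2c : forall i j, cont_on U (fun x => D2f x i j) }.

Definition qform {n} (M : 'I_n -> 'I_n -> R) (xi : vec n) : R :=
  sumI (fun i => sumI (fun j => M i j * xi j) * xi i).

Lemma derivable_pt_lim_sumI n (F : 'I_n -> R -> R) (l : 'I_n -> R) s :
  (forall i, derivable_pt_lim (F i) s (l i)) ->
  derivable_pt_lim (fun t => sumI (fun i => F i t)) s (sumI l).
Proof.
move=> H; rewrite /sumI; move: (index_enum _) => r.
elim: r => [|i r IH].
  rewrite big_nil; apply: (derivable_pt_lim_ext (fun=> 0)); last exact: derivable_pt_lim_const.
  by move=> t; rewrite big_nil.
rewrite big_cons; apply: (derivable_pt_lim_ext (fun t => F i t + \big[Rplus/0]_(i <- r) F i t)).
  by move=> t; rewrite big_cons.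
exact: derivable_pt_lim_plus.
Qed.

Lemma open_line n (U : vec n -> Prop) x xi : is_open U -> U x ->
  exists d, 0 < d /\ forall s, Rabs s < d -> U (vadd x (vscal s xi)).
Proof.
move=> HU Hx; have [d [Hd HdU]] := HU x Hx; have H0 := vnorm_ge0 n xi.
exists (d / (vnorm xi + 1)); split; first by apply: Rdiv_lt_0_compat; lra.
move=> s Hs; apply: HdU; rewrite vsub_addl vnorm_scal.
have E : d / (vnorm xi + 1) * (vnorm xi + 1) = d by field; lra.
have := Rabs_pos s; nra.
Qed.

Lemma C2_line n U (f : vec n -> R) Df D2f x xi : is_open U -> C2_on U f Df D2f -> U x ->
  exists d, 0 < d /\
    (forall s, Rabs s < d -> derivable_pt_lim (fun s => f (vadd x (vscal s xi))) s
       (dot (Df (vadd x (vscal s xi))) xi)) /\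
    derivable_pt_lim (fun s => dot (Df (vadd x (vscal s xi))) xi) 0 (qform (D2f x) xi).
Proof.
move=> HU [H1 H2 H3 H4] Hx; have [d [Hd HdU]] := open_line n U x xi HU Hx.
exists d; split => //; split.
  by move=> s Hs; apply: (line_derivative n U f Df x xi s HU H1 H3); exact: HdU.
apply: derivable_pt_lim_sumI => i.
have H := line_derivative0 n U (fun y => Df y i) (fun y j => D2f y i j) x xi HU
  (fun y j => H2 y i j) (H4 i) Hx.
apply: (derivable_pt_lim_ext (mult_real_fct (xi i) (fun s => Df (vadd x (vscal s xi)) i))).
  by move=> s; rewrite /mult_real_fct; ring.
rewrite Rmult_comm; exact: derivable_pt_lim_scal.
Qed.

(** Once the parabola is subtracted, 0 is a local maximum. A positive second derivative there would
    make the first derivative positive just to the right of 0, and the mean value theorem would lift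
    the function above its maximum. *)
Lemma second_order_max (h h1 : R -> R) h2 b c d : 0 < d ->
  (forall s, Rabs s < d -> derivable_pt_lim h s (h1 s)) ->
  derivable_pt_lim h1 0 h2 ->
  (forall s, Rabs s < d -> h s <= h 0 + b * s + c * s ^ 2) ->
  h1 0 = b /\ h2 <= 2 * c.
Proof.
move=> Hd H1 H2 Hle.
pose k s := h s - (b * s + c * s ^ 2); pose k1 s := h1 s - (b + 2 * c * s).
have Hk s : Rabs s < d -> derivable_pt_lim k s (k1 s).
  move=> Hs; apply: derivable_pt_lim_minus; first exact: H1.
  by apply/is_derive_Reals; auto_derive => //; ring.
have Hk2 : derivable_pt_lim k1 0 (h2 - 2 * c).
  apply: derivable_pt_lim_minus => //.
  by apply/is_derive_Reals; auto_derive => //; ring.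
have Hmax s : Rabs s < d -> k s <= k 0 by move=> /Hle; rewrite /k; lra.
have Hk10 : k1 0 = 0.
  have pr : derivable_pt_lim k 0 (k1 0) by apply: Hk; rewrite Rabs_R0.
  rewrite -(derive_pt_eq_0 _ _ _ (exist _ _ pr) pr).
  apply: (deriv_maximum k (- d) d); try lra.
  by move=> s Hs1 Hs2; apply: Hmax; apply: Rabs_def1.
split; first by rewrite /k1 in Hk10; lra.
apply: Rnot_lt_le => Hlt.
have [e [He Hke]] := proj1 (derivable_pt_lim_littleo _ _ _) Hk2 ((h2 - 2 * c) / 2) ltac:(lra).
pose s := Rmin e d / 2.
have Hm : 0 < Rmin e d by apply: Rmin_pos.
have Hs : 0 < s by rewrite /s; lra.
have Hse : s < e by have := Rmin_l e d; rewrite /s; lra.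
have Hsd : s < d by have := Rmin_r e d; rewrite /s; lra.
have [r [Er Hr]] := MVT_cor2 k k1 0 s Hs ltac:(by move=> r Hr; apply: Hk; apply: Rabs_def1; lra).
have := Hke r ltac:(apply: Rabs_def1; lra).
rewrite Rplus_0_l Hk10 (Rabs_pos_eq r); last lra.
have := Hmax s ltac:(apply: Rabs_def1; lra).
move=> H3 H4; have : 0 < k1 r by move: H4; split_Rabs; nra.
by move=> H5; nra.
Qed.

(** The two points move along their own directions. With [f = g] this serves the doubling argument,
    with [x = y] and two functions the comparison principle. *)
Lemma touching_test n U (f g : vec n -> R) Df D2f Dg D2g x y xi zeta b c d :
  is_open U -> C2_on U f Df D2f -> C2_on U g Dg D2g -> U x -> U y -> 0 < d ->
  (forall s, Rabs s < d -> f (vadd x (vscal s xi)) - g (vadd y (vscal s zeta))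
     <= f x - g y + b * s + c * s ^ 2) ->
  dot (Df x) xi - dot (Dg y) zeta = b /\ qform (D2f x) xi - qform (D2g y) zeta <= 2 * c.
Proof.
move=> HU Hf Hg Hx Hy Hd H.
have [d1 [Hd1 [F1 F2]]] := C2_line n U f Df D2f x xi HU Hf Hx.
have [d2 [Hd2 [G1 G2]]] := C2_line n U g Dg D2g y zeta HU Hg Hy.
pose e := Rmin d (Rmin d1 d2).
have He : 0 < e by apply: Rmin_pos => //; apply: Rmin_pos.
have Hel s : Rabs s < e -> Rabs s < d /\ Rabs s < d1 /\ Rabs s < d2.
  by have := Rmin_l d (Rmin d1 d2); have := Rmin_r d (Rmin d1 d2);
     have := Rmin_l d1 d2; have := Rmin_r d1 d2; rewrite /e; lra.
have := second_order_max
  (fun s => f (vadd x (vscal s xi)) - g (vadd y (vscal s zeta)))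
  (fun s => dot (Df (vadd x (vscal s xi))) xi - dot (Dg (vadd y (vscal s zeta))) zeta)
  (qform (D2f x) xi - qform (D2g y) zeta) b c e He.
rewrite !vadd_scal0; apply.
- by move=> s /Hel [_ [? ?]]; apply: derivable_pt_lim_minus; [exact: F1|exact: G1].
- exact: derivable_pt_lim_minus.
by move=> s /Hel [Hs _]; exact: H.
Qed.

(** * Interior gradient estimate by doubling the variables *)

(** Its slope [1 - s / (2 d)] stays between 1/2 and 1 on [[0, d]]. Its second derivative
    [- 1 / (2 d)], times the squared speed [4 e_k^2] of a reflected motion and summed over [k],
    gives [- 2 / d]. *)
Definition modulus (d s : R) : R := s - s * s / (4 * d).

(** Maximality of the doubling function at a frozen time, with the increment of [K |x - x0|^2]
    expanded. The spatial tests thus depend neither on time nor on the set over which the maximum is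
    taken. *)
Definition small_displacement_bound {n} (f : vec n -> R) (x y x0 : vec n) (L K d : R) :=
  exists r, 0 < r /\ forall xi zeta, vnorm xi < r -> vnorm zeta < r ->
    f (vadd x xi) - f (vadd y zeta) <= f x - f y
      + L * (modulus d (vnorm (vadd (vsub x y) (vsub xi zeta))) - modulus d (dist x y))
      + K * (2 * dot (vsub x x0) xi + dot xi xi).

Lemma scal_small n (xi : vec n) r : 0 < r ->
  exists d, 0 < d /\ forall s, Rabs s < d -> vnorm (vscal s xi) < r.
Proof.
move=> Hr; have H0 := vnorm_ge0 n xi.
exists (r / (vnorm xi + 1)); split; first by apply: Rdiv_lt_0_compat; lra.
move=> s Hs; rewrite vnorm_scal.
have E : r / (vnorm xi + 1) * (vnorm xi + 1) = r by field; lra.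
have := Rabs_pos s; nra.
Qed.

Lemma vsub_scal n s (x y : vec n) : vsub (vscal s x) (vscal s y) = vscal s (vsub x y).
Proof. by vec_ring. Qed.

Lemma vnorm_add_scal_sq n (v w : vec n) t :
  vnorm (vadd v (vscal t w)) * vnorm (vadd v (vscal t w))
    = vnorm v * vnorm v + 2 * t * dot v w + t * t * dot w w.
Proof. by rewrite !vnorm_sq !dotE (dotC n w v); ring. Qed.

Lemma Rdiv_mult_simpl a b : b <> 0 -> a / b * b = a.
Proof. by move=> H; field. Qed.

(* The norm is bounded by the quadratic [(|w|^2 + |v|^2) / (2 |v|)], which touches it at [w = v]. *)
Lemma doubling_test n U (f : vec n -> R) Df D2f x y x0 L K d xi zeta :
  is_open U -> C2_on U f Df D2f -> U x -> U y -> 0 < d -> 0 <= L ->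
  0 < dist x y -> small_displacement_bound f x y x0 L K d ->
  dot (Df x) xi - dot (Df y) zeta
    = L * dot (vsub x y) (vsub xi zeta) * (/ dist x y - / (2 * d))
      + 2 * K * dot (vsub x x0) xi /\
  qform (D2f x) xi - qform (D2f y) zeta
    <= L * dot (vsub xi zeta) (vsub xi zeta) * (/ dist x y - / (2 * d))
       + 2 * K * dot xi xi.
Proof.
move=> HU Hf Hx Hy Hd HL Hs [r [Hr H]].
have [d1 [Hd1 H1]] := scal_small n xi r Hr; have [d2 [Hd2 H2]] := scal_small n zeta r Hr.
pose v := vsub x y; pose s := vnorm v; pose de := vsub xi zeta.
have Hsq : dot v v = s * s by rewrite vnorm_sq.
have [||E1 E2] := touching_test n U f f Df D2f Df D2f x y xi zeta
  (L * dot v de * (/ s - / (2 * d)) + 2 * K * dot (vsub x x0) xi)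
  (L * dot de de * (/ s - / (2 * d)) / 2 + K * dot xi xi) (Rmin d1 d2)
  HU Hf Hf Hx Hy.
- exact: Rmin_pos.
- move=> t Ht.
  have Ht1 : Rabs t < d1 by apply: Rlt_le_trans Ht (Rmin_l _ _).
  have Ht2 : Rabs t < d2 by apply: Rlt_le_trans Ht (Rmin_r _ _).
  apply: Rle_trans (H _ _ (H1 t Ht1) (H2 t Ht2)) _.
  rewrite vsub_scal -/v -/de -/s.
  have := vnorm_add_scal_sq n v de t; rewrite !(dot_scall n t) !(dot_scalr n t) -/s.
  move: (vnorm_ge0 n (vadd v (vscal t de))); move: (vnorm (vadd v (vscal t de))) => w Hw Ew.
  have Hm : modulus d w - modulus d s <=
      t * dot v de * (/ s - / (2 * d)) + t * t * dot de de * (/ s - / (2 * d)) / 2.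
    have Hws : w <= (w * w + s * s) / (2 * s).
      apply: (Rmult_le_reg_r (2 * s)); first by rewrite /s /v; lra.
      rewrite Rdiv_mult_simpl; last by rewrite /s /v; lra.
      by have := Rle_0_sqr (w - s); rewrite /Rsqr; lra.
    have -> : modulus d w = w - w * w / (4 * d) by [].
    rewrite /modulus; apply: (Rle_trans _ ((w * w + s * s) / (2 * s) - w * w / (4 * d) - (s - s * s / (4 * d)))); first lra.
    rewrite Ew; apply: Req_le; field; split; [lra|rewrite /s /v; lra].
  have := Rmult_le_compat_l L _ _ HL Hm; lra.
by rewrite /de /s /v in E1 E2; split => //; lra.
Qed.

Lemma qform_ebasis n (M : 'I_n -> 'I_n -> R) k : qform M (ebasis k) = M k k.
Proof.
rewrite /qform -[RHS](dot_ebasis n (fun i => M i k) k); apply: sumI_ext => i.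
congr (_ * _); exact: (dot_ebasis n (fun j => M i j) k).
Qed.

Definition reflected {n} (e : vec n) (k : 'I_n) : vec n := vsub (ebasis k) (vscal (2 * e k) e).

(* Moving [x] along [e_k] and [y] along its mirror image changes [x - y] along [x - y] only, where the norm is linear. *)
Lemma doubling_test_reflected n U (f : vec n -> R) Df D2f x y x0 L K d (k : 'I_n) :
  is_open U -> C2_on U f Df D2f -> U x -> U y -> 0 < d ->
  0 < dist x y -> small_displacement_bound f x y x0 L K d ->
  let e := vscal (/ dist x y) (vsub x y) in
  D2f x k k - qform (D2f y) (reflected e k) <= - 2 * L * (e k * e k) / d + 2 * K.
Proof.
move=> HU Hf Hx Hy Hd Hs [r [Hr H]] e.
pose v := vsub x y; pose s := vnorm v.
have [d1 [Hd1 H1]] := scal_small n (ebasis k) r Hr.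
have [d2 [Hd2 H2]] := scal_small n (reflected e k) r Hr.
(* This radius keeps [s + t (2 e_k)] positive, so that the moving difference does not cross 0 and
   its norm stays linear in [t]. *)
have [d3 [Hd3 H3]] := scal_small n (vscal (2 * e k) e) s Hs.
have Hee : dot e e = 1.
  by rewrite /e dot_scall dot_scalr -vnorm_sq; field; lra.
have He i : x i - y i = s * e i.
  by rewrite /e /vscal /s /v /vsub; field; rewrite /vsub in Hs; lra.
clearbody e.
have [||E1 E2] := touching_test n U f f Df D2f Df D2f x y (ebasis k) (reflected e k)
  (L * (2 * e k * (1 - s / (2 * d))) + 2 * K * vsub x x0 k)
  (- L * (e k * e k) / d + K) (Rmin d1 (Rmin d2 d3)) HU Hf Hf Hx Hy.
- by apply: Rmin_pos => //; apply: Rmin_pos.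
- move=> t Ht.
  have Ht' : Rabs t < Rmin d2 d3 by apply: Rlt_le_trans Ht (Rmin_r _ _).
  have Ht1 : Rabs t < d1 by apply: Rlt_le_trans Ht (Rmin_l _ _).
  have Ht2 : Rabs t < d2 by apply: Rlt_le_trans Ht' (Rmin_l _ _).
  have Ht3 : Rabs t < d3 by apply: Rlt_le_trans Ht' (Rmin_r _ _).
  apply: Rle_trans (H _ _ (H1 t Ht1) (H2 t Ht2)) _.
  have Ev : vadd (vsub x y) (vsub (vscal t (ebasis k)) (vscal t (reflected e k)))
      = vscal (s + t * (2 * e k)) e.
    apply: functional_extensionality => i; rewrite /reflected /vadd /vsub /vscal.
    by rewrite He; ring.
  have Hne : vnorm e = 1 by rewrite -sqrt_1; congr sqrt.
  have Hpos : 0 < s + t * (2 * e k).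
    have := H3 t Ht3; rewrite !vnorm_scal Hne Rmult_1_r -Rabs_mult => Habs.
    by have := Rle_abs (- (t * (2 * e k))); rewrite Rabs_Ropp; lra.
  rewrite Ev vnorm_scal Hne Rmult_1_r (Rabs_pos_eq _ (Rlt_le _ _ Hpos)) -/v -/s.
  rewrite (dot_scall n t) !(dot_scalr n t) !dot_ebasis /ebasis eqxx /modulus.
  by apply: Req_le; field; lra.
rewrite qform_ebasis in E2; apply: Rle_trans E2 _; apply: Req_le; field; lra.
Qed.

Lemma sum_qform n (M : 'I_n -> 'I_n -> R) (X : 'I_n -> vec n) :
  sumI (fun k => qform M (X k)) = sumI (fun i => sumI (fun j => M i j * sumI (fun k => X k i * X k j))).
Proof.
rewrite /qform sumI_exch; apply: sumI_ext => i.
transitivity (sumI (fun k => sumI (fun j => M i j * (X k i * X k j)))).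
  by apply: sumI_ext => k; rewrite -sumI_scalr; apply: sumI_ext => j; ring.
by rewrite sumI_exch; apply: sumI_ext => j; rewrite sumI_scal.
Qed.

(** The reflected basis is orthonormal, so the Gram matrix in [sum_qform] is the identity: the tests
    at [y], although reflected, still add up to the full trace. *)
Lemma sum_qform_reflected n (M : 'I_n -> 'I_n -> R) (e : vec n) : dot e e = 1 ->
  sumI (fun k => qform M (reflected e k)) = sumI (fun i => M i i).
Proof.
move=> He; rewrite sum_qform; apply: sumI_ext => i.
rewrite -[RHS](sumI_idr n i (fun j => M i j)); apply: sumI_ext => j; congr (_ * _).
transitivity (sumI (fun k => idmat n i k * idmat n j k) - 2 * e i * sumI (fun k => e k * idmat n j k)
   - 2 * e j * sumI (fun k => e k * idmat n i k) + 4 * e i * e j * dot e e).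
  rewrite -!sumI_scal -!sumI_sub -sumI_add; apply: sumI_ext => k.
  by rewrite /reflected /vsub /vscal /ebasis /idmat; ring.
rewrite sumI_idl !sumI_idr He idmatC; ring.
Qed.

(** One-sided, because a maximum over a time interval may be attained at its final time. *)
Lemma left_max_derivative h t l d : 0 < d -> derivable_pt_lim h t l ->
  (forall s, t - d < s <= t -> h s <= h t) -> 0 <= l.
Proof.
move=> Hd H Hmax; apply: Rnot_lt_le => Hl.
have [e [He Hke]] := proj1 (derivable_pt_lim_littleo _ _ _) H (- l / 2) ltac:(lra).
have Hm : 0 < Rmin e d by apply: Rmin_pos.
have := Rmin_l e d; have := Rmin_r e d => H1 H2.
pose s := Rmin e d / 2.
have := Hke (- s) ltac:(rewrite /s; split_Rabs; lra).
have := Hmax (t + - s) ltac:(rewrite /s; lra).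
rewrite Rabs_Ropp (Rabs_pos_eq s); last by rewrite /s; lra.
have Hs : 0 < s by rewrite /s; lra.
by split_Rabs; nra.
Qed.

(** This is [tr ((lam I + P P^T) M)], written as second derivatives along the basis vectors and the
    columns of [P], the directions in which the tests are made. *)
Definition elliptic_part {n} (lam : R) (P : mat n) (M : 'I_n -> 'I_n -> R) : R :=
  lam * sumI (fun i => M i i) + sumI (fun k => qform M (fun i => P i k)).

Definition parabolic_on {n} (lam : R) (P : vec n -> mat n) (beta : vec n -> vec n)
    (F : vec n -> R -> R) (w : vec n -> R -> R) (Dw : vec n -> R -> vec n)
    (D2w : vec n -> R -> 'I_n -> 'I_n -> R) (wt : vec n -> R -> R) (x : vec n) (t : R) :=
  derivable_pt_lim (fun s => w x s) t (wt x t) /\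
  wt x t = elliptic_part lam (P x) (D2w x t) + dot (beta x) (Dw x t) + F x t.

Lemma modulus_le d s : 0 < d -> modulus d s <= s.
Proof.
move=> Hd; rewrite /modulus.
have : 0 <= s * s / (4 * d) by apply: Rdiv_le_0_compat; nra.
lra.
Qed.

Lemma modulus_continuity d u l : Un_cv u l -> Un_cv (fun k => modulus d (u k)) (modulus d l).
Proof.
move=> Hu; apply: CV_minus => //; apply: CV_mult; last first.
  by move=> e He; exists O => k _; rewrite /R_dist Rminus_diag Rabs_R0.
exact: CV_mult.
Qed.

Lemma vcv_vnorm n (X : nat -> vec n) x : vcv X x -> Un_cv (fun k => vnorm (X k)) (vnorm x).
Proof.
move=> H eps He; have [N HN] := vcv_eps _ _ _ H eps He; exists N => k Hk.
exact: Rle_lt_trans (vnorm_diff _ _ _) (HN k Hk).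
Qed.

Lemma vcv_vsub n (X Y : nat -> vec n) x y :
  vcv X x -> vcv Y y -> vcv (fun k => vsub (X k) (Y k)) (vsub x y).
Proof.
move=> HX HY; apply: vcvI => eps He.
have [N1 HN1] := vcv_eps _ _ _ HX (eps / 2) ltac:(lra).
have [N2 HN2] := vcv_eps _ _ _ HY (eps / 2) ltac:(lra).
exists (N1 + N2)%coq_nat => k Hk.
have -> : vsub (vsub (X k) (Y k)) (vsub x y) = vadd (vsub (X k) x) (vsub y (Y k)) by vec_ring.
apply: Rle_lt_trans (vnorm_triang _ _ _) _; rewrite (vnorm_sub_sym n y).
have := HN1 k ltac:(lia); have := HN2 k ltac:(lia); lra.
Qed.

Lemma Un_cv_const (c : R) : Un_cv (fun=> c) c.
Proof. by move=> e He; exists O => k _; rewrite /R_dist Rminus_diag Rabs_R0. Qed.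

Lemma abs_dot_le n (x y : vec n) a b : vnorm x <= a -> vnorm y <= b -> Rabs (dot x y) <= a * b.
Proof.
move=> Ha Hb; apply: Rle_trans (cauchy_schwarz _ _ _) _.
by apply: Rmult_le_compat => //; exact: vnorm_ge0.
Qed.

Definition doubling_fun {n} (w : vec n -> R -> R) (x0 : vec n) t0 L K1 K2 d
    (p : vec n * vec n * R) : R :=
  w p.1.1 p.2 - w p.1.2 p.2 - L * modulus d (vnorm (vsub p.1.1 p.1.2))
  - K1 * dot (vsub p.1.1 x0) (vsub p.1.1 x0) - K2 * (t0 - p.2).

(** The radius [rho / 2] for the first point leaves room for the second: if [d <= rho / 2], both
    stay within [rho] of [x0]. *)
Definition doubling_dom {n} (x0 : vec n) t0 rho d (p : vec n * vec n * R) : Prop :=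
  vnorm (vsub p.1.1 x0) <= rho / 2 /\ vnorm (vsub p.1.1 p.1.2) <= d /\
  t0 - rho * rho <= p.2 <= t0.

Lemma doubling_max_exists n (w : vec n -> R -> R) (x0 : vec n) t0 rho L K1 K2 d :
  0 < rho -> 0 < d <= rho / 2 ->
  cont_xt (fun x t => dist x x0 <= rho /\ t0 - rho * rho <= t <= t0) w ->
  exists p, doubling_dom x0 t0 rho d p /\
    forall p', doubling_dom x0 t0 rho d p' ->
      doubling_fun w x0 t0 L K1 K2 d p' <= doubling_fun w x0 t0 L K1 K2 d p.
Proof.
move=> Hrho Hd Hw.
have Hball x y : dist x x0 <= rho / 2 -> dist x y <= d ->
    dist y x0 <= rho.
  move=> H1 H2; have := vnorm_sub_triang n y x x0; rewrite (vnorm_sub_sym n y x); lra.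
have Hb x : dist x x0 <= rho -> vnorm x <= rho + vnorm x0.
  by move=> H; have := vnorm_diff n x x0; split_Rabs; lra.
apply: (seq_compact_max _ _ _ (x0, x0, t0)).
  by rewrite /doubling_dom /= !vnorm0; nra.
move=> X HX.
have HX1 k : vnorm (vsub (X k).1.1 x0) <= rho by apply: Rle_trans (proj1 (HX k)) _; lra.
have HX3 k : Rabs (X k).2 <= Rabs t0 + rho * rho by have [_ [_ ?]] := HX k; split_Rabs; nra.
have [p1 [x [Hp1 Hx]]] := bolzano_weierstrass n (fun k => (X k).1.1) (rho + vnorm x0)
  (fun k => Hb _ (HX1 k)).
have [p2 [y [Hp2 Hy]]] := bolzano_weierstrass n (fun k => (X (p1 k)).1.2) (rho + vnorm x0)
  (fun k => Hb _ (Hball _ _ (proj1 (HX (p1 k))) (proj1 (proj2 (HX (p1 k)))))).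
have [p3 [t [Hp3 Ht]]] := bolzano_weierstrass_R (fun k => (X (p1 (p2 k))).2)
  (Rabs t0 + rho * rho) (fun k => HX3 (p1 (p2 k))).
pose phi k := p1 (p2 (p3 k)).
have Hphi k : le k (phi k).
  by have := Hp1 (p2 (p3 k)); have := Hp2 (p3 k); have := Hp3 k; rewrite /phi; lia.
have {}Hx : vcv (fun k => (X (phi k)).1.1) x.
  apply: (vcv_sub n (fun k => (X (p1 k)).1.1) x (fun k => p2 (p3 k))) => // k.
  by have := Hp2 (p3 k); have := Hp3 k; lia.
have {}Hy : vcv (fun k => (X (phi k)).1.2) y.
  exact: (vcv_sub n (fun k => (X (p1 (p2 k))).1.2) y p3).
have HK : doubling_dom x0 t0 rho d (x, y, t).
  split; [|split] => /=.
  - by apply: vcv_dist_bound Hx (vcv_const n x0) _ => k; have [] := HX (phi k).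
  - by apply: vcv_dist_bound Hx Hy _ => k; have [_ []] := HX (phi k).
  - by apply: Un_cv_bounds Ht _ => k; have [_ []] := HX (phi k).
exists phi, (x, y, t); split => //; split => //.
have [HK1 [HK2 HK3]] := HK; rewrite /= in HK1 HK2 HK3.
rewrite /doubling_fun /=.
apply: CV_minus; last first.
  by apply: CV_mult; [exact: Un_cv_const | apply: CV_minus => //; exact: Un_cv_const].
apply: CV_minus; last first.
  apply: CV_mult; first exact: Un_cv_const.
  rewrite -vnorm_sq.
  have H : Un_cv (fun k => vnorm (vsub (X (phi k)).1.1 x0)) (dist x x0).
    by apply: vcv_vnorm; apply: vcv_vsub => //; exact: vcv_const.
  apply: (Un_cv_ext (fun k => vnorm (vsub (X (phi k)).1.1 x0) * vnorm (vsub (X (phi k)).1.1 x0))).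
    by move=> k; rewrite vnorm_sq.
  exact: CV_mult.
apply: CV_minus; last first.
  apply: CV_mult; first exact: Un_cv_const.
  by apply: modulus_continuity; apply: vcv_vnorm; exact: vcv_vsub.
apply: CV_minus.
  apply: (cont_xt_cv _ _ _ _ (fun k => (X (phi k)).2) _ _ Hw) => //; first by split => //; lra.
  by move=> k; have [H [_ ?]] := HX (phi k); split => //; lra.
apply: (cont_xt_cv _ _ _ _ (fun k => (X (phi k)).2) _ _ Hw) => //; first by split => //; exact: Hball HK2.
by move=> k; have [H [H' ?]] := HX (phi k); split => //; exact: Hball H'.
Qed.

(** [Tr] bounds the squared Frobenius norm of [P], and [Lp] is the square of a Lipschitz constant of
    [P] in that norm. At the bottom time of the cylinder only continuity and the bound of [w] are
    asked. *)
Record solution_near {n} (U : vec n -> Prop) lam P beta F w Dw D2w wt x0 t0 rho M MF Lp Tr Bb : Prop :=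
  SolutionNear {
  sn_open : is_open U;
  sn_ball : forall y, dist y x0 <= rho -> U y;
  sn_cont : cont_xt (fun x t => dist x x0 <= rho /\ t0 - rho * rho <= t <= t0) w;
  sn_C2 : forall t, t0 - rho * rho < t <= t0 ->
     C2_on U (fun x => w x t) (fun x => Dw x t) (fun x => D2w x t);
  sn_eq : forall x t, dist x x0 <= rho -> t0 - rho * rho < t <= t0 ->
     parabolic_on lam P beta F w Dw D2w wt x t;
  sn_w : forall x t, dist x x0 <= rho -> t0 - rho * rho <= t <= t0 -> Rabs (w x t) <= M;
  sn_F : forall x t, dist x x0 <= rho -> t0 - rho * rho < t <= t0 -> Rabs (F x t) <= MF;
  sn_beta : forall x, dist x x0 <= rho -> vnorm (beta x) <= Bb;
  sn_tr : forall x, dist x x0 <= rho ->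
     sumI (fun k => dot (fun i => P x i k) (fun i => P x i k)) <= Tr;
  sn_lip : forall x y, dist x x0 <= rho -> dist y x0 <= rho ->
     sumI (fun k => dot (vsub (fun i => P x i k) (fun i => P y i k))
                        (vsub (fun i => P x i k) (fun i => P y i k)))
     <= Lp * (dist x y * dist x y) }.

(** The three inequalities with [M] keep a maximizer of positive value off [|x - x0| = rho / 2], off
    the initial time and off [|x - y| = d]. The condition [d (Lp d + 2 Bb) <= lam] lets half of the
    good term [2 lam L / d] absorb all errors proportional to [L]; by the last, strict inequality
    the other half exceeds everything else. *)
Lemma doubling_estimate n (U : vec n -> Prop) lam P beta F w Dw D2w wt
    (x0 : vec n) t0 rho M MF Lp Tr Bb L K1 K2 d :
  solution_near U lam P beta F w Dw D2w wt x0 t0 rho M MF Lp Tr Bb ->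
  0 < lam -> 0 < rho -> 0 < d <= rho / 2 -> 0 < L -> 0 <= K1 -> 0 <= K2 -> 0 <= Bb -> 0 <= M ->
  0 <= Lp ->
  8 * M <= K1 * (rho * rho) -> 2 * M <= K2 * (rho * rho) -> 8 * M <= 3 * (L * d) ->
  d * (Lp * d + 2 * Bb) <= lam ->
  d * (K2 + 2 * lam * INR n * K1 + 2 * K1 * Tr + K1 * rho * Bb + 2 * MF) < lam * L ->
  forall y, dist x0 y <= d -> w x0 t0 - w y t0 <= L * dist x0 y.
Proof.
move=> [HU HbU Hw HC2 Heq HwM HFM HbM HTr HLp] Hlam Hrho Hd HL HK1 HK2 HBb HM HLp0 H8 H2 H3 Hdl Hfin y0 Hy0.
have [[[x y] t] [[Hx [Hxy Ht]] Hmax]] :=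
  doubling_max_exists n w x0 t0 rho L K1 K2 d Hrho Hd Hw.
rewrite /= in Hx Hxy Ht.
have Hball x' y' : dist x' x0 <= rho / 2 -> dist x' y' <= d ->
    dist y' x0 <= rho.
  by move=> h1 h2; have := vnorm_sub_triang n y' x' x0; rewrite (vnorm_sub_sym n y' x'); lra.
(* A nonpositive maximum, compared with the competitor [(x0, y0, t0)], gives the claim because
   [modulus d s <= s]. A positive one is refuted below. *)
case: (Rle_or_lt (doubling_fun w x0 t0 L K1 K2 d (x, y, t)) 0) => [Hle|Hgt].
  have := Hmax (x0, y0, t0) ltac:(rewrite /doubling_dom /= vnorm0; nra).
  rewrite /doubling_fun /= in Hle *; rewrite -(vnorm_sq n (vsub x0 x0)) vnorm0.
  have := modulus_le d (dist x0 y0) ltac:(lra).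
  by move=> h; have := Rmult_le_compat_l L _ _ (Rlt_le _ _ HL) h; lra.
exfalso.
rewrite /doubling_fun /= -vnorm_sq in Hgt.
have Hyb := Hball _ _ Hx Hxy.
have Hxb : dist x x0 <= rho by lra.
have HwB : w x t - w y t <= 2 * M.
  by have := HwM x t Hxb Ht; have := HwM y t Hyb Ht; split_Rabs; lra.
have Hs0 := vnorm_ge0 n (vsub x y); have Hx0 := vnorm_ge0 n (vsub x x0).
have Hmod0 : 0 <= modulus d (dist x y).
  rewrite /modulus; set s := vnorm _ in Hxy Hs0 *.
  have -> : s - s * s / (4 * d) = s * (4 * d - s) / (4 * d) by field; lra.
  by apply: Rdiv_le_0_compat; nra.
have HLm := Rmult_le_pos _ _ (Rlt_le _ _ HL) Hmod0.
have HKx := Rmult_le_pos _ _ HK1 (Rle_0_sqr (dist x x0)); rewrite /Rsqr in HKx.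
have HKt := Rmult_le_pos _ _ HK2 (_ : 0 <= t0 - t).
have {}HKt := HKt ltac:(lra).
have Hs : 0 < dist x y.
  apply: Rnot_le_lt => h; have E : x = y.
    apply: functional_extensionality => i.
    by have := coord_le_vnorm n (vsub x y) i; rewrite /vsub in h *; split_Rabs; lra.
  by rewrite E in Hgt HKx HLm; lra.
have Hsd : dist x y < d.
  apply: Rnot_le_lt => h; have E : dist x y = d by lra.
  rewrite E in Hgt; have Em : modulus d d = 3 * d / 4 by rewrite /modulus; field; lra.
  by rewrite Em in Hgt; lra.
have Hxr : dist x x0 < rho / 2.
  apply: Rnot_le_lt => h; have E : dist x x0 = rho / 2 by lra.
  by rewrite E in Hgt; lra.
have Htr : t0 - rho * rho < t.
  apply: Rnot_le_lt => h; have E : t0 - t = rho * rho by lra.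
  by rewrite E in Hgt; lra.
have Ht' : t0 - rho * rho < t <= t0 by lra.
have [Htx Ex] := Heq x t Hxb Ht'; have [Hty Ey] := Heq y t Hyb Ht'.
have Hsm : small_displacement_bound (fun z => w z t) x y x0 L K1 d.
  pose r := Rmin (rho / 2 - dist x x0) ((d - dist x y) / 2).
  exists r; split; first by apply: Rmin_pos; lra.
  move=> xi zeta Hxi Hze.
  have Hr1 : r <= rho / 2 - dist x x0 by exact: Rmin_l.
  have Hr2 : r <= (d - dist x y) / 2 by exact: Rmin_r.
  have E1 : vsub (vadd x xi) (vadd y zeta) = vadd (vsub x y) (vsub xi zeta).
    by vec_ring.
  have E2 : vsub (vadd x xi) x0 = vadd (vsub x x0) xi.
    by vec_ring.
  have Hd1 : doubling_dom x0 t0 rho d (vadd x xi, vadd y zeta, t).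
    split; [|split] => //=; [rewrite E2|rewrite E1].
      by have := vnorm_triang n (vsub x x0) xi; lra.
    have := vnorm_triang n (vsub x y) (vsub xi zeta).
    have := vnorm_sub_triang n xi (fun=> 0) zeta.
    have -> : vsub xi (fun=> 0) = xi by vec_ring.
    rewrite (vnorm_sub_sym n (fun=> 0) zeta).
    have -> : vsub zeta (fun=> 0) = zeta by vec_ring.
    by lra.
  have := Hmax _ Hd1; rewrite /doubling_fun /= E1 E2.
  rewrite (dot_addl n (vsub x x0)) !(dot_addr n _ (vsub x x0)) (dotC n xi (vsub x x0)).
  by lra.
have Htime : 0 <= wt x t - wt y t + K2.
  apply: (left_max_derivative (fun s => w x s - w y s + K2 * s) t _ (t - (t0 - rho * rho))).
  - by lra.
  - apply: derivable_pt_lim_plus; first exact: derivable_pt_lim_minus.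
    by apply/is_derive_Reals; auto_derive => //; ring.
  move=> s Hs'; have := Hmax (x, y, s) ltac:(by split; [|split] => //=; lra).
  by rewrite /doubling_fun /=; lra.
have HUx := HbU _ Hxb; have HUy := HbU _ Hyb.
have HC := HC2 t Ht'.
have Hdp : 0 < d by lra.
have HL0 := Rlt_le _ _ HL.
(* The slope of the modulus at [|x - y|], divided by [|x - y|]. *)
pose c := / dist x y - / (2 * d).
have Hc : 0 <= c <= / dist x y.
  have := Rinv_0_lt_compat (2 * d) ltac:(lra).
  have := Rinv_le_contravar (dist x y) (2 * d) Hs ltac:(lra).
  by rewrite /c; lra.
have Hcs : c * dist x y <= 1.
  have E : / dist x y * dist x y = 1 by field; lra.
  by rewrite -E; apply: Rmult_le_compat_r; lra.
have T1 : sumI (fun i => D2w x t i i) - sumI (fun i => D2w y t i i) <= - 2 * L / d + 2 * K1 * INR n.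
  pose e := vscal (/ dist x y) (vsub x y).
  have Hee : dot e e = 1 by rewrite /e dot_scall dot_scalr -vnorm_sq; field; lra.
  rewrite -(sum_qform_reflected n (D2w y t) e Hee) -sumI_sub.
  have -> : - 2 * L / d + 2 * K1 * INR n = sumI (fun k => - 2 * L * (e k * e k) / d + 2 * K1).
    rewrite sumI_add sumI_const /Rdiv sumI_scalr sumI_scal -/(dot e e) Hee; ring.
  apply: sumI_le => k.
  exact: (doubling_test_reflected n U (fun z => w z t) (fun z => Dw z t) (fun z => D2w z t) x y x0).
(* The bound [c |x - y| <= 1] turns the squared Lipschitz estimate of the columns into
   [L Lp |x - y|], which is small with [d]. *)
have T2 : sumI (fun k => qform (D2w x t) (fun i => P x i k))
    - sumI (fun k => qform (D2w y t) (fun i => P y i k)) <= L * Lp * d + 2 * K1 * Tr.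
  rewrite -sumI_sub.
  apply: (Rle_trans _ (sumI (fun k => L * c *
      dot (vsub (fun i => P x i k) (fun i => P y i k)) (vsub (fun i => P x i k) (fun i => P y i k))
      + 2 * K1 * dot (fun i => P x i k) (fun i => P x i k)))).
    apply: sumI_le => k.
    have [_] := doubling_test n U (fun z => w z t) (fun z => Dw z t) (fun z => D2w z t) x y x0
      L K1 d (fun i => P x i k) (fun i => P y i k) HU HC HUx HUy Hdp HL0 Hs Hsm.
    by rewrite -/c; lra.
  rewrite sumI_add !sumI_scal.
  have h1 := HLp x y Hxb Hyb; have h2 := HTr x Hxb.
  have h3 : 0 <= L * c by apply: Rmult_le_pos; lra.
  apply: Rplus_le_compat; last by apply: Rmult_le_compat_l; lra.
  apply: Rle_trans (Rmult_le_compat_l _ _ _ h3 h1) _.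
  have -> : L * c * (Lp * (dist x y * dist x y))
    = L * Lp * ((c * dist x y) * dist x y) by ring.
  apply: Rmult_le_compat_l; first exact: Rmult_le_pos.
  have : 0 <= c * dist x y by apply: Rmult_le_pos; lra.
  by nra.
(* Both gradients equal [L c (x - y)] up to the localization term [2 K1 (x - x0)]. Bounding [beta]
   at each point costs [2 L Bb], one of the errors that the choice of [d] absorbs. *)
have T3 : dot (beta x) (Dw x t) - dot (beta y) (Dw y t) <= 2 * L * Bb + K1 * rho * Bb.
  have h1 := HbM x Hxb; have h2 := HbM y Hyb.
  have [E _] := doubling_test n U (fun z => w z t) (fun z => Dw z t) (fun z => D2w z t) x y x0
      L K1 d (beta x) (beta y) HU HC HUx HUy Hdp HL0 Hs Hsm.
  rewrite (dotC n (beta x)) (dotC n (beta y)) E -/c.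
  have h3 := abs_dot_le n (vsub x y) (beta x) _ _ (Rle_refl _) h1.
  have h4 := abs_dot_le n (vsub x y) (beta y) _ _ (Rle_refl _) h2.
  have h5 := abs_dot_le n (vsub x x0) (beta x) _ _ (Rlt_le _ _ Hxr) h1.
  have h6 : dot (vsub x y) (vsub (beta x) (beta y)) <= 2 * Bb * dist x y.
    by rewrite (dot_subr n (vsub x y)); split_Rabs; lra.
  have h7 : dot (vsub x y) (vsub (beta x) (beta y)) * c <= 2 * Bb.
    apply: (Rle_trans _ (2 * Bb * dist x y * c)); first by apply: Rmult_le_compat_r; lra.
    rewrite Rmult_assoc (Rmult_comm _ c).
    by have := Rmult_le_compat_l (2 * Bb) _ _ ltac:(lra) Hcs; lra.
  have h8 := Rmult_le_compat_l L _ _ HL0 h7.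
  have h9 : dot (vsub x x0) (beta x) <= rho / 2 * Bb by split_Rabs; lra.
  have := Rmult_le_compat_l K1 _ _ HK1 h9; lra.
have HF : F x t - F y t <= 2 * MF.
  by have := HFM x t Hxb Ht'; have := HFM y t Hyb Ht'; split_Rabs; lra.
have T1' := Rmult_le_compat_l lam _ _ (Rlt_le _ _ Hlam) T1.
rewrite /elliptic_part in Ex Ey.
have Hall : lam * (2 * L / d) <= K2 + lam * (2 * K1 * INR n) + L * (Lp * d + 2 * Bb)
    + 2 * K1 * Tr + K1 * rho * Bb + 2 * MF by lra.
have Hall' := Rmult_le_compat_l d _ _ (Rlt_le _ _ Hdp) Hall.
have E : d * (lam * (2 * L / d)) = 2 * (lam * L) by field; lra.
rewrite E in Hall'.
have := Rmult_le_compat_l L _ _ HL0 Hdl; lra.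
Qed.

(** A step against the gradient [g] lowers [f] at the rate [|g|^2] while the distance grows at the
    rate [|g|]; the one-sided bound from [x0] therefore suffices. *)
Lemma gradient_of_lipschitz n (U : vec n -> Prop) (f : vec n -> R) (Df : vec n -> vec n) D2f x0 L d :
  is_open U -> U x0 -> C2_on U f Df D2f -> 0 < d -> 0 <= L ->
  (forall y, dist x0 y <= d -> f x0 - f y <= L * dist x0 y) ->
  vnorm (Df x0) <= L.
Proof.
move=> HU Hx0 Hf Hd HL H; pose g := Df x0.
have Hg0 := vnorm_ge0 n g.
apply: Rnot_lt_le => Hlt; rewrite -/g in Hlt.
have Hder := line_derivative0 n U f Df x0 g HU (C2_D _ _ _ _ Hf) (C2_Dc _ _ _ _ Hf) Hx0.
rewrite -/g -vnorm_sq in Hder.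
have Heps : 0 < vnorm g * (vnorm g - L) / 2 by apply: Rdiv_lt_0_compat; [nra|lra].
have [e [He Hke]] := proj1 (derivable_pt_lim_littleo _ _ _) Hder _ Heps.
have [e' [He' Hsm]] := scal_small n g d Hd.
have Hm : 0 < Rmin e e' by apply: Rmin_pos.
have h1 := Rmin_l e e'; have h2 := Rmin_r e e'.
pose s := Rmin e e' / 2; have Hs : 0 < s by rewrite /s; lra.
have Ha : Rabs (- s) < Rmin e e' by rewrite Rabs_Ropp Rabs_pos_eq /s; lra.
have := Hke (- s) ltac:(lra); rewrite Rplus_0_l vadd_scal0.
have E : vnorm (vsub x0 (vadd x0 (vscal (- s) g))) = s * vnorm g.
  rewrite vnorm_sub_sym vsub_addl vnorm_scal Rabs_Ropp Rabs_pos_eq //; lra.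
have := H (vadd x0 (vscal (- s) g)); rewrite E.
have := Hsm (- s) ltac:(lra); rewrite vnorm_scal Rabs_Ropp (Rabs_pos_eq s); last lra.
move=> h3 /(_ ltac:(lra)) h4 h5.
have : vnorm g * vnorm g * s <= L * (s * vnorm g) + vnorm g * (vnorm g - L) / 2 * s.
  by move: h5; split_Rabs; lra.
by nra.
Qed.

(** Parabolic scaling: with [d = c0 rho] and the smallest admissible [K1], [K2], both multiples of
    [M / rho^2], the slope has the size [M / rho + rho MF]. The cap [rhobar] makes the first-order
    terms uniform in the radius. *)
Lemma gradient_estimate n lam Lp Tr Bb rhobar :
  0 < lam -> 0 <= Lp -> 0 <= Tr -> 0 <= Bb -> 0 < rhobar ->
  exists C, 0 < C /\
  forall (U : vec n -> Prop) P beta F w Dw D2w wt (x0 : vec n) t0 rho M MF,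
  solution_near U lam P beta F w Dw D2w wt x0 t0 rho M MF Lp Tr Bb ->
  0 < rho <= rhobar -> 0 <= M -> 0 <= MF ->
  vnorm (Dw x0 t0) <= C * (M / rho + rho * MF).
Proof.
move=> Hlam HLp HTr HBb Hrb.
have Hn := pos_INR n.
have HD : 0 < rhobar * (Lp * rhobar + 2 * Bb + 1) by nra.
(* The first entry gives [d <= rho / 2], the second the absorption condition for every
   [rho <= rhobar]; the summand 1 keeps the denominator positive when [Lp] and [Bb] vanish. *)
pose c0 := Rmin (1 / 2) (lam / (rhobar * (Lp * rhobar + 2 * Bb + 1))).
have Hc0 : 0 < c0 by apply: Rmin_pos; [lra|exact: Rdiv_lt_0_compat].
have Hc1 : c0 <= 1 / 2 by exact: Rmin_l.
have Hc2 : c0 * (rhobar * (Lp * rhobar + 2 * Bb + 1)) <= lam.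
  have h : c0 <= lam / (rhobar * (Lp * rhobar + 2 * Bb + 1)) by exact: Rmin_r.
  have := Rmult_le_compat_r _ _ _ (Rlt_le _ _ HD) h.
  by rewrite Rdiv_mult_simpl; lra.
clearbody c0.
pose CM := c0 / lam * (2 + 16 * lam * INR n + 16 * Tr + 8 * rhobar * Bb) + 3 / c0.
pose CF := 2 * c0 / lam.
have Hcl : 0 < c0 / lam by exact: Rdiv_lt_0_compat.
have HCM : 0 < CM.
  have h1 : 0 < 3 / c0 by apply: Rdiv_lt_0_compat; lra.
  have h2 : 0 <= c0 / lam * (2 + 16 * lam * INR n + 16 * Tr + 8 * rhobar * Bb).
    by apply: Rmult_le_pos; first lra; nra.
  by rewrite /CM; lra.
have HCF : 0 < CF by rewrite /CF; apply: Rdiv_lt_0_compat; lra.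
exists (CM + CF); split; first lra.
move=> U P beta F w Dw D2w wt x0 t0 rho M MF Hs Hrho HM HMF; have [HU HbU _ HC2 _ _ _ _ _ _] := Hs.
apply: (Rle_trans _ (CM * (M / rho) + CF * (rho * MF))); last first.
  have : 0 <= M / rho by apply: Rdiv_le_0_compat; lra.
  have : 0 <= rho * MF by apply: Rmult_le_pos; lra.
  by nra.
(* The last inequality of [doubling_estimate] is strict, hence the slope [L0 + eps]. *)
apply: le_epsilon => eps He.
pose d := c0 * rho; pose K1 := 8 * M / (rho * rho); pose K2 := 2 * M / (rho * rho).
have Hd : 0 < d <= rho / 2 by rewrite /d; nra.
have Hrr : 0 < rho * rho by nra.
have HK1 : 0 <= K1 by apply: Rdiv_le_0_compat; lra.
have HK2 : 0 <= K2 by apply: Rdiv_le_0_compat; lra.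
(* The first summand is the equality case of the last inequality, the second ensures
   [8 M <= 3 L d]. *)
pose L0 := d / lam * (K2 + 2 * lam * INR n * K1 + 2 * K1 * Tr + K1 * rho * Bb + 2 * MF) + 3 * M / d.
have Hin : 0 <= K2 + 2 * lam * INR n * K1 + 2 * K1 * Tr + K1 * rho * Bb + 2 * MF.
  have h1 : 0 <= lam * INR n * K1 by apply: Rmult_le_pos => //; nra.
  have h2 : 0 <= K1 * rho * Bb by apply: Rmult_le_pos => //; nra.
  by nra.
have HMd : 0 <= 3 * M / d by apply: Rdiv_le_0_compat; lra.
have Hdl : 0 <= d / lam by apply: Rdiv_le_0_compat; lra.
have HL0 : 0 <= L0 by have := Rmult_le_pos _ _ Hdl Hin; rewrite /L0; lra.
have HL0le : L0 <= CM * (M / rho) + CF * (rho * MF).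
  have E : CM * (M / rho) + CF * (rho * MF) - L0 = c0 / lam * (8 * (rhobar - rho) * Bb) * (M / rho).
    by rewrite /L0 /CM /CF /K1 /K2 /d; field; split; [lra|split; lra].
  have h1 : 0 <= M / rho by apply: Rdiv_le_0_compat; lra.
  have h2 : 0 <= c0 / lam * (8 * (rhobar - rho) * Bb).
    by apply: Rmult_le_pos; first lra; apply: Rmult_le_pos => //; lra.
  by have := Rmult_le_pos _ _ h2 h1; lra.
apply: (Rle_trans _ (L0 + eps)); last lra.
have Hx0 : dist x0 x0 <= rho by rewrite vnorm0; lra.
apply: (gradient_of_lipschitz n U (fun x => w x t0) (fun x => Dw x t0) (fun x => D2w x t0) x0 _ d HU)
  => //; try lra.
- exact: HbU.
- by apply: HC2; lra.
apply: (doubling_estimate n U lam P beta F w Dw D2w wt x0 t0 rho M MF Lp Tr Bb (L0 + eps) K1 K2 d)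
  => //; try lra.
- by rewrite /K1; apply: Req_le; field; lra.
- by rewrite /K2; apply: Req_le; field; lra.
- have E : 3 * M / d * d = 3 * M by field; lra.
  have : 3 * M / d <= L0 + eps by have := Rmult_le_pos _ _ Hdl Hin; rewrite /L0; lra.
  by move=> h; have := Rmult_le_compat_r d _ _ ltac:(lra) h; lra.
- apply: Rle_trans Hc2; rewrite /d Rmult_assoc; apply: Rmult_le_compat_l; first lra.
  have h : c0 * rho <= rhobar by nra.
  apply: Rmult_le_compat; try lra.
    have h' : 0 <= c0 * rho by nra.
    by have := Rmult_le_pos _ _ HLp h'; lra.
  by have := Rmult_le_compat_l Lp _ _ HLp h; lra.
have -> : lam * (L0 + eps) = d * (K2 + 2 * lam * INR n * K1 + 2 * K1 * Tr + K1 * rho * Bb + 2 * MF)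
    + lam * (3 * M / d) + lam * eps by rewrite /L0; field; split; lra.
have := Rmult_le_pos _ _ (Rlt_le _ _ Hlam) HMd; have := Rmult_lt_0_compat _ _ Hlam He; lra.
Qed.

(** * Comparison with a positive supersolution *)

Lemma C2_scal n U (f : vec n -> R) Df D2f m : C2_on U f Df D2f ->
  C2_on U (fun x => m * f x) (fun x => vscal m (Df x)) (fun x i j => m * D2f x i j).
Proof.
have Hc g : cont_on U g -> cont_on U (fun x => m * g x).
  move=> Hg x Hx eps He; have Hm := Rabs_pos m.
  have [d [Hd H]] := Hg x Hx (eps / (Rabs m + 1)) ltac:(apply: Rdiv_lt_0_compat; lra).
  exists d; split => // y Hy Hxy; rewrite -Rmult_minus_distr_l Rabs_mult.
  have := H y Hy Hxy; have := Rabs_pos (g y - g x).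
  have E : eps / (Rabs m + 1) * (Rabs m + 1) = eps by field; lra.
  by nra.
move=> [H1 H2 H3 H4]; split.
- by move=> x i Hx; apply: derivable_pt_lim_scal; exact: H1.
- by move=> x i j Hx; apply: derivable_pt_lim_scal; exact: H2.
- by move=> i; apply: Hc; exact: H3.
by move=> i j; apply: Hc; exact: H4.
Qed.

Lemma closure_cases n (U : vec n -> Prop) x : closure U x -> U x \/ bdry U x.
Proof. by move=> Hx; case: (classic (U x)) => H; [left|right]. Qed.

Lemma closure_norm n (U : vec n -> Prop) B x :
  (forall x, U x -> vnorm x <= B) -> closure U x -> vnorm x <= B.
Proof.
move=> HB Hx; apply: le_epsilon => eps He; have [y [Hy Hxy]] := Hx eps He.
have := vnorm_diff n y x; have := HB y Hy; split_Rabs; lra.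
Qed.

(* At an interior maximum of [w / Psi] with value [m > 1], the function [w - m Psi] and its gradient vanish, so that the zeroth-order term needs no sign. *)
Lemma comparison_principle n (U : vec n -> Prop) B lam P beta (gamma : vec n -> R) F
    w Dw D2w wt Psi DPsi D2Psi Psit T0 :
  is_open U -> (forall x, U x -> vnorm x <= B) -> 0 <= lam ->
  cont_xt (fun x t => closure U x /\ T0 <= t) w ->
  (forall (X : nat -> vec n) u x t, vcv X x -> Un_cv u t ->
     Un_cv (fun k => Psi (X k) (u k)) (Psi x t)) ->
  (forall x t, closure U x -> T0 <= t -> 0 < Psi x t) ->
  (forall t, T0 < t -> C2_on U (fun x => w x t) (fun x => Dw x t) (fun x => D2w x t)) ->
  (forall t, T0 < t -> C2_on U (fun x => Psi x t) (fun x => DPsi x t) (fun x => D2Psi x t)) ->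
  (forall x t, U x -> T0 < t ->
     parabolic_on lam P beta (fun x t => gamma x * w x t + F x t) w Dw D2w wt x t) ->
  (forall x t, U x -> T0 < t -> derivable_pt_lim (fun s => Psi x s) t (Psit x t) /\
     elliptic_part lam (P x) (D2Psi x t) + dot (beta x) (DPsi x t) + gamma x * Psi x t
       + Rabs (F x t) < Psit x t) ->
  (forall x, closure U x -> w x T0 <= Psi x T0) ->
  (forall x t, bdry U x -> T0 <= t -> w x t <= Psi x t) ->
  forall x t, closure U x -> T0 <= t -> w x t <= Psi x t.
Proof.
move=> HU HB Hlam Hw HPsi Hpos HC HCP Heq Hsup Hic Hbc x1 T Hx1 HT.
have [[x t] [[Hx Ht] Hmax]] : exists p : vec n * R,
    (closure U p.1 /\ T0 <= p.2 <= T) /\ forall q : vec n * R, closure U q.1 /\ T0 <= q.2 <= T ->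
      w q.1 q.2 / Psi q.1 q.2 <= w p.1 p.2 / Psi p.1 p.2.
  apply: (seq_compact_max _ (fun p : vec n * R => closure U p.1 /\ T0 <= p.2 <= T)
    (fun p => w p.1 p.2 / Psi p.1 p.2) (x1, T)); first by split => //=; lra.
  move=> X HX.
  have [p1 [x [Hp1 Hx]]] := bolzano_weierstrass n (fun k => (X k).1) B
    (fun k => closure_norm _ _ _ _ HB (proj1 (HX k))).
  have Hbt k : Rabs (X (p1 k)).2 <= Rabs T0 + Rabs T.
    by have [_] := HX (p1 k); split_Rabs; lra.
  have [p2 [t [Hp2 Ht]]] := bolzano_weierstrass_R (fun k => (X (p1 k)).2) _ Hbt.
  pose phi k := p1 (p2 k).
  have Hphi k : le k (phi k) by have := Hp1 (p2 k); have := Hp2 k; rewrite /phi; lia.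
  have {}Hx : vcv (fun k => (X (phi k)).1) x by exact: (vcv_sub n (fun k => (X (p1 k)).1) x p2).
  have HK : closure U x /\ T0 <= t <= T.
    split; first by apply: closure_cv Hx => k; have [] := HX (phi k).
    by apply: Un_cv_bounds Ht _ => k; have [_] := HX (phi k).
  have HK' : closure U x /\ T0 <= t by split; [tauto|lra].
  have HX' k : closure U (X (phi k)).1 /\ T0 <= (X (phi k)).2.
    by have [? ?] := HX (phi k); split => //; lra.
  exists phi, (x, t); split => //; split => //=; rewrite /Rdiv.
  have C1 := cont_xt_cv _ _ _ _ (fun k => (X (phi k)).2) _ _ Hw HK' HX' Hx Ht.
  have C2 := HPsi _ (fun k => (X (phi k)).2) _ _ Hx Ht.
  apply: CV_mult => //.
  apply: (is_lim_seq_Reals (fun k => / Psi (X (phi k)).1 (X (phi k)).2) (/ Psi x t)).1.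
  apply: (is_lim_seq_inv _ (Psi x t)) => //; first exact/is_lim_seq_Reals.
  by case=> E; have := Hpos x t (proj1 HK') (proj2 HK'); lra.
rewrite /= in Hx Ht Hmax.
have HPx := Hpos x t Hx ltac:(lra); have HP1 := Hpos x1 T Hx1 HT.
apply: Rnot_lt_le => Hbad.
pose m := w x t / Psi x t.
have Hm : 1 < m.
  apply: (Rlt_le_trans _ (w x1 T / Psi x1 T)); last by apply: (Hmax (x1, T)); split => //=; lra.
  apply: (Rmult_lt_reg_r (Psi x1 T)) => //; rewrite Rdiv_mult_simpl; lra.
have Ew : w x t = m * Psi x t by rewrite /m Rdiv_mult_simpl; lra.
have Hle y s : closure U y -> T0 <= s <= T -> w y s <= m * Psi y s.
  move=> Hy Hs; have := Hmax (y, s) (conj Hy Hs); rewrite /= -/m.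
  have Hp := Hpos y s Hy ltac:(lra) => h.
  have := Rmult_le_compat_r _ _ _ (Rlt_le _ _ Hp) h; rewrite Rdiv_mult_simpl; lra.
clearbody m.
have Ht0 : T0 < t.
  apply: Rnot_le_lt => h; have E : t = T0 by lra.
  by have := Hic x Hx; rewrite E in Ew HPx; nra.
have HUx : U x.
  by case: (closure_cases _ _ _ Hx) => // Hb; have := Hbc x t Hb ltac:(lra); nra.
have [Dt E] := Heq x t HUx Ht0; have [DtP EP] := Hsup x t HUx Ht0.
have Htime : 0 <= wt x t - m * Psit x t.
  apply: (left_max_derivative (fun s => w x s - m * Psi x s) t _ (t - T0)); first lra.
    by apply: derivable_pt_lim_minus => //; exact: derivable_pt_lim_scal.
  by move=> s Hs; have := Hle x s Hx ltac:(lra); lra.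
have Htest xi : dot (Dw x t) xi - dot (vscal m (DPsi x t)) xi = 0 /\
    qform (D2w x t) xi - qform (fun i j => m * D2Psi x t i j) xi <= 2 * 0.
  have [d [Hd HdU]] := open_line n U x xi HU HUx.
  apply: (touching_test n U (fun x => w x t) (fun x => m * Psi x t) (fun x => Dw x t)
    (fun x => D2w x t) (fun x => vscal m (DPsi x t)) (fun x i j => m * D2Psi x t i j)
    x x xi xi 0 0 d HU (HC t Ht0) (C2_scal _ _ _ _ _ m (HCP t Ht0)) HUx HUx Hd).
  by move=> s Hs; have := Hle _ t (closure_sub _ _ _ (HdU s Hs)) ltac:(lra); lra.
have Eg : dot (beta x) (Dw x t) = m * dot (beta x) (DPsi x t).
  have [h _] := Htest (beta x); rewrite dot_scall in h; rewrite !(dotC n (beta x)); lra.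
have Eq : elliptic_part lam (P x) (D2w x t) <= m * elliptic_part lam (P x) (D2Psi x t).
  have Em xi : qform (fun i j => m * D2Psi x t i j) xi = m * qform (D2Psi x t) xi.
    rewrite /qform -sumI_scal; apply: sumI_ext => i.
    by rewrite -Rmult_assoc -sumI_scal; congr (_ * _); apply: sumI_ext => j; ring.
  rewrite /elliptic_part Rmult_plus_distr_l; apply: Rplus_le_compat.
    have -> : m * (lam * sumI (fun i => D2Psi x t i i)) = lam * sumI (fun i => m * D2Psi x t i i).
      by rewrite sumI_scal; ring.
    apply: Rmult_le_compat_l => //; apply: sumI_le => i.
    by have [_] := Htest (ebasis i); rewrite !qform_ebasis; lra.
  rewrite -sumI_scal; apply: sumI_le => k.
  by have [_] := Htest (fun i => P x i k); rewrite Em; lra.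
(* The margin of the supersolution exceeds [|F|], and all the more so after multiplication by
   [m > 1]; together with the touching relations this contradicts the equation of [w]. *)
have HF : F x t < m * (Psit x t - (elliptic_part lam (P x) (D2Psi x t) + dot (beta x) (DPsi x t)
    + gamma x * Psi x t)).
  have h0 := Rabs_pos (F x t); have h1 := Rle_abs (F x t).
  by nra.
by rewrite Ew in E; lra.
Qed.

(** * Radial fields and coefficients of class C^1 on an interval *)

Lemma partial_unique n (f : vec n -> R) x i l1 l2 :
  has_partial f x i l1 -> has_partial f x i l2 -> l1 = l2.
Proof. exact: uniqueness_limite. Qed.

Lemma partial_add n (f g : vec n -> R) x i l m :
  has_partial f x i l -> has_partial g x i m -> has_partial (fun y => f y + g y) x i (l + m).
Proof. exact: derivable_pt_lim_plus. Qed.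

Lemma partial_sub n (f g : vec n -> R) x i l m :
  has_partial f x i l -> has_partial g x i m -> has_partial (fun y => f y - g y) x i (l - m).
Proof. exact: derivable_pt_lim_minus. Qed.

Lemma partial_opp n (f : vec n -> R) x i l :
  has_partial f x i l -> has_partial (fun y => - f y) x i (- l).
Proof. exact: derivable_pt_lim_opp. Qed.

Lemma partial_mul n (f g : vec n -> R) x i l m :
  has_partial f x i l -> has_partial g x i m ->
  has_partial (fun y => f y * g y) x i (l * g x + f x * m).
Proof.
move=> Hf Hg; have := derivable_pt_lim_mult _ _ _ _ _ Hf Hg.
by rewrite !vadd_scal0.
Qed.

Lemma partial_sumI n m (F : 'I_m -> vec n -> R) (l : 'I_m -> R) x i :
  (forall j, has_partial (F j) x i (l j)) -> has_partial (fun y => sumI (fun j => F j y)) x i (sumI l).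
Proof. by move=> H; apply: (derivable_pt_lim_sumI m (fun j h => F j (vadd x (vscal h (ebasis i))))). Qed.

Lemma partial_coord n (x : vec n) i j : has_partial (fun y => y j) x i (idmat n i j).
Proof.
rewrite /has_partial /vadd /vscal /ebasis /idmat eq_sym.
by apply/is_derive_Reals; auto_derive => //; ring.
Qed.

Lemma partial_near n (U : vec n -> Prop) (f g : vec n -> R) x i l : is_open U -> U x ->
  (forall y, U y -> f y = g y) -> has_partial f x i l -> has_partial g x i l.
Proof.
move=> HU Hx H; have [d [Hd HdU]] := open_line n U x (ebasis i) HU Hx.
apply: (derivable_pt_lim_near _ _ _ _ d Hd) => s; rewrite Rminus_0_r => Hs.
by apply: H; exact: HdU.
Qed.

Lemma partial_ext n (f g : vec n -> R) x i l :
  (forall y, f y = g y) -> has_partial f x i l -> has_partial g x i l.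
Proof. by move=> H; apply: derivable_pt_lim_ext => s; rewrite H. Qed.

Lemma vnorm_line n (v w : vec n) t :
  vnorm (vadd v (vscal t w)) = sqrt (vnorm v * vnorm v + 2 * t * dot v w + t * t * dot w w).
Proof. rewrite -vnorm_add_scal_sq sqrt_square //; exact: vnorm_ge0. Qed.

Lemma partial_radial n (phi : R -> R) l (x : vec n) i : 0 < vnorm x ->
  derivable_pt_lim phi (vnorm x) l ->
  has_partial (fun y => phi (vnorm y)) x i (l / vnorm x * x i).
Proof.
move=> Hx Hphi.
have H : derivable_pt_lim (fun h => vnorm (vadd x (vscal h (ebasis i)))) 0 (x i / vnorm x).
  apply: (derivable_pt_lim_ext
    (fun h => sqrt (vnorm x * vnorm x + 2 * h * x i + h * h * 1))).
    by move=> h; rewrite vnorm_line !dot_ebasis /ebasis eqxx.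
  apply/is_derive_Reals; auto_derive; first by nra.
  have -> : vnorm x * vnorm x + 2 * 0 * x i + 0 * 0 * 1 = vnorm x * vnorm x by ring.
  by rewrite sqrt_square; [field; lra | lra].
have Hphi' : derivable_pt_lim phi (vnorm (vadd x (vscal 0 (ebasis i)))) l by rewrite vadd_scal0.
have := derivable_pt_lim_comp _ _ _ _ _ H Hphi'.
by have -> : l * (x i / vnorm x) = l / vnorm x * x i by field; lra.
Qed.

(** The eigenvalues are [al] orthogonally to [x] and [al + ga |x|^2] along [x]. These fields are
    closed under products, and all matrix coefficients of the system are of this kind. *)
Definition radm {n} (al ga : R -> R) (x : vec n) : mat n :=
  fun i j => al (vnorm x) * idmat n i j + ga (vnorm x) * x i * x j.

Lemma matvec_radm n al ga (x W : vec n) i :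
  matvec (radm al ga x) W i = al (vnorm x) * W i + ga (vnorm x) * x i * dot x W.
Proof.
rewrite /matvec -(sumI_idl n i W) /dot -!sumI_scal -sumI_add.
by apply: sumI_ext => j; rewrite /radm; ring.
Qed.

Lemma matvec_radm_self n al ga (x : vec n) a i :
  matvec (radm al ga x) (vscal a x) i
  = (al (vnorm x) + ga (vnorm x) * (vnorm x * vnorm x)) * a * x i.
Proof. rewrite matvec_radm dot_scalr -vnorm_sq /vscal; ring. Qed.

Lemma sum_radm n al ga (x : vec n) (M : 'I_n -> 'I_n -> R) :
  sumI (fun i => sumI (fun j => radm al ga x i j * M i j))
  = al (vnorm x) * sumI (fun i => M i i)
    + ga (vnorm x) * sumI (fun i => x i * sumI (fun j => x j * M i j)).
Proof.
rewrite -!sumI_scal -sumI_add; apply: sumI_ext => i.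
rewrite -(sumI_idl n i (fun j => M i j)) -!sumI_scal -sumI_add.
by apply: sumI_ext => j; rewrite /radm; ring.
Qed.

(** The factor of [dot x (W x)] comes from the divergence of the matrix field itself, which is
    [(al' / r + ga' r + (n + 1) ga) x]. *)
Lemma div_radm n al ga al' ga' (x : vec n) (W : vec n -> vec n) (DW : 'I_n -> 'I_n -> R) :
  0 < vnorm x ->
  derivable_pt_lim al (vnorm x) al' -> derivable_pt_lim ga (vnorm x) ga' ->
  (forall i j, has_partial (fun y => W y i) x j (DW i j)) ->
  exists l : 'I_n -> R,
    (forall i, has_partial (fun y => matvec (radm al ga y) (W y) i) x i (l i)) /\
    sumI l = (al' / vnorm x + ga' * vnorm x + (INR n + 1) * ga (vnorm x)) * dot x (W x)
      + sumI (fun i => sumI (fun j => radm al ga x i j * DW i j)).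
Proof.
move=> Hx Hal Hga HW.
pose r := vnorm x.
exists (fun i => (al' / r * x i * W x i + al r * DW i i)
  + ((ga' / r * x i * x i + ga r * idmat n i i) * dot x (W x)
     + ga r * x i * sumI (fun j => idmat n i j * W x j + x j * DW j i))); split.
  move=> i; apply: (partial_ext n (fun y => al (vnorm y) * W y i + ga (vnorm y) * y i * dot y (W y))).
    by move=> y; rewrite matvec_radm.
  apply: partial_add; first by apply: partial_mul => //; exact: partial_radial.
  apply: (partial_mul n (fun y => ga (vnorm y) * y i) (fun y => dot y (W y))).
    apply: partial_mul; [exact: partial_radial | exact: partial_coord].
  apply: (partial_sumI n n (fun j y => y j * W y j)) => j.
  apply: partial_mul => //; exact: partial_coord.
rewrite sum_radm -/r.
have Hrr : r * r = sumI (fun i => x i * x i) by rewrite /r vnorm_sq.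
transitivity (al' / r * dot x (W x) + al r * sumI (fun i => DW i i)
  + (ga' / r * (r * r) + ga r * INR n) * dot x (W x)
  + ga r * (dot x (W x) + sumI (fun i => x i * sumI (fun j => x j * DW j i)))); last first.
  have -> : sumI (fun i => x i * sumI (fun j => x j * DW i j))
     = sumI (fun i => x i * sumI (fun j => x j * DW j i)).
    transitivity (sumI (fun i => sumI (fun j => x i * x j * DW i j))).
      by apply: sumI_ext => i; rewrite -sumI_scal; apply: sumI_ext => j; ring.
    by rewrite sumI_exch; apply: sumI_ext => i; rewrite -sumI_scal; apply: sumI_ext => j; ring.
  by field; rewrite /r; lra.
transitivity (sumI (fun i => al' / r * (x i * W x i) + al r * DW i i
  + ga' / r * dot x (W x) * (x i * x i) + ga r * dot x (W x) + ga r * (x i * W x i)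
  + ga r * (x i * sumI (fun j => x j * DW j i)))).
  by apply: sumI_ext => i; rewrite sumI_add sumI_idl /idmat eqxx; ring.
rewrite !sumI_add !sumI_scal sumI_const Hrr /dot; ring.
Qed.

Lemma cont_on_add n U (f g : vec n -> R) : cont_on U f -> cont_on U g -> cont_on U (fun x => f x + g x).
Proof.
move=> Hf Hg x Hx eps He.
have [d1 [Hd1 H1]] := Hf x Hx (eps / 2) ltac:(lra).
have [d2 [Hd2 H2]] := Hg x Hx (eps / 2) ltac:(lra).
exists (Rmin d1 d2); split; first exact: Rmin_pos.
move=> y Hy Hxy; have := H1 y Hy (Rlt_le_trans _ _ _ Hxy (Rmin_l _ _)).
have := H2 y Hy (Rlt_le_trans _ _ _ Hxy (Rmin_r _ _)); split_Rabs; lra.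
Qed.

Lemma cont_on_mul n U (f g : vec n -> R) : cont_on U f -> cont_on U g -> cont_on U (fun x => f x * g x).
Proof.
move=> Hf Hg x Hx eps He.
have Hfa := Rabs_pos (f x); have Hga := Rabs_pos (g x).
pose e := Rmin 1 (eps / (Rabs (f x) + Rabs (g x) + 2)).
have He0 : 0 < e by apply: Rmin_pos; [lra|apply: Rdiv_lt_0_compat; lra].
have He1 : e <= 1 by exact: Rmin_l.
have He2 : e * (Rabs (f x) + Rabs (g x) + 2) <= eps.
  have h : e <= eps / (Rabs (f x) + Rabs (g x) + 2) by exact: Rmin_r.
  have := Rmult_le_compat_r (Rabs (f x) + Rabs (g x) + 2) _ _ ltac:(lra) h.
  by rewrite Rdiv_mult_simpl; lra.
have [d1 [Hd1 H1]] := Hf x Hx e He0; have [d2 [Hd2 H2]] := Hg x Hx e He0.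
exists (Rmin d1 d2); split; first exact: Rmin_pos.
move=> y Hy Hxy; have h1 := H1 y Hy (Rlt_le_trans _ _ _ Hxy (Rmin_l _ _)).
have h2 := H2 y Hy (Rlt_le_trans _ _ _ Hxy (Rmin_r _ _)).
have -> : f y * g y - f x * g x
  = (f y - f x) * (g y - g x) + ((f y - f x) * g x + f x * (g y - g x)) by ring.
apply: Rle_lt_trans (Rabs_triang _ _) _.
have := Rabs_triang ((f y - f x) * g x) (f x * (g y - g x)); rewrite !Rabs_mult.
have := Rabs_pos (f y - f x); have := Rabs_pos (g y - g x).
move: (Rabs (f y - f x)) (Rabs (g y - g x)) h1 h2 => a b h1 h2 ha hb h3.
have : a * b <= e by nra.
have : a * Rabs (g x) <= e * Rabs (g x) by nra.
have : Rabs (f x) * b <= e * Rabs (f x) by nra.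
by nra.
Qed.

Lemma cont_on_const n (U : vec n -> Prop) c : cont_on U (fun=> c).
Proof. by move=> x _ e He; exists 1; split; [lra|move=> y _ _; rewrite Rminus_diag Rabs_R0]. Qed.

Lemma cont_on_coord n (U : vec n -> Prop) i : cont_on U (fun x => x i).
Proof.
move=> x _ e He; exists e; split => // y _; apply: Rle_lt_trans.
exact: (coord_le_vnorm n (vsub y x) i).
Qed.

Lemma continuity_pt_eps f x : continuity_pt f x <->
  forall eps, 0 < eps -> exists d, 0 < d /\ forall y, Rabs (y - x) < d -> Rabs (f y - f x) < eps.
Proof.
split.
  move=> H eps He; have [d [Hd Hf]] := H eps He; exists d; split => // y Hy.
  case: (Req_dec x y) => [<-|Hne]; first by rewrite Rminus_diag Rabs_R0.
  by apply: Hf; split => //; split.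
move=> H e He; have [d [Hd Hf]] := H e He.
by exists d; split => // y [_ Hy]; exact: Hf.
Qed.

Lemma cont_on_radial n (U : vec n -> Prop) phi : continuity phi -> cont_on U (fun x => phi (vnorm x)).
Proof.
move=> Hphi x Hx e He; have [d [Hd H]] := proj1 (continuity_pt_eps _ _) (Hphi (vnorm x)) e He.
by exists d; split => // y _ Hxy; apply: H; apply: Rle_lt_trans (vnorm_diff _ _ _) Hxy.
Qed.

(** With derivatives written as multiples of [r], the gradient is [phi1 x] and the Hessian
    [phi1' x x^T + phi1 I], free of quotients. *)
Lemma C2_radial n (U : vec n -> Prop) a b (phi phi1 phi1' : R -> R) :
  0 < a -> (forall x, U x -> a < vnorm x < b) ->
  (forall r, a < r < b -> derivable_pt_lim phi r (phi1 r * r)) ->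
  (forall r, a < r < b -> derivable_pt_lim phi1 r (phi1' r * r)) ->
  continuity phi1 -> continuity phi1' ->
  C2_on U (fun x => phi (vnorm x)) (fun x => vscal (phi1 (vnorm x)) x)
    (fun x i j => phi1' (vnorm x) * x i * x j + phi1 (vnorm x) * idmat n i j).
Proof.
move=> Ha HU H1 H2 Hc1 Hc2.
split.
- move=> x i Hx; have Hr := HU x Hx; have := partial_radial n phi _ x i ltac:(lra) (H1 _ Hr).
  by have -> : phi1 (vnorm x) * vnorm x / vnorm x = phi1 (vnorm x) by field; lra.
- move=> x i j Hx; have Hr := HU x Hx; have := partial_radial n phi1 _ x j ltac:(lra) (H2 _ Hr).
  have -> : phi1' (vnorm x) * vnorm x / vnorm x = phi1' (vnorm x) by field; lra.
  move=> h; have := partial_mul n _ _ x j _ _ h (partial_coord n x j i).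
  rewrite (idmatC n j i).
  by have -> : phi1' (vnorm x) * x j * x i = phi1' (vnorm x) * x i * x j by ring.
- by move=> i; apply: cont_on_mul; [exact: cont_on_radial|exact: cont_on_coord].
move=> i j; apply: cont_on_add; apply: cont_on_mul; try exact: cont_on_const.
- by apply: cont_on_mul; [exact: cont_on_radial|exact: cont_on_coord].
- exact: cont_on_coord.
exact: cont_on_radial.
Qed.

(* Coefficients are composed with [clamp a b]: continuous on [R], differentiable only inside. *)
Definition C1I (a b : R) (f : R -> R) : Prop := exists f' : R -> R,
  continuity f /\ continuity f' /\ forall r, a < r < b -> derivable_pt_lim f r (f' r).

Lemma continuity_cst (c : R) : continuity (fun=> c).
Proof. by apply: continuity_const. Qed.

Lemma C1I_const a b c : C1I a b (fun=> c).
Proof.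
exists (fun=> 0); split; last split; try exact: continuity_cst.
by move=> r _; exact: derivable_pt_lim_const.
Qed.

Lemma C1I_add a b f g : C1I a b f -> C1I a b g -> C1I a b (fun r => f r + g r).
Proof.
move=> [f' [H1 [H2 H3]]] [g' [K1 [K2 K3]]]; exists (fun r => f' r + g' r); split; last split.
- exact: continuity_plus.
- exact: continuity_plus.
by move=> r Hr; apply: derivable_pt_lim_plus; auto.
Qed.

Lemma C1I_mul a b f g : C1I a b f -> C1I a b g -> C1I a b (fun r => f r * g r).
Proof.
move=> [f' [H1 [H2 H3]]] [g' [K1 [K2 K3]]].
exists (fun r => f' r * g r + f r * g' r); split; last split.
- exact: continuity_mult.
- by apply: continuity_plus; exact: continuity_mult.
by move=> r Hr; apply: derivable_pt_lim_mult; auto.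
Qed.

Lemma C1I_opp a b f : C1I a b f -> C1I a b (fun r => - f r).
Proof.
move=> [f' [H1 [H2 H3]]]; exists (fun r => - f' r); split; last split.
- exact: continuity_opp.
- exact: continuity_opp.
by move=> r Hr; apply: derivable_pt_lim_opp; auto.
Qed.

Lemma C1I_sub a b f g : C1I a b f -> C1I a b g -> C1I a b (fun r => f r - g r).
Proof. by move=> Hf Hg; apply: C1I_add => //; exact: C1I_opp. Qed.

Lemma C1I_comp a b (J : R -> Prop) F F' f :
  (forall s, J s -> derivable_pt_lim F s (F' s)) -> (forall s, J s -> continuity_pt F' s) ->
  (forall r, J (f r)) -> C1I a b f -> C1I a b (fun r => F (f r)).
Proof.
move=> HF HF' HJ [f' [H1 [H2 H3]]]; exists (fun r => F' (f r) * f' r); split; last split.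
- move=> r; apply: (continuity_pt_comp f F); first exact: H1.
  by apply: derivable_continuous_pt; exists (F' (f r)); exact: HF.
- move=> r; apply: continuity_pt_mult; last exact: H2.
  by apply: (continuity_pt_comp f F'); [exact: H1|exact: HF'].
by move=> r Hr; apply: (derivable_pt_lim_comp f F); auto.
Qed.

Lemma C1I_inv a b f : (forall r, f r <> 0) -> C1I a b f -> C1I a b (fun r => / f r).
Proof.
move=> Hf; apply: (C1I_comp a b (fun s => s <> 0) Rinv (fun s => - / (s * s))) => //.
  by move=> s Hs; apply/is_derive_Reals; auto_derive => //; field.
move=> s Hs; apply: continuity_pt_opp; apply: continuity_pt_inv; last by nra.
by apply: continuity_pt_mult; apply: derivable_continuous_pt; exact: derivable_pt_id.
Qed.

Lemma C1I_div a b f g : (forall r, g r <> 0) -> C1I a b f -> C1I a b g -> C1I a b (fun r => f r / g r).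
Proof. by move=> Hg Hf Hgg; apply: C1I_mul => //; exact: C1I_inv. Qed.

Lemma C1I_sqrt a b f : (forall r, 0 < f r) -> C1I a b f -> C1I a b (fun r => sqrt (f r)).
Proof.
move=> Hf; apply: (C1I_comp a b (fun s => 0 < s) sqrt (fun s => / (2 * sqrt s))) => //.
  by move=> s Hs; exact: derivable_pt_lim_sqrt.
move=> s Hs; apply: continuity_pt_inv; last by have := sqrt_lt_R0 s Hs; lra.
apply: continuity_pt_mult; last by apply: continuity_pt_sqrt; lra.
exact: continuity_cst.
Qed.

Lemma C1I_Rpower a b f c : (forall r, 0 < f r) -> C1I a b f -> C1I a b (fun r => Rpower (f r) c).
Proof.
move=> Hf.
apply: (C1I_comp a b (fun s => 0 < s) (fun s => Rpower s c) (fun s => c * Rpower s (c - 1))) => //.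
  by move=> s Hs; exact: derivable_pt_lim_power.
move=> s Hs; apply: derivable_continuous_pt; exists (c * ((c - 1) * Rpower s (c - 1 - 1))).
by apply: derivable_pt_lim_scal; exact: derivable_pt_lim_power.
Qed.

Lemma C1I_exp a b f : C1I a b f -> C1I a b (fun r => exp (f r)).
Proof.
apply: (C1I_comp a b (fun=> True) exp exp) => // s _; first exact: derivable_pt_lim_exp.
by apply: derivable_continuous_pt; exact: derivable_pt_exp.
Qed.

Lemma C1I_ext a b f g : (forall r, f r = g r) -> C1I a b f -> C1I a b g.
Proof. by move=> H; have -> : g = f by apply: functional_extensionality. Qed.

Lemma continuity_bounded a b f : a <= b -> continuity f ->
  exists K, 0 < K /\ forall r, a <= r <= b -> Rabs (f r) <= K.
Proof.
move=> Hab Hf.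
have [M [HM _]] := continuity_ab_maj f a b Hab (fun r _ => Hf r).
have [m [Hm _]] := continuity_ab_min f a b Hab (fun r _ => Hf r).
exists (Rabs (f M) + Rabs (f m) + 1); split.
  by have := Rabs_pos (f M); have := Rabs_pos (f m); lra.
by move=> r Hr; have := HM r Hr; have := Hm r Hr; split_Rabs; lra.
Qed.

Lemma C1I_integral a b f : C1I a b f -> exists g, C1I a b g /\ (forall r, derivable_pt_lim g r (f r)).
Proof.
move=> [f' [Hf [_ _]]].
have Hc r : continuous f r by apply/continuity_pt_filterlim; exact: Hf.
have Hd r : derivable_pt_lim (fun r => RInt f a r) r (f r).
  apply/is_derive_Reals; apply: is_derive_RInt (Hc r).
  apply: filter_forall => s; apply: RInt_correct; apply: ex_RInt_continuous => z _; exact: Hc.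
exists (fun r => RInt f a r); split => //; exists f; split; last by split.
by move=> r; apply: derivable_continuous_pt; exists (f r); exact: Hd.
Qed.

Definition clamp (a b r : R) : R := Rmax a (Rmin r b).

Lemma clamp_cases a b r : a <= b ->
  (r <= a /\ clamp a b r = a) \/ (a <= r <= b /\ clamp a b r = r) \/ (b <= r /\ clamp a b r = b).
Proof.
move=> H; rewrite /clamp; case: (Rle_or_lt r b) => Hb.
  rewrite (Rmin_left r b) //; case: (Rle_or_lt r a) => Ha; [left|right; left].
    by rewrite Rmax_left.
  by rewrite Rmax_right; lra.
have -> : Rmin r b = b by apply: Rmin_right; lra.
by rewrite Rmax_right; lra.
Qed.

Lemma clamp_in a b r : a <= b -> a <= clamp a b r <= b.
Proof. by move=> H; case: (clamp_cases a b r H) => [|[]] [? ->]; lra. Qed.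

Lemma clamp_id a b r : a <= r <= b -> clamp a b r = r.
Proof. by move=> H; case: (clamp_cases a b r ltac:(lra)) => [|[]] [? ->]; lra. Qed.

Lemma clamp_lip a b r s : a <= b -> Rabs (clamp a b r - clamp a b s) <= Rabs (r - s).
Proof.
by move=> H; case: (clamp_cases a b r H) => [|[]] [? ->];
  case: (clamp_cases a b s H) => [|[]] [? ->]; split_Rabs; lra.
Qed.

Lemma C1I_clamp a b : a <= b -> C1I a b (clamp a b).
Proof.
move=> Hab; exists (fun=> 1); split; last split.
- move=> r; apply/continuity_pt_eps => e He; exists e; split => // y Hy.
  by apply: Rle_lt_trans (clamp_lip _ _ _ _ Hab) Hy.
- exact: continuity_cst.
move=> r Hr; apply: (derivable_pt_lim_locally_ext id _ r a b 1 Hr); last exact: derivable_pt_lim_id.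
by move=> z Hz; rewrite clamp_id //; lra.
Qed.

(** * Linear operators with radial coefficients *)

Lemma Rabs_mult_le a b A B : Rabs a <= A -> Rabs b <= B -> Rabs (a * b) <= A * B.
Proof. by move=> ha hb; rewrite Rabs_mult; apply: Rmult_le_compat => //; exact: Rabs_pos. Qed.

Lemma C1I_id a b : C1I a b (fun r => r).
Proof.
exists (fun=> 1); split; last split.
- by move=> r; apply: derivable_continuous_pt; exact: derivable_pt_id.
- exact: continuity_cst.
by move=> r _; exact: derivable_pt_lim_id.
Qed.

Definition annulus {n} (r0 Rb : R) (x : vec n) : Prop := r0 < vnorm x < Rb.

Lemma annulus_open n r0 Rb : is_open (@annulus n r0 Rb).
Proof.
move=> x Hx; rewrite /annulus in Hx *.
exists (Rmin (vnorm x - r0) (Rb - vnorm x)); split; first by apply: Rmin_pos; lra.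
move=> y Hy; have := vnorm_diff n y x.
have := Rmin_l (vnorm x - r0) (Rb - vnorm x); have := Rmin_r (vnorm x - r0) (Rb - vnorm x).
split_Rabs; lra.
Qed.

Lemma sum_radm_sq n al ga (x : vec n) i j :
  sumI (fun k => radm al ga x i k * radm al ga x j k)
  = radm (fun r => al r * al r) (fun r => 2 * al r * ga r + ga r * ga r * (r * r)) x i j.
Proof.
rewrite [RHS]/radm vnorm_sq.
rewrite /radm; set a := al _; set g := ga _.
transitivity (sumI (fun k => a * a * (idmat n i k * idmat n j k) + a * g * x j * (idmat n i k * x k)
   + a * g * x i * (idmat n j k * x k) + g * g * x i * x j * (x k * x k))).
  by apply: sumI_ext => k; ring.
by rewrite !sumI_add !sumI_scal !sumI_idl (idmatC n j) -/(dot x x); ring.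
Qed.

(* [p] and [h] are the tangential and radial eigenvalues of [B]; the matrix below is its inverse. *)
Definition radA {n} (r0 Rb : R) (p h : R -> R) : vec n -> mat n :=
  radm (fun r => / p r) (fun r => (/ h r - / p r) / (clamp r0 Rb r * clamp r0 Rb r)).

(** The positive square root of [A - lam I]: same eigenvectors, eigenvalues [sqrt (/ p - lam)] and
    [sqrt (/ h - lam)]. Being explicit, it is Lipschitz by one-variable calculus. *)
Definition rootA {n} (r0 Rb lam : R) (p h : R -> R) : vec n -> mat n :=
  radm (fun r => sqrt (/ p r - lam))
    (fun r => (sqrt (/ h r - lam) - sqrt (/ p r - lam)) / (clamp r0 Rb r * clamp r0 Rb r)).

(** [bc] encodes the vector field [b = bc(r) x]. The order [p <= h <= C0] says that both eigenvalues
    of [A] are at least [/ C0]. *)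
Record radial_data (r0 Rb C0 : R) (p h bc : R -> R) : Prop := RadialData {
  rd_r : 0 < r0 < Rb;
  rd_p : C1I r0 Rb p;
  rd_h : C1I r0 Rb h;
  rd_bc : C1I r0 Rb bc;
  rd_p0 : forall r, 0 < p r;
  rd_ph : forall r, p r <= h r;
  rd_hC : forall r, h r <= C0 }.

Arguments rd_r {r0 Rb C0 p h bc} _.
Arguments rd_bc {r0 Rb C0 p h bc} _.
Arguments rd_p0 {r0 Rb C0 p h bc} _ _.
Arguments rd_ph {r0 Rb C0 p h bc} _ _.
Arguments rd_hC {r0 Rb C0 p h bc} _ _.

Section RadialSystem.
Context (n : nat) (r0 Rb C0 : R) (p h bc : R -> R) (Hrd : radial_data r0 Rb C0 p h bc).

(** Half of the lower bound [/ C0] for the spectrum of [A], so that [A - lam I] is still at least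
    [lam I]. *)
Let lam := / (2 * C0).
Local Notation rtA := (rootA r0 Rb lam p h).
Let Hp0 : forall r, 0 < p r := rd_p0 Hrd.
Let Hph : forall r, p r <= h r := rd_ph Hrd.
Let HhC : forall r, h r <= C0 := rd_hC Hrd.
Let Hr0b : 0 < r0 < Rb := rd_r Hrd.

Lemma rd_C0 : 0 < C0.
Proof. have := Hp0 0; have := Hph 0; have := HhC 0; lra. Qed.

Lemma rd_lam : 0 < lam.
Proof. by apply: Rinv_0_lt_compat; have := rd_C0; lra. Qed.

Lemma rd_inv_h r : 2 * lam <= / h r.
Proof.
have -> : 2 * lam = / C0 by rewrite /lam; field; have := rd_C0; lra.
by apply: Rinv_le_contravar => //; have := Hp0 r; have := Hph r; lra.
Qed.

Lemma rd_inv_p r : 2 * lam <= / p r.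
Proof.
apply: Rle_trans (rd_inv_h r) _; exact: Rinv_le_contravar.
Qed.

Lemma clamp_sq_neq r : clamp r0 Rb r * clamp r0 Rb r <> 0.
Proof. by have := clamp_in r0 Rb r ltac:(lra); nra. Qed.

Lemma C1I_clamp_sq : C1I r0 Rb (fun r => clamp r0 Rb r * clamp r0 Rb r).
Proof.
by apply: C1I_mul; apply: C1I_clamp; lra.
Qed.

Lemma C1I_inv_p : C1I r0 Rb (fun r => / p r).
Proof. by apply: C1I_inv => [r|]; [have := Hp0 r; lra|case: Hrd]. Qed.

Lemma C1I_inv_h : C1I r0 Rb (fun r => / h r).
Proof. by apply: C1I_inv => [r|]; [have := Hp0 r; have := Hph r; lra|case: Hrd]. Qed.

Lemma C1I_root f : (forall r, 2 * lam <= f r) -> C1I r0 Rb f -> C1I r0 Rb (fun r => sqrt (f r - lam)).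
Proof.
move=> Hf Cf; apply: C1I_sqrt; first by move=> r; have := Hf r; have := rd_lam; lra.
by apply: C1I_sub => //; exact: C1I_const.
Qed.

Lemma C1I_radA2 :
  C1I r0 Rb (fun r => (/ h r - / p r) / (clamp r0 Rb r * clamp r0 Rb r)).
Proof.
apply: C1I_div; [exact: clamp_sq_neq| |exact: C1I_clamp_sq].
by apply: C1I_sub; [exact: C1I_inv_h|exact: C1I_inv_p].
Qed.

Lemma C1I_rootA2 : C1I r0 Rb
  (fun r => (sqrt (/ h r - lam) - sqrt (/ p r - lam)) / (clamp r0 Rb r * clamp r0 Rb r)).
Proof.
apply: C1I_div; [exact: clamp_sq_neq| |exact: C1I_clamp_sq].
apply: C1I_sub; apply: C1I_root; [exact: rd_inv_h|exact: C1I_inv_h|exact: rd_inv_p|exact: C1I_inv_p].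
Qed.

Lemma rootA_sq (x : vec n) i j : annulus r0 Rb x ->
  sumI (fun k => rtA x i k * rtA x j k)
  = radA r0 Rb p h x i j - lam * idmat n i j.
Proof.
rewrite /annulus => Hx; have [Hr _] := Hr0b.
rewrite sum_radm_sq /radA /radm clamp_id; last lra.
set r := vnorm x in Hx *.
have H1 := sqrt_sqrt (/ h r - lam) ltac:(have := rd_inv_h r; have := rd_lam; lra).
have H2 := sqrt_sqrt (/ p r - lam) ltac:(have := rd_inv_p r; have := rd_lam; lra).
move: H1 H2; move: (sqrt (/ h r - lam)) (sqrt (/ p r - lam)) => u v H1 H2.
have -> : / h r = u * u + lam by lra.
have -> : / p r = v * v + lam by lra.
by field; lra.
Qed.

Lemma elliptic_rootA (x : vec n) M : annulus r0 Rb x ->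
  elliptic_part lam (rtA x) M
  = sumI (fun i => sumI (fun j => radA r0 Rb p h x i j * M i j)).
Proof.
move=> Hx; rewrite /elliptic_part sum_qform -sumI_scal -sumI_add; apply: sumI_ext => i.
rewrite -(sumI_idl n i (fun j => M i j)) -sumI_scal -sumI_add; apply: sumI_ext => j.
by rewrite rootA_sq //; ring.
Qed.

Lemma radA_radial (x : vec n) a i : annulus r0 Rb x ->
  matvec (radA r0 Rb p h x) (vscal a x) i = / h (vnorm x) * a * x i.
Proof.
rewrite /annulus => Hx; have [Hr _] := Hr0b.
rewrite /radA matvec_radm_self clamp_id; last lra.
have H1 := Hp0 (vnorm x); have H2 := Hph (vnorm x).
by field; split; [|split]; lra.
Qed.

Definition flux (w : vec n -> R) (Dw : vec n -> vec n) (y : vec n) : vec n :=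
  matvec (radA r0 Rb p h y) (vsub (Dw y) (vscal (w y) (vscal (bc (vnorm y)) y))).

(** Here [bet x = div A - A b] and [gam = - div (A b)]. Since [x] is an eigenvector,
    [A b = (bc / h) x], whose divergence is explicit. Both coefficients are chosen before [w]. *)
Lemma flux_expansion : exists bet gam : R -> R, continuity bet /\ continuity gam /\
  forall x (w : vec n -> R) (Dw : vec n -> vec n) (D2w : 'I_n -> 'I_n -> R), annulus r0 Rb x ->
  (forall i, has_partial w x i (Dw x i)) ->
  (forall i j, has_partial (fun y => Dw y i) x j (D2w i j)) ->
  exists l : 'I_n -> R, (forall i, has_partial (fun y => flux w Dw y i) x i (l i)) /\
    sumI l = elliptic_part lam (rtA x) D2w
      + dot (vscal (bet (vnorm x)) x) (Dw x) + gam (vnorm x) * w x.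
Proof.
have [a' [Ha [Ha' Ha1]]] := C1I_inv_p.
have [e' [He [He' He1]]] := C1I_radA2.
have Hab : C1I r0 Rb (fun r => / h r * bc r).
  by apply: C1I_mul; [exact: C1I_inv_h|case: Hrd].
have [b' [Hb [Hb' Hb1]]] := Hab.
have [Hr _] := Hr0b.
set e := (fun r => (/ h r - / p r) / (clamp r0 Rb r * clamp r0 Rb r)) in He He1.
pose cl := clamp r0 Rb.
have Hcl : continuity cl by have [? [? _]] := C1I_clamp r0 Rb ltac:(lra).
have Hcl0 r : cl r <> 0 by have := clamp_in r0 Rb r ltac:(lra); rewrite /cl; lra.
have Hid : continuity (fun r => r).
  by move=> r; apply: derivable_continuous_pt; exact: derivable_pt_id.
pose bet r := a' r * / cl r + e' r * r + (INR n + 1) * e r - / h r * bc r.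
pose gam r := - (b' r * r + INR n * (/ h r * bc r)).
have Hcinv : continuity (fun r => / cl r).
  by move=> r; apply: continuity_pt_inv => //; exact: Hcl.
exists bet, gam; split; last split.
- apply: continuity_minus => //; apply: continuity_plus.
    by apply: continuity_plus; apply: continuity_mult.
  by apply: continuity_mult => //; exact: continuity_cst.
- apply: continuity_opp; apply: continuity_plus; apply: continuity_mult => //.
  exact: continuity_cst.
move=> x w Dw D2w Hx Hw HDw; have Hx' := Hx; rewrite /annulus in Hx'.
have [l1 [Hl1 El1]] := div_radm n _ _ _ _ x Dw D2w ltac:(lra) (Ha1 _ Hx') (He1 _ Hx') HDw.
pose r := vnorm x; pose q r := / h r * bc r.
exists (fun i => l1 i - ((Dw x i * q r + w x * (b' r / r * x i)) * x i + w x * q r * idmat n i i)); split.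
  move=> i; apply: (partial_near n (annulus r0 Rb)
    (fun y => matvec (radA r0 Rb p h y) (Dw y) i - w y * q (vnorm y) * y i)) => //.
  - exact: annulus_open.
  - move=> y Hy; rewrite /flux.
    have -> : matvec (radA r0 Rb p h y) (vsub (Dw y) (vscal (w y) (vscal (bc (vnorm y)) y))) i
      = matvec (radA r0 Rb p h y) (Dw y) i
        - matvec (radA r0 Rb p h y) (vscal (w y * bc (vnorm y)) y) i.
      by rewrite /matvec -sumI_sub; apply: sumI_ext => j; rewrite /vsub /vscal; ring.
    by rewrite radA_radial // /q; ring.
  apply: partial_sub; first exact: Hl1.
  apply: (partial_mul n (fun y => w y * q (vnorm y)) (fun y => y i)).
    by apply: partial_mul => //; apply: partial_radial; [lra|exact: Hb1].
  exact: partial_coord.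
rewrite sumI_sub El1 elliptic_rootA // dot_scall /radA -/e.
have -> : sumI (fun i => (Dw x i * q r + w x * (b' r / r * x i)) * x i + w x * q r * idmat n i i)
  = q r * dot x (Dw x) + w x * (b' r / r) * (r * r) + INR n * (w x * q r).
  rewrite /r vnorm_sq -sumI_const /dot -!sumI_scal -!sumI_add; apply: sumI_ext => i.
  by rewrite /idmat eqxx; ring.
rewrite /bet /gam -/r /cl clamp_id; last by rewrite /r; lra.
by rewrite /q; field; rewrite /r; split; last lra; have := Hp0 (vnorm x); have := Hph (vnorm x); lra.
Qed.

Lemma C1I_lipschitz f : C1I r0 Rb f -> exists K, 0 < K /\ forall r s,
  r0 < r < Rb -> r0 < s < Rb -> Rabs (f r - f s) <= K * Rabs (r - s).
Proof.
move=> [f' [_ [Hf' H]]]; have [K [HK HKb]] := continuity_bounded r0 Rb f' ltac:(lra) Hf'.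
exists K; split => //.
have Hlt r s : r0 < r < Rb -> r0 < s < Rb -> r < s -> Rabs (f s - f r) <= K * Rabs (s - r).
  move=> Hr Hs Hrs.
  have [c [-> Hc]] := MVT_cor2 f f' r s Hrs ltac:(by move=> c Hc; apply: H; lra).
  rewrite Rabs_mult; apply: Rmult_le_compat_r; [exact: Rabs_pos|apply: HKb; lra].
move=> r s Hr Hs; case: (Rtotal_order r s) => [h1|[->|h1]].
- by rewrite Rabs_minus_sym (Rabs_minus_sym r s); exact: Hlt.
- by rewrite !Rminus_diag Rabs_R0; lra.
exact: Hlt.
Qed.

Lemma C1I_bounded f : C1I r0 Rb f -> exists K, 0 < K /\ forall r, r0 <= r <= Rb -> Rabs (f r) <= K.
Proof.
by move=> [f' [Hf _]]; apply: continuity_bounded => //; lra.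
Qed.

Lemma radm_entry_bound al ga : C1I r0 Rb al -> C1I r0 Rb ga -> exists K, 0 < K /\
  forall (x : vec n) i j, annulus r0 Rb x -> Rabs (radm al ga x i j) <= K.
Proof.
move=> /C1I_bounded [K1 [HK1 H1]] /C1I_bounded [K2 [HK2 H2]].
exists (K1 + K2 * (Rb * Rb)); split; first nra.
move=> x i j; rewrite /annulus => Hx; apply: Rle_trans (Rabs_triang _ _) _; rewrite !Rabs_mult.
have h1 := H1 (vnorm x) ltac:(lra); have h2 := H2 (vnorm x) ltac:(lra).
have h3 : Rabs (idmat n i j) <= 1 by rewrite /idmat; case: (i == j); split_Rabs; lra.
have h4 := coord_le_vnorm n x i; have h5 := coord_le_vnorm n x j.
have := Rabs_pos (al (vnorm x)); have := Rabs_pos (ga (vnorm x)).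
have := Rabs_pos (x i); have := Rabs_pos (x j); have := Rabs_pos (idmat n i j).
move=> p1 p2 p3 p4 p5; apply: Rplus_le_compat; first by nra.
rewrite Rmult_assoc; apply: Rmult_le_compat => //; first by nra.
by apply: Rmult_le_compat => //; lra.
Qed.

Lemma radm_entry_lipschitz al ga : C1I r0 Rb al -> C1I r0 Rb ga -> exists K, 0 < K /\
  forall (x y : vec n) i j, annulus r0 Rb x -> annulus r0 Rb y ->
    Rabs (radm al ga x i j - radm al ga y i j) <= K * dist x y.
Proof.
move=> /C1I_lipschitz [K1 [HK1 H1]] Hga.
have [K2 [HK2 H2]] := C1I_lipschitz ga Hga; have [K3 [HK3 H3]] := C1I_bounded ga Hga.
exists (K1 + K2 * (Rb * Rb) + 2 * K3 * Rb); split; first nra.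
move=> x y i j; rewrite /annulus => Hx Hy.
have -> : radm al ga x i j - radm al ga y i j
  = (al (vnorm x) - al (vnorm y)) * idmat n i j
    + ((ga (vnorm x) - ga (vnorm y)) * (x i * x j)
       + ga (vnorm y) * ((x i - y i) * x j + y i * (x j - y j))) by rewrite /radm; ring.
have h1 := H1 _ _ Hx Hy; have h2 := H2 _ _ Hx Hy; have h3 := H3 (vnorm y) ltac:(lra).
have hd := vnorm_diff n x y; have Hd0 := vnorm_ge0 n (vsub x y).
have h4 : Rabs (idmat n i j) <= 1 by rewrite /idmat; case: (i == j); split_Rabs; lra.
have cxi := coord_le_vnorm n x i; have cxj := coord_le_vnorm n x j.
have cyi := coord_le_vnorm n y i.
have di := coord_le_vnorm n (vsub x y) i; have dj := coord_le_vnorm n (vsub x y) j.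
rewrite /vsub in di dj; rewrite -/(vsub x y) in di dj.
apply: Rle_trans (Rabs_triang _ _) _.
apply: (Rle_trans _ (K1 * dist x y + (K2 * dist x y * (Rb * Rb)
    + K3 * (dist x y * Rb + Rb * dist x y)))); last by apply: Req_le; ring.
apply: Rplus_le_compat.
  rewrite -[X in _ <= X]Rmult_1_r; apply: Rabs_mult_le => //.
  by apply: Rle_trans h1 _; apply: Rmult_le_compat_l; lra.
apply: Rle_trans (Rabs_triang _ _) _; apply: Rplus_le_compat.
  apply: Rabs_mult_le; last by apply: Rabs_mult_le; lra.
  by apply: Rle_trans h2 _; apply: Rmult_le_compat_l; lra.
apply: Rabs_mult_le => //; apply: Rle_trans (Rabs_triang _ _) _.
apply: Rplus_le_compat; apply: Rabs_mult_le => //; lra.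
Qed.

Lemma rootA_lipschitz : exists Lp, 0 <= Lp /\
  forall x y : vec n, annulus r0 Rb x -> annulus r0 Rb y ->
     sumI (fun k => dot (vsub (fun i => rtA x i k) (fun i => rtA y i k))
                        (vsub (fun i => rtA x i k) (fun i => rtA y i k)))
     <= Lp * (dist x y * dist x y).
Proof.
have [K [HK H]] := radm_entry_lipschitz _ _ (C1I_root _ rd_inv_p C1I_inv_p) C1I_rootA2.
have Hn := pos_INR n.
exists (INR n * (INR n * (K * K))); split; first by nra.
move=> x y Hx Hy.
have -> : INR n * (INR n * (K * K)) * (dist x y * dist x y)
  = sumI (fun _ : 'I_n => sumI (fun _ : 'I_n => (K * dist x y) * (K * dist x y))).
  by rewrite !sumI_const; ring.
apply: sumI_le => k; apply: sumI_le => i; have := H x y i k Hx Hy.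
rewrite -/(rtA x i k) -/(rtA y i k) /vsub -/(vsub x y).
have := vnorm_ge0 n (vsub x y); split_Rabs; nra.
Qed.

Lemma rootA_trace : exists Tr, 0 <= Tr /\ forall x : vec n, annulus r0 Rb x ->
  sumI (fun k => dot (fun i => rtA x i k) (fun i => rtA x i k)) <= Tr.
Proof.
have [K [HK H]] := radm_entry_bound _ _ (C1I_root _ rd_inv_p C1I_inv_p) C1I_rootA2.
have Hn := pos_INR n.
exists (INR n * (INR n * (K * K))); split; first by nra.
move=> x Hx; rewrite -!sumI_const; apply: sumI_le => k; apply: sumI_le => i.
have := H x i k Hx; rewrite -/(rtA x i k); split_Rabs; nra.
Qed.

End RadialSystem.

(** * Decay of the supremum *)

Definition flux_expands (n : nat) r0 Rb C0 p h bc (bet gam : R -> R) : Prop :=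
  forall (x : vec n) (w : vec n -> R) (Dw : vec n -> vec n) (D2w : 'I_n -> 'I_n -> R),
  annulus r0 Rb x ->
  (forall i, has_partial w x i (Dw x i)) ->
  (forall i j, has_partial (fun y => Dw y i) x j (D2w i j)) ->
  exists l : 'I_n -> R,
    (forall i, has_partial (fun y => flux n r0 Rb p h bc w Dw y i) x i (l i)) /\
    sumI l = elliptic_part (/ (2 * C0)) (rootA r0 Rb (/ (2 * C0)) p h x) D2w
      + dot (vscal (bet (vnorm x)) x) (Dw x) + gam (vnorm x) * w x.

Definition radial_hessian {n} (f2 f1 : R -> R) (x : vec n) : 'I_n -> 'I_n -> R :=
  fun i j => f2 (vnorm x) * x i * x j + f1 (vnorm x) * idmat n i j.

Lemma exp_le_exp u v : u <= v -> exp u <= exp v.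
Proof. by case=> [/exp_increasing|->]; lra. Qed.

Lemma decreasing_of_derivative f f' a b : a <= b ->
  (forall r, a <= r <= b -> derivable_pt_lim f r (f' r)) ->
  (forall r, a <= r <= b -> f' r <= 0) -> f b <= f a.
Proof.
move=> Hab Hd Hs; case: (Req_dec a b) => [->|Hne]; first lra.
have [c [E Hc]] := MVT_cor2 f f' a b ltac:(lra) Hd.
have := Hs c ltac:(lra); nra.
Qed.

(** Puts a derivative into the form expected by [C2_radial]; dividing by the clamped radius keeps
    [g] continuous at 0. *)
Lemma C1I_div_clamp r0 Rb f : 0 < r0 < Rb -> C1I r0 Rb f ->
  exists g, continuity g /\ forall r, r0 < r < Rb -> derivable_pt_lim f r (g r * r).
Proof.
move=> Hr [f' [_ [Hf' H]]]; exists (fun r => f' r / clamp r0 Rb r); split.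
  have [_ [Hc _]] := C1I_clamp r0 Rb ltac:(lra).
  move=> r; apply: continuity_pt_mult; first exact: Hf'.
  by apply: continuity_pt_inv; [exact: Hc|have := clamp_in r0 Rb r ltac:(lra); lra].
move=> r Hrr; rewrite clamp_id; last lra.
by have -> : f' r / r * r = f' r by [field; lra]; exact: H.
Qed.

Section SupBound.
Context (n : nat) (r0 Rb C0 : R) (p h bc : R -> R) (Hrd : radial_data r0 Rb C0 p h bc).
Context (bet gam : R -> R) (Hexp : flux_expands n r0 Rb C0 p h bc bet gam).
Context (Hn : 2 <= INR n) (N eta : R).
(** The quantity [bc r^2] is [b . x]. The divergence of [r^N e^Lam x] is
    [r^N e^Lam (b . x + N + n)], and this bound makes the bracket at least [2 n >= 4]. *)
Context (HbcN : forall r, r0 < r < Rb -> Rabs (bc r * (r * r)) <= N - INR n).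
Context (Heta0 : 0 <= eta) (Heta : eta * C0 * Rpower Rb (N + 2) <= 2 * N * Rpower r0 N).

Let Hr0b : 0 < r0 < Rb := rd_r Hrd.
Let HN : INR n <= N.
Proof.
have := HbcN ((r0 + Rb) / 2) ltac:(lra).
have := Rabs_pos (bc ((r0 + Rb) / 2) * ((r0 + Rb) / 2 * ((r0 + Rb) / 2))); lra.
Qed.

Definition radial_weight (r : R) : R := Rpower (clamp r0 Rb r) N.

Let Ck : C1I r0 Rb radial_weight.
Proof.
apply: C1I_Rpower; last by apply: C1I_clamp; lra.
by move=> r; have := clamp_in r0 Rb r ltac:(lra); lra.
Qed.

(* [psi' = - r^(N+1) h], so that [A grad psi = - r^N x] by the choice of [h]. *)
Lemma radial_profile : exists psi psi0 psi1, C1I r0 Rb psi /\ 0 < psi0 /\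
  (forall r, derivable_pt_lim psi r (- (radial_weight r * r * h r))) /\
  (forall r, r0 <= r <= Rb -> psi0 <= psi r <= psi1) /\
  (forall r, r0 <= r <= Rb -> eta * psi r <= 3 * Rpower r0 N).
Proof.
have HC0 := rd_C0 r0 Rb C0 p h bc Hrd.
have Cf : C1I r0 Rb (fun r => radial_weight r * r * h r).
  apply: C1I_mul; last by case: Hrd.
  by apply: C1I_mul => //; exact: C1I_id.
have [I [CI HI]] := C1I_integral r0 Rb _ Cf.
have Hq0 : 0 < Rpower r0 N by exact: exp_pos.
(* A positive minimum so small that [eta * psi0 <= r0^N]; the hypothesis on [eta] leaves at most
   [2 r0^N] for the variable part of [psi]. *)
pose psi0 := Rpower r0 N / (1 + eta).
have Hpsi0 : 0 < psi0 by apply: Rdiv_lt_0_compat; lra.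
have Ep0 : eta * psi0 <= Rpower r0 N.
  have -> : eta * psi0 = Rpower r0 N - psi0 by rewrite /psi0; field; lra.
  by lra.
(* [c s^(N+2)] is a primitive of [C0 s^(N+1)], which dominates the integrand because [h <= C0]. *)
pose c := C0 / (N + 2).
have Hc : 0 < c by apply: Rdiv_lt_0_compat; lra.
have Hpos r : 0 < h r by have := rd_p0 Hrd r; have := rd_ph Hrd r; lra.
have Hw r : 0 < radial_weight r by exact: exp_pos.
have Hup r : r0 <= r <= Rb -> I Rb - I r <= c * Rpower Rb (N + 2).
  move=> Hr.
  have := decreasing_of_derivative (fun s => I s - c * Rpower s (N + 2))
    (fun s => radial_weight s * s * h s - c * ((N + 2) * Rpower s (N + 2 - 1))) r Rb ltac:(lra) _ _.
  have := Rmult_le_pos _ _ (Rlt_le _ _ Hc) (Rlt_le _ _ (exp_pos ((N + 2) * ln r))).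
  rewrite -/(Rpower r (N + 2)) => h1 h2.
  suff : I Rb - c * Rpower Rb (N + 2) <= I r - c * Rpower r (N + 2) by lra.
  apply: h2 => s Hs.
    apply: derivable_pt_lim_minus; first exact: HI.
    by apply: derivable_pt_lim_scal; apply: derivable_pt_lim_power; lra.
  have -> : N + 2 - 1 = N + 1 by ring.
  rewrite Rpower_plus Rpower_1; last lra.
  rewrite /radial_weight clamp_id; last lra.
  have -> : c * ((N + 2) * (Rpower s N * s)) = Rpower s N * s * C0 by rewrite /c; field; lra.
  have h3 : 0 < Rpower s N * s by apply: Rmult_lt_0_compat; [exact: exp_pos|lra].
  by have := Rmult_le_compat_l _ _ _ (Rlt_le _ _ h3) (rd_hC Hrd s); lra.
have Hlow r : r0 <= r <= Rb -> 0 <= I Rb - I r.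
  move=> Hr.
  have := decreasing_of_derivative (fun s => - I s) (fun s => - (radial_weight s * s * h s)) r Rb
    ltac:(lra) (fun s _ => derivable_pt_lim_opp _ _ _ (HI s)) _.
  suff Hneg s : r <= s <= Rb -> - (radial_weight s * s * h s) <= 0 by move=> /(_ Hneg); lra.
  move=> Hs; have : 0 < radial_weight s * s * h s; last lra.
  by apply: Rmult_lt_0_compat => //; apply: Rmult_lt_0_compat => //; lra.
exists (fun r => psi0 + I Rb - I r), psi0, (psi0 + c * Rpower Rb (N + 2)); split.
  by apply: C1I_sub => //; exact: C1I_const.
split => //; split.
  move=> r; have -> : - (radial_weight r * r * h r) = 0 - radial_weight r * r * h r by ring.
  by apply: derivable_pt_lim_minus; [exact: derivable_pt_lim_const|exact: HI].
split=> r Hr; first by have := Hup r Hr; have := Hlow r Hr; lra.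
have h1 := Rmult_le_compat_l eta _ _ Heta0 (Hup r Hr).
have h2 : eta * (c * Rpower Rb (N + 2)) <= 2 * Rpower r0 N.
  apply: (Rmult_le_reg_r (N + 2)); first lra.
  have -> : eta * (c * Rpower Rb (N + 2)) * (N + 2) = eta * C0 * Rpower Rb (N + 2).
    by rewrite /c; field; lra.
  by lra.
have -> : psi0 + I Rb - I r = psi0 + (I Rb - I r) by ring.
lra.
Qed.

(** The witnesses are [b = e^Lam], whose zero flux makes [k'] disappear from the bound, and
    [a = e^Lam psi], whose flux is [- e^Lam r^N x]. The divergence of the latter is at most
    [- 4 e^Lam r0^N]: three quarters pay for [eta a], and the last quarter is the margin [theta]
    against the source. *)
Lemma barrier : exists a a1 a2 b b1 b2 : R -> R, exists m Mx theta,
  0 < m /\ 0 < theta /\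
  (continuity a /\ continuity a1 /\ continuity a2 /\ continuity b /\ continuity b1 /\ continuity b2) /\
  (forall r, r0 <= r <= Rb -> m <= a r <= Mx /\ m <= b r <= Mx) /\
  (forall r, r0 < r < Rb ->
     derivable_pt_lim a r (a1 r * r) /\ derivable_pt_lim a1 r (a2 r * r) /\
     derivable_pt_lim b r (b1 r * r) /\ derivable_pt_lim b1 r (b2 r * r)) /\
  (forall (x : vec n) k k', annulus r0 Rb x -> 0 <= k ->
     elliptic_part (/ (2 * C0)) (rootA r0 Rb (/ (2 * C0)) p h x)
       (radial_hessian (fun r => k * a2 r + k' * b2 r) (fun r => k * a1 r + k' * b1 r) x)
     + dot (vscal (bet (vnorm x)) x) (vscal (k * a1 (vnorm x) + k' * b1 (vnorm x)) x)
     + gam (vnorm x) * (k * a (vnorm x) + k' * b (vnorm x))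
     <= - k * (eta * a (vnorm x) + theta)).
Proof.
have [psi [psi0 [psi1 [Cpsi [Hpsi0 [Dpsi [Hpsi Hepsi]]]]]]] := radial_profile.
have Cbc : C1I r0 Rb bc by case: Hrd.
have Ch : C1I r0 Rb h by case: Hrd.
have [La [CLa DLa]] := C1I_integral r0 Rb (fun r => bc r * r) (C1I_mul _ _ _ _ Cbc (C1I_id _ _)).
pose b r := exp (La r); pose a r := b r * psi r.
pose b1 r := b r * bc r; pose a1 r := b r * (bc r * psi r - radial_weight r * h r).
have Cb : C1I r0 Rb b by exact: C1I_exp.
have Ca : C1I r0 Rb a by exact: C1I_mul.
have Cb1 : C1I r0 Rb b1 by exact: C1I_mul.
have Ca1 : C1I r0 Rb a1.
  by apply: C1I_mul => //; apply: C1I_sub; exact: C1I_mul.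
have [a2 [Ka2 Da2]] := C1I_div_clamp _ _ _ Hr0b Ca1.
have [b2 [Kb2 Db2]] := C1I_div_clamp _ _ _ Hr0b Cb1.
have Db r : derivable_pt_lim b r (b1 r * r).
  have := derivable_pt_lim_comp La exp r _ _ (DLa r) (derivable_pt_lim_exp (La r)).
  by rewrite /b1 /b Rmult_assoc.
have Da r : derivable_pt_lim a r (a1 r * r).
  have := derivable_pt_lim_mult _ _ _ _ _ (Db r) (Dpsi r).
  by have -> : b1 r * r * psi r + b r * - (radial_weight r * r * h r) = a1 r * r by rewrite /a1 /b1; ring.
have [KL [HKL HL]] := C1I_bounded r0 Rb C0 p h bc Hrd La CLa.
have Hb r : r0 <= r <= Rb -> exp (- KL) <= b r <= exp KL.
  move=> /HL Hr.
  by split; apply: exp_le_exp; split_Rabs; lra.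
pose m := Rmin (exp (- KL)) (exp (- KL) * psi0).
have Hem := exp_pos (- KL).
have Hm : 0 < m by apply: Rmin_pos => //; exact: Rmult_lt_0_compat.
have Hq0 : 0 < Rpower r0 N by exact: exp_pos.
exists a, a1, a2, b, b1, b2, m, (exp KL + exp KL * Rabs psi1), (exp (- KL) * Rpower r0 N).
split => //; split; first exact: Rmult_lt_0_compat.
have cont f : C1I r0 Rb f -> continuity f by case=> ? [].
split; first by split; [|split; [|split; [|split; [|split]]]] => //; exact: cont.
split.
  move=> r Hr; have [hb1 hb2] := Hb r Hr; have [hp1 hp2] := Hpsi r Hr.
  have hm1 : m <= exp (- KL) by exact: Rmin_l.
  have hm2 : m <= exp (- KL) * psi0 by exact: Rmin_r.
  have hE := exp_pos KL; have h1 := Rle_abs psi1; have h2 := Rabs_pos psi1.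
  have h3 : 0 <= exp KL * Rabs psi1 by apply: Rmult_le_pos; lra.
  split; last lra.
  split; rewrite /a.
    by apply: Rle_trans hm2 _; apply: Rmult_le_compat; lra.
  apply: (Rle_trans _ (exp KL * Rabs psi1)); last lra.
  by apply: Rmult_le_compat; lra.
split; first by move=> r Hr; split => //; split; [exact: Da2|split => //; exact: Db2].
move=> x k k' Hx Hk; have Hx' := Hx; rewrite /annulus in Hx'.
pose phi r := k * a r + k' * b r; pose phi1 r := k * a1 r + k' * b1 r.
pose phi2 r := k * a2 r + k' * b2 r.
have [|||||HC2D HC2D2 _ _] := C2_radial n (annulus r0 Rb) r0 Rb phi phi1 phi2 ltac:(lra).
- by [].
- move=> r Hr; rewrite /phi /phi1.
  have -> : (k * a1 r + k' * b1 r) * r = k * (a1 r * r) + k' * (b1 r * r) by ring.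
  by apply: derivable_pt_lim_plus; exact: derivable_pt_lim_scal.
- move=> r Hr; rewrite /phi2 /phi1.
  have -> : (k * a2 r + k' * b2 r) * r = k * (a2 r * r) + k' * (b2 r * r) by ring.
  by apply: derivable_pt_lim_plus; apply: derivable_pt_lim_scal; [exact: Da2|exact: Db2].
- apply: continuity_plus; apply: continuity_mult; (try exact: continuity_cst); exact: cont.
- by apply: continuity_plus; apply: continuity_mult => //; exact: continuity_cst.
(* The operator is evaluated without expanding second derivatives: it equals the divergence of the
   flux, which is explicit, and partial derivatives are unique. *)
have [l [Hl El]] := Hexp x (fun y => phi (vnorm y)) (fun y => vscal (phi1 (vnorm y)) y)
  (radial_hessian phi2 phi1 x) Hx (fun i => HC2D x i Hx) (fun i j => HC2D2 x i j Hx).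
rewrite -/(phi (vnorm x)) -/(phi1 (vnorm x)) -El.
pose r := vnorm x; pose z s := k * (b s * radial_weight s).
have Hz : derivable_pt_lim z r (k * (b1 r * r * radial_weight r + b r * (N * radial_weight r / r))).
  apply: derivable_pt_lim_scal; apply: derivable_pt_lim_mult; first exact: Db.
  apply: (derivable_pt_lim_locally_ext (fun s => Rpower s N) _ _ r0 Rb _ Hx').
    by move=> s Hs; rewrite /radial_weight clamp_id //; lra.
  have -> : N * radial_weight r / r = N * Rpower r (N - 1).
    rewrite /radial_weight clamp_id; last by rewrite /r; lra.
    rewrite /Rminus Rpower_plus Rpower_Ropp Rpower_1; last by rewrite /r; lra.
    by field; rewrite /r; lra.
  by apply: derivable_pt_lim_power; rewrite /r; lra.
have Hl' i : l i = - ((k * (b1 r * r * radial_weight r + b r * (N * radial_weight r / r)) / r * x i) * x i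
    + z r * idmat n i i).
  apply: (partial_unique n _ x i _ _ (Hl i)).
  apply: (partial_near n (annulus r0 Rb) (fun y => - (z (vnorm y) * y i))) => //; first exact: annulus_open.
    move=> y Hy; rewrite /flux.
    have -> : vsub (vscal (phi1 (vnorm y)) y) (vscal (phi (vnorm y)) (vscal (bc (vnorm y)) y))
      = vscal (- (k * (b (vnorm y) * radial_weight (vnorm y) * h (vnorm y)))) y.
      apply: functional_extensionality => j; rewrite /vsub /vscal /phi /phi1 /a /a1 /b1; ring.
    rewrite (radA_radial n r0 Rb C0 p h bc Hrd) // /z; field.
    by have := rd_p0 Hrd (vnorm y); have := rd_ph Hrd (vnorm y); lra.
  apply: (partial_opp n (fun y => z (vnorm y) * y i)).
  apply: (partial_mul n (fun y => z (vnorm y)) (fun y => y i)); last exact: partial_coord.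
  by apply: partial_radial => //; lra.
have -> : sumI l = - k * (b r * radial_weight r * (bc r * (r * r) + N + INR n)).
  rewrite (sumI_ext _ _ _ Hl').
  have -> : sumI (fun i => - ((k * (b1 r * r * radial_weight r + b r * (N * radial_weight r / r)) / r * x i) * x i
    + z r * idmat n i i))
    = - (k * (b1 r * r * radial_weight r + b r * (N * radial_weight r / r)) / r) * (r * r)
      - z r * INR n.
    rewrite /r vnorm_sq -/r (Rmult_comm (z r)) -(sumI_const n (z r)) /dot -sumI_scal -sumI_sub.
    by apply: sumI_ext => i; rewrite /idmat eqxx; ring.
  by rewrite /z /b1; field; rewrite /r; lra.
rewrite -!Ropp_mult_distr_l; apply: Ropp_le_contravar; apply: Rmult_le_compat_l => //.
rewrite -/r /a.
have [hb1 hb2] := Hb r ltac:(rewrite /r; lra).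
have hr : r0 < r < Rb by [].
have hbc := HbcN r hr.
have hw : Rpower r0 N <= radial_weight r.
  rewrite /radial_weight clamp_id; last lra.
  by apply: Rle_Rpower_l; lra.
have he := Hepsi r ltac:(lra).
have h4 : 4 * Rpower r0 N <= radial_weight r * (bc r * (r * r) + N + INR n).
  have : 4 <= bc r * (r * r) + N + INR n by move: hbc; split_Rabs; lra.
  by nra.
have h5 : b r * (4 * Rpower r0 N) <= b r * (radial_weight r * (bc r * (r * r) + N + INR n)).
  by apply: Rmult_le_compat_l; lra.
have h6 : b r * (eta * psi r) <= b r * (3 * Rpower r0 N) by apply: Rmult_le_compat_l; lra.
have h7 : exp (- KL) * Rpower r0 N <= b r * Rpower r0 N by apply: Rmult_le_compat_r; lra.
lra.
Qed.

Record solution_after (U : vec n -> Prop) F w Dw D2w wt T0 D6 : Prop := SolutionAfter {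
  sa_open : is_open U;
  sa_annulus : forall x, U x -> annulus r0 Rb x;
  sa_cont : cont_xt (fun x t => closure U x /\ T0 <= t) w;
  sa_C2 : forall t, T0 < t -> C2_on U (fun x => w x t) (fun x => Dw x t) (fun x => D2w x t);
  sa_eq : forall x t, U x -> T0 < t ->
    parabolic_on (/ (2 * C0)) (rootA r0 Rb (/ (2 * C0)) p h) (fun x => vscal (bet (vnorm x)) x)
      (fun x t => gam (vnorm x) * w x t + F x t) w Dw D2w wt x t;
  sa_F : forall x t, U x -> T0 < t -> Rabs (F x t) <= D6 }.

Lemma sup_estimate_upper : exists C, 0 < C /\
  forall (U : vec n -> Prop) F w Dw D2w wt T0 S D6 D7,
  solution_after U F w Dw D2w wt T0 D6 -> 0 <= S -> 0 <= D6 -> 0 <= D7 ->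
  (forall x, closure U x -> w x T0 <= S) ->
  (forall x t, bdry U x -> T0 <= t -> w x t <= D7) ->
  forall x t, closure U x -> T0 <= t -> w x t <= C * (exp (- eta * (t - T0)) * S + D6 + D7).
Proof.
have [a [a1 [a2 [b [b1 [b2 [m [Mx [th [Hm [Hth [[Ka [Ka1 [Ka2 [Kb [Kb1 Kb2]]]]] [Hab [Hder Hop]]]]]]]]]]]]]] := barrier.
have HMx : 0 < Mx by have := Hab r0 ltac:(lra); lra.
have Hmi : 0 < Mx / m by exact: Rdiv_lt_0_compat.
have Hti : 0 < Mx / th by exact: Rdiv_lt_0_compat.
exists (Mx / m + Mx / th); split; first lra.
move=> U F w Dw D2w wt T0 S D6 D7 [HU HUa Hw HC Heq HF] HS HD6 HD7 Hic Hbc x t Hx Ht.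
apply: le_epsilon => e He.
(* These dominate the initial values, the source and the boundary values. The term [e * th / Mx]
   makes the supersolution inequality strict and costs exactly [e] in the end. *)
pose K1 := S / m; pose K2 := (D6 + e * th / Mx) / th; pose K3 := D7 / m.
have HK1 : 0 <= K1 by apply: Rdiv_le_0_compat.
have HK3 : 0 <= K3 by apply: Rdiv_le_0_compat.
have Hee : 0 < e * th / Mx by apply: Rdiv_lt_0_compat => //; nra.
have HK2 : 0 < K2 by apply: Rdiv_lt_0_compat => //; lra.
have EK1 : K1 * m = S by rewrite /K1; field; lra.
have EK3 : K3 * m = D7 by rewrite /K3; field; lra.
have EK2 : K2 * th = D6 + e * th / Mx by rewrite /K2; field; lra.
pose k s := K1 * exp (- eta * (s - T0)) + K2.
have Hcl y : closure U y -> r0 <= vnorm y <= Rb.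
  move=> Hy; split; apply: le_epsilon => d Hd; have [z [Hz Hyz]] := Hy d Hd;
  have := HUa z Hz; have := vnorm_diff n z y; rewrite /annulus; split_Rabs; lra.
have HE s : 0 < exp (- eta * (s - T0)) by exact: exp_pos.
have Hk s : 0 < k s by have := Rmult_le_pos _ _ HK1 (Rlt_le _ _ (HE s)); rewrite /k; lra.
pose Psi (y : vec n) s := k s * a (vnorm y) + K3 * b (vnorm y).
have HPsi : w x t <= Psi x t.
  apply: (comparison_principle n U Rb (/ (2 * C0)) (rootA r0 Rb (/ (2 * C0)) p h)
    (fun x => vscal (bet (vnorm x)) x) (fun x => gam (vnorm x)) F w Dw D2w wt Psi
    (fun y s => vscal (k s * a1 (vnorm y) + K3 * b1 (vnorm y)) y)
    (fun y s => radial_hessian (fun r => k s * a2 r + K3 * b2 r) (fun r => k s * a1 r + K3 * b1 r) y)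
    (fun y s => - eta * (K1 * exp (- eta * (s - T0))) * a (vnorm y)) T0) => //.
  - by move=> y Hy; have := HUa y Hy; rewrite /annulus; lra.
  - exact/Rlt_le/(rd_lam r0 Rb C0 p h bc).
  - move=> X u y s HX Hu; have HX' := vcv_vnorm _ _ _ HX.
    apply: CV_plus; apply: CV_mult.
    + apply: CV_plus; last exact: Un_cv_const.
      apply: CV_mult; first exact: Un_cv_const.
      apply: (continuity_seq (fun s => exp (- eta * (s - T0)))) => //.
      apply: derivable_continuous_pt; apply: ex_derive_Reals_0; auto_derive; done.
    + exact: continuity_seq.
    + exact: Un_cv_const.
    + exact: continuity_seq.
  - move=> y s /Hcl Hy Hs; have [[h1 _] [h2 _]] := Hab _ Hy; rewrite /Psi.
    have := Rmult_lt_0_compat _ _ (Hk s) (Rlt_le_trans _ _ _ Hm h1).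
    by have := Rmult_le_pos _ _ HK3 (Rlt_le _ _ (Rlt_le_trans _ _ _ Hm h2)); lra.
  - move=> s Hs.
    apply: (C2_radial n U r0 Rb (fun r => k s * a r + K3 * b r) (fun r => k s * a1 r + K3 * b1 r)
      (fun r => k s * a2 r + K3 * b2 r)) => //; first lra.
    + move=> r Hr; have [h1 [_ [h2 _]]] := Hder r Hr.
      have -> : (k s * a1 r + K3 * b1 r) * r = k s * (a1 r * r) + K3 * (b1 r * r) by ring.
      by apply: derivable_pt_lim_plus; exact: derivable_pt_lim_scal.
    + move=> r Hr; have [_ [h1 [_ h2]]] := Hder r Hr.
      have -> : (k s * a2 r + K3 * b2 r) * r = k s * (a2 r * r) + K3 * (b2 r * r) by ring.
      by apply: derivable_pt_lim_plus; exact: derivable_pt_lim_scal.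
    + by apply: continuity_plus; apply: continuity_mult => //; exact: continuity_cst.
    + by apply: continuity_plus; apply: continuity_mult => //; exact: continuity_cst.
  - move=> y s Hy Hs; split.
      apply/is_derive_Reals; rewrite /Psi /k; auto_derive => //; rewrite /Rminus; ring.
    have := Hop y (k s) K3 (HUa y Hy) (Rlt_le _ _ (Hk s)).
    have := HF y s Hy Hs.
    have [[h1 _] _] := Hab (vnorm y) (Hcl y (closure_sub _ _ _ Hy)).
    have h2 : 0 <= eta * a (vnorm y) by apply: Rmult_le_pos; lra.
    have h3 := Rmult_le_pos _ _ (Rmult_le_pos _ _ HK1 (Rlt_le _ _ (HE s))) (Rlt_le _ _ Hth).
    have h4 := Rmult_le_pos _ _ (Rlt_le _ _ HK2) h2.
    rewrite /Psi /k; move: (exp _) h3 => E h3; lra.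
  - move=> y Hy; apply: Rle_trans (Hic y Hy) _; rewrite /Psi /k Rminus_diag Rmult_0_r exp_0.
    have [[h1 _] [h2 _]] := Hab _ (Hcl y Hy).
    have := Rmult_le_compat_l K1 _ _ HK1 h1; have := Rmult_le_pos K3 (b (vnorm y)) HK3 ltac:(lra).
    by have := Rmult_le_pos K2 (a (vnorm y)) ltac:(lra) ltac:(lra); lra.
  - move=> y s Hy Hs; apply: Rle_trans (Hbc y s Hy Hs) _; rewrite /Psi.
    have [[h1 _] [h2 _]] := Hab _ (Hcl y (proj1 Hy)).
    have := Rmult_le_compat_l K3 _ _ HK3 h2.
    by have := Rmult_le_pos (k s) (a (vnorm y)) ltac:(have := Hk s; lra) ltac:(lra); lra.
apply: Rle_trans HPsi _; rewrite /Psi.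
have [[_ h1] [_ h2]] := Hab _ (Hcl x Hx).
have h3 := Rmult_le_compat_l _ _ _ (Rlt_le _ _ (Hk t)) h1.
have h4 := Rmult_le_compat_l _ _ _ HK3 h2.
apply: (Rle_trans _ (k t * Mx + K3 * Mx)); first lra.
have -> : k t * Mx + K3 * Mx = Mx / m * (exp (- eta * (t - T0)) * S) + Mx / m * D7 + Mx / th * D6 + e.
  by rewrite /k /K1 /K2 /K3; field; lra.
have := Rmult_le_pos _ _ (Rlt_le _ _ (HE t)) HS.
move: (exp _ * S) => ES hES.
have := Rmult_le_pos _ _ (Rlt_le _ _ Hti) hES; have := Rmult_le_pos _ _ (Rlt_le _ _ Hti) HD7.
have := Rmult_le_pos _ _ (Rlt_le _ _ Hmi) HD6; lra.
Qed.

Lemma elliptic_part_opp lam (P : mat n) M :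
  elliptic_part lam P (fun i j => -1 * M i j) = -1 * elliptic_part lam P M.
Proof.
rewrite /elliptic_part sumI_scal Rmult_plus_distr_l -(sumI_scal n (-1) (fun k => qform M _)).
congr (_ + _); first ring.
apply: sumI_ext => k; rewrite /qform -sumI_scal; apply: sumI_ext => i.
by rewrite -Rmult_assoc -sumI_scal; congr (_ * _); apply: sumI_ext => j; ring.
Qed.

Lemma sup_estimate : exists C, 0 < C /\
  forall (U : vec n -> Prop) F w Dw D2w wt T0 S D6 D7,
  solution_after U F w Dw D2w wt T0 D6 -> 0 <= S -> 0 <= D6 -> 0 <= D7 ->
  (forall x, closure U x -> Rabs (w x T0) <= S) ->
  (forall x t, bdry U x -> T0 <= t -> Rabs (w x t) <= D7) ->
  forall x t, closure U x -> T0 <= t ->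
    Rabs (w x t) <= C * (exp (- eta * (t - T0)) * S + D6 + D7).
Proof.
have [C [HC H]] := sup_estimate_upper; exists C; split => //.
move=> U F w Dw D2w wt T0 S D6 D7 Hsol HS HD6 HD7 Hic Hbc x t Hx Ht.
apply: Rabs_le; split; last first.
  apply: (H U F w Dw D2w wt) => //.
    by move=> y Hy; have := Hic y Hy; split_Rabs; lra.
  by move=> y s Hy Hs; have := Hbc y s Hy Hs; split_Rabs; lra.
suff : -1 * w x t <= C * (exp (- eta * (t - T0)) * S + D6 + D7) by lra.
have [HU HUa Hw HC2 Heq HF] := Hsol.
apply: (H U (fun y s => -1 * F y s) (fun y s => -1 * w y s) (fun y s => vscal (-1) (Dw y s))
  (fun y s i j => -1 * D2w y s i j) (fun y s => -1 * wt y s)) => //; first split => //.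
- move=> y s Hys e He; have [d [Hd Hwd]] := Hw y s Hys e He; exists d; split => // z r Hzr h1 h2.
  by have := Hwd z r Hzr h1 h2; split_Rabs; lra.
- by move=> s Hs'; apply: C2_scal; exact: HC2.
- move=> y s Hy Hs'; have [h1 h2] := Heq y s Hy Hs'; split; first exact: derivable_pt_lim_scal.
  rewrite h2 elliptic_part_opp (dot_scalr n (-1)); ring.
- by move=> y s Hy Hs'; have := HF y s Hy Hs'; split_Rabs; lra.
- by move=> y Hy; have := Hic y Hy; split_Rabs; lra.
- by move=> y s Hy Hs; have := Hbc y s Hy Hs; split_Rabs; lra.
Qed.

End SupBound.

(** * Velocity bound *)

Lemma matvec_norm_le n (M : mat n) (x : vec n) K : 0 <= K -> (forall i j, Rabs (M i j) <= K) ->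
  vnorm (matvec M x) <= INR n * (INR n * K) * vnorm x.
Proof.
move=> HK H; rewrite Rmult_assoc; apply: vnorm_le_bound => i; apply: Rle_trans (sumI_Rabs _ _) _.
rewrite Rmult_assoc -sumI_const; apply: sumI_le => j.
by apply: Rabs_mult_le => //; exact: coord_le_vnorm.
Qed.

Lemma entry_le_frobenius n (D : 'I_n -> 'I_n -> R) i j :
  Rabs (D i j) <= sqrt (sumI (fun i => sumI (fun j => D i j ^ 2))).
Proof.
rewrite -(sqrt_Rsqr_abs (D i j)); apply: sqrt_le_1_alt.
have -> : Rsqr (D i j) = D i j ^ 2 by rewrite /Rsqr; ring.
apply: Rle_trans (sumI_term_le n j (fun j => D i j ^ 2) _) _; first by move=> k; exact: pow2_ge_0.
apply: (sumI_term_le n i (fun i => sumI (fun j => D i j ^ 2))) => k.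
by apply: sumI_ge0 => l; exact: pow2_ge_0.
Qed.

Lemma vnorm_vadd_le n (x y : vec n) a b : vnorm x <= a -> vnorm y <= b -> vnorm (vadd x y) <= a + b.
Proof. by move=> h1 h2; have := vnorm_triang n x y; lra. Qed.

Lemma vnorm_vsub_le n (x y : vec n) a b : vnorm x <= a -> vnorm y <= b -> dist x y <= a + b.
Proof.
move=> h1 h2; have -> : vsub x y = vadd x (vscal (-1) y) by vec_ring.
by apply: vnorm_vadd_le => //; rewrite vnorm_scal Rabs_Ropp Rabs_R1; lra.
Qed.

Definition velocity n r0 Rb p h bc (mt me : R -> R) (w : vec n -> R -> R) (Dw V : vec n -> R -> vec n)
    (x : vec n) (t : R) : vec n :=
  vadd (flux n r0 Rb p h bc (fun y => w y t) (fun y => Dw y t) x) (matvec (radm mt me x) (V x t)).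

Record radial_solution n r0 Rb p h bc mt me (U : vec n -> Prop) (w : vec n -> R -> R)
    (Dw : vec n -> R -> vec n) D2w wt (V : vec n -> R -> vec n)
    (DV : vec n -> R -> 'I_n -> 'I_n -> R) : Prop := RadialSolution {
  rs_open : is_open U;
  rs_annulus : forall x, U x -> annulus r0 Rb x;
  rs_cont : cont_xt (fun x t => closure U x /\ 0 <= t) w;
  rs_C2 : forall t, 0 < t -> C2_on U (fun x => w x t) (fun x => Dw x t) (fun x => D2w x t);
  rs_t : forall x t, U x -> 0 < t -> derivable_pt_lim (fun s => w x s) t (wt x t);
  rs_V : forall x t i j, U x -> 0 < t -> has_partial (fun y => V y t i) x j (DV x t i j);
  rs_pde : forall x t, U x -> 0 < t -> exists dv : 'I_n -> R,
    (forall i, has_partial (fun y => velocity n r0 Rb p h bc mt me w Dw V y t i) x i (dv i)) /\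
    wt x t = sumI dv }.

Arguments rs_open {n r0 Rb p h bc mt me U w Dw D2w wt V DV} _.
Arguments rs_annulus {n r0 Rb p h bc mt me U w Dw D2w wt V DV} _.
Arguments rs_cont {n r0 Rb p h bc mt me U w Dw D2w wt V DV} _.
Arguments rs_C2 {n r0 Rb p h bc mt me U w Dw D2w wt V DV} _.
Arguments rs_t {n r0 Rb p h bc mt me U w Dw D2w wt V DV} _.
Arguments rs_V {n r0 Rb p h bc mt me U w Dw D2w wt V DV} _.
Arguments rs_pde {n r0 Rb p h bc mt me U w Dw D2w wt V DV} _.

Section VelocityBound.
Context (n : nat) (r0 Rb C0 : R) (p h bc : R -> R) (Hrd : radial_data r0 Rb C0 p h bc).
Context (mt me : R -> R) (Cmt : C1I r0 Rb mt) (Cme : C1I r0 Rb me).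

Let Hr0b : 0 < r0 < Rb := rd_r Hrd.
Let lam := / (2 * C0).
Local Notation rtA := (rootA r0 Rb lam p h).

Lemma source_bound : exists CF, 0 < CF /\
  forall (x : vec n) (V : vec n -> vec n) (DV : 'I_n -> 'I_n -> R) B, annulus r0 Rb x ->
  (forall i j, has_partial (fun y => V y i) x j (DV i j)) ->
  vnorm (V x) <= B -> (forall i j, Rabs (DV i j) <= B) ->
  exists l : 'I_n -> R,
    (forall i, has_partial (fun y => matvec (radm mt me y) (V y) i) x i (l i)) /\
    Rabs (sumI l) <= CF * B.
Proof.
have [mt' [_ [Kmt' Dmt]]] := Cmt; have [me' [_ [Kme' Dme]]] := Cme.
have [K1 [HK1 H1]] := continuity_bounded r0 Rb mt' ltac:(lra) Kmt'.
have [K2 [HK2 H2]] := continuity_bounded r0 Rb me' ltac:(lra) Kme'.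
have [K3 [HK3 H3]] := C1I_bounded _ _ _ _ _ _ Hrd me Cme.
have [K4 [HK4 H4]] := radm_entry_bound n _ _ _ _ _ _ Hrd mt me Cmt Cme.
have Hn := pos_INR n.
exists ((K1 / r0 + K2 * Rb + (INR n + 1) * K3) * Rb + INR n * (INR n * K4) + 1).
have Hc : 0 <= (K1 / r0 + K2 * Rb + (INR n + 1) * K3) * Rb.
  have : 0 < K1 / r0 by apply: Rdiv_lt_0_compat; lra.
  by move=> ?; apply: Rmult_le_pos; [nra|lra].
have Hc2 : 0 <= INR n * (INR n * K4) by nra.
split; first lra.
move=> x V DV B Hx HV HB HDB; have Hx' := Hx; rewrite /annulus in Hx'.
have [l [Hl El]] := div_radm n mt me _ _ x V DV ltac:(lra) (Dmt _ Hx') (Dme _ Hx') HV.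
exists l; split => //; rewrite El.
have HB0 : 0 <= B by have := vnorm_ge0 n (V x); lra.
have h1 : Rabs ((mt' (vnorm x) / vnorm x + me' (vnorm x) * vnorm x + (INR n + 1) * me (vnorm x))
    * dot x (V x)) <= (K1 / r0 + K2 * Rb + (INR n + 1) * K3) * (Rb * B).
  apply: Rabs_mult_le; last by apply: abs_dot_le; lra.
  apply: Rle_trans (Rabs_triang _ _) _; apply: Rplus_le_compat; last first.
    by apply: Rabs_mult_le; [rewrite Rabs_pos_eq; lra|apply: H3; lra].
  apply: Rle_trans (Rabs_triang _ _) _; apply: Rplus_le_compat; apply: Rabs_mult_le.
  - by apply: H1; lra.
  - by rewrite Rabs_inv Rabs_pos_eq; [apply: Rinv_le_contravar|]; lra.
  - by apply: H2; lra.
  - by rewrite Rabs_pos_eq; lra.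
have h2 : Rabs (sumI (fun i => sumI (fun j => radm mt me x i j * DV i j))) <= INR n * (INR n * (K4 * B)).
  rewrite -!sumI_const; apply: Rle_trans (sumI_Rabs _ _) _; apply: sumI_le => i.
  apply: Rle_trans (sumI_Rabs _ _) _; apply: sumI_le => j.
  by apply: Rabs_mult_le => //; exact: H4.
apply: Rle_trans (Rabs_triang _ _) _; lra.
Qed.

Context (bet gam : R -> R) (Kbet : continuity bet) (Kgam : continuity gam).
Context (Hexp : flux_expands n r0 Rb C0 p h bc bet gam).

(** Defined as a residual, so that the equation in non-divergence form is an identity; its actual
    value is [div (A c)]. *)
Definition source (w : vec n -> R -> R) Dw D2w (wt : vec n -> R -> R) (x : vec n) (t : R) : R :=
  wt x t - (elliptic_part lam (rtA x) (D2w x t)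
    + dot (vscal (bet (vnorm x)) x) (Dw x t) + gam (vnorm x) * w x t).

Lemma source_equation (w : vec n -> R -> R) Dw D2w wt x t :
  derivable_pt_lim (fun s => w x s) t (wt x t) ->
  parabolic_on lam rtA (fun x => vscal (bet (vnorm x)) x)
    (fun x t => gam (vnorm x) * w x t + source w Dw D2w wt x t) w Dw D2w wt x t.
Proof. by move=> H; split => //; rewrite /source; ring. Qed.

(** The flux and [A c] have partial derivatives separately, by [Hexp] and by the first hypothesis.
    Uniqueness for their sum, whose divergence is [wt], identifies the residual with [div (A c)]. *)
Lemma source_le CF U w Dw D2w wt V DV :
  (forall (x : vec n) (V : vec n -> vec n) (DV : 'I_n -> 'I_n -> R) B, annulus r0 Rb x ->
    (forall i j, has_partial (fun y => V y i) x j (DV i j)) ->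
    vnorm (V x) <= B -> (forall i j, Rabs (DV i j) <= B) ->
    exists l : 'I_n -> R,
      (forall i, has_partial (fun y => matvec (radm mt me y) (V y) i) x i (l i)) /\
      Rabs (sumI l) <= CF * B) ->
  radial_solution n r0 Rb p h bc mt me U w Dw D2w wt V DV ->
  forall x t B, U x -> 0 < t -> vnorm (V x t) <= B -> (forall i j, Rabs (DV x t i j) <= B) ->
  Rabs (source w Dw D2w wt x t) <= CF * B.
Proof.
move=> HCF Hs x t B Hx Ht HB HDB.
have Hxa := rs_annulus Hs x Hx.
have [l [Hl Hlb]] := HCF x (fun y => V y t) (DV x t) B Hxa
  (fun i j => rs_V Hs x t i j Hx Ht) HB HDB.
have HC := rs_C2 Hs t Ht.
have [l' [Hl' El']] := Hexp x (fun y => w y t) (fun y => Dw y t) (D2w x t) Hxa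
  (fun i => C2_D _ _ _ _ HC x i Hx) (fun i j => C2_D2 _ _ _ _ HC x i j Hx).
have [dv [Hdv Edv]] := rs_pde Hs x t Hx Ht.
have -> : source w Dw D2w wt x t = sumI l; last by [].
rewrite /source Edv -El' -sumI_sub; apply: sumI_ext => i.
have := partial_add n _ _ x i _ _ (Hl' i) (Hl i) => H.
by rewrite (partial_unique n _ x i _ _ (Hdv i) H); ring.
Qed.

(** The zeroth-order term joins the source, whose bound becomes [Kg M + MF]; [rho <= 1] then merges
    the two terms of [gradient_estimate]. *)
Lemma gradient_bound : exists C, 0 < C /\
  forall (U : vec n -> Prop) w Dw D2w wt V DV (x0 : vec n) t0 rho M MF,
  radial_solution n r0 Rb p h bc mt me U w Dw D2w wt V DV ->
  (forall y, dist y x0 <= rho -> U y) ->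
  0 < rho <= 1 -> rho * rho < t0 -> 0 <= M -> 0 <= MF ->
  (forall x t, U x -> t0 - rho * rho <= t <= t0 -> Rabs (w x t) <= M) ->
  (forall x t, U x -> t0 - rho * rho < t <= t0 -> Rabs (source w Dw D2w wt x t) <= MF) ->
  vnorm (Dw x0 t0) <= C * (M + MF) / rho.
Proof.
have [Lp [HLp HL]] := rootA_lipschitz n r0 Rb C0 p h bc Hrd.
have [Tr [HTr HT]] := rootA_trace n r0 Rb C0 p h bc Hrd.
have [Kb [HKb Hb]] := continuity_bounded r0 Rb bet ltac:(lra) Kbet.
have [Kg [HKg Hg]] := continuity_bounded r0 Rb gam ltac:(lra) Kgam.
have [C [HC H]] := gradient_estimate n lam Lp Tr (Kb * Rb) 1 (rd_lam r0 Rb C0 p h bc Hrd) HLp HTr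
  ltac:(nra) Rlt_0_1.
exists (C * (1 + Kg)); split; first nra.
move=> U w Dw D2w wt V DV x0 t0 rho M MF Hs HbU Hrho Ht0 HM HMF HwM HFM.
have Hann x : dist x x0 <= rho -> annulus r0 Rb x.
  by move=> Hx; apply: (rs_annulus Hs); exact: HbU.
have Hpos t : t0 - rho * rho <= t -> 0 < t by lra.
have Hsn : solution_near U lam rtA (fun x => vscal (bet (vnorm x)) x)
  (fun x t => gam (vnorm x) * w x t + source w Dw D2w wt x t) w Dw D2w wt x0 t0 rho M (Kg * M + MF)
  Lp Tr (Kb * Rb).
  split.
  - exact: rs_open Hs.
  - exact: HbU.
  - move=> x t [Hx Ht] e He.
    have [d [Hd Hwd]] := rs_cont Hs x t
      ltac:(split; [exact: closure_sub (HbU x Hx)|lra]) e He.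
    exists d; split => // y s [Hy Hs'] h1 h2; apply: Hwd => //.
    by split; [exact: closure_sub (HbU y Hy)|lra].
  - by move=> t Ht; apply: (rs_C2 Hs); lra.
  - move=> x t Hx Ht; apply: source_equation.
    by apply: (rs_t Hs); [exact: HbU|lra].
  - by move=> x t Hx Ht; apply: HwM => //; exact: HbU.
  - move=> x t Hx Ht; apply: Rle_trans (Rabs_triang _ _) _; apply: Rplus_le_compat.
      apply: Rabs_mult_le; last by apply: HwM; [exact: HbU|lra].
      by have := Hann x Hx; rewrite /annulus => ?; apply: Hg; lra.
    by apply: HFM => //; exact: HbU.
  - move=> x Hx; rewrite vnorm_scal; have := Hann x Hx; rewrite /annulus => ?.
    by apply: Rmult_le_compat; [exact: Rabs_pos|exact: vnorm_ge0|apply: Hb; lra|lra].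
  - by move=> x Hx; apply: HT; exact: Hann.
  - by move=> x y Hx Hy; apply: HL; exact: Hann.
apply: Rle_trans (H _ _ _ _ _ _ _ _ _ _ _ _ _ Hsn Hrho HM ltac:(nra)) _.
rewrite /Rdiv Rmult_assoc Rmult_assoc; apply: Rmult_le_compat_l; first lra.
have Hri : 1 <= / rho by rewrite -Rinv_1; apply: Rinv_le_contravar; lra.
have h0 : 0 <= Kg * M + MF by nra.
have h1 : rho * (Kg * M + MF) <= (Kg * M + MF) * / rho.
  by rewrite Rmult_comm; apply: Rmult_le_compat_l; lra.
have h2 : 0 <= Kg * MF * / rho.
  by apply: Rmult_le_pos; [nra|lra].
by lra.
Qed.

Context (Hn : 2 <= INR n) (N eta : R).
Context (HbcN : forall r, r0 < r < Rb -> Rabs (bc r * (r * r)) <= N - INR n).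
Context (Heta0 : 0 <= eta) (Heta : eta * C0 * Rpower Rb (N + 2) <= 2 * N * Rpower r0 N).

(** The starting time is free, and [S] need only bound [w] at that time: this permits a restart once
    the data have become small. *)
Lemma velocity_bound : exists C, 0 < C /\
  forall (U : vec n -> Prop) w Dw D2w wt V DV T0 S D6 D7,
  radial_solution n r0 Rb p h bc mt me U w Dw D2w wt V DV ->
  0 <= T0 -> 0 <= S -> 0 <= D6 -> 0 <= D7 ->
  (forall x t, U x -> T0 < t -> vnorm (V x t) <= D6 /\ forall i j, Rabs (DV x t i j) <= D6) ->
  (forall x, closure U x -> Rabs (w x T0) <= S) ->
  (forall x t, bdry U x -> T0 <= t -> Rabs (w x t) <= D7) ->
  forall x t rho, (forall y, dist y x <= rho -> U y) ->
  0 < rho <= 1 -> rho * rho < t - T0 ->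
  vnorm (velocity n r0 Rb p h bc mt me w Dw V x t)
    <= C / rho * (exp (- eta * (t - T0)) * S + D6 + D7) /\
  dist (V x t) (velocity n r0 Rb p h bc mt me w Dw V x t)
    <= C / rho * (exp (- eta * (t - T0)) * S + D6 + D7).
Proof.
have [CF [HCF HF]] := source_bound.
have [CG [HCG HG]] := gradient_bound.
have [CS [HCS HS]] := sup_estimate n r0 Rb C0 p h bc Hrd bet gam Hexp Hn N eta HbcN Heta0 Heta.
have [KA [HKA HA]] := radm_entry_bound n _ _ _ _ _ _ Hrd _ _
  (C1I_inv_p _ _ _ _ _ _ Hrd) (C1I_radA2 _ _ _ _ _ _ Hrd).
have [Km [HKm Hm]] := radm_entry_bound n _ _ _ _ _ _ Hrd mt me Cmt Cme.
have [Kc [HKc Hc]] := C1I_bounded _ _ _ _ _ _ Hrd bc (rd_bc Hrd).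
pose a := INR n * (INR n * KA); pose m := INR n * (INR n * Km).
have Hn0 := pos_INR n.
have Ha : 0 <= a by rewrite /a; nra.
have Hm0 : 0 <= m by rewrite /m; nra.
(* [exp eta] pays for the earlier times of the cylinder, back to [t - rho^2] with [rho <= 1], where
   the decay factor is larger than at [t]. *)
pose M1 := CS * (exp eta + CF + 1).
have HE0 := exp_pos eta.
have HM1 : 0 < M1 by apply: Rmult_lt_0_compat; lra.
pose C := a * (CG * (M1 + CF) + Kc * Rb * M1) + m + 1.
have HCGM : 0 < CG * (M1 + CF) by apply: Rmult_lt_0_compat; lra.
have HKM : 0 < Kc * Rb * M1 by apply: Rmult_lt_0_compat => //; nra.
have HC : 0 < C by rewrite /C; nra.
exists (C + 1); split; first lra.
move=> U w Dw D2w wt V DV T0 S D6 D7 Hs HT0 HS0 HD6 HD7 HV HwS HwD x t rho HbU Hrho Ht.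
have Hx : U x by apply: HbU; rewrite vnorm0; lra.
have Hrr : 0 < rho * rho by nra.
pose Q := exp (- eta * (t - T0)) * S + D6 + D7.
have HE := exp_pos (- eta * (t - T0)).
have HES : 0 <= exp (- eta * (t - T0)) * S by apply: Rmult_le_pos; lra.
have HQ : 0 <= Q by rewrite /Q; lra.
have Hsrc y s : U y -> T0 < s -> Rabs (source w Dw D2w wt y s) <= CF * D6.
  move=> Hy Hs'; have [h1 h2] := HV y s Hy Hs'.
  by apply: (source_le CF U w Dw D2w wt V DV HF Hs) => //; lra.
have HCFD : 0 <= CF * D6 by apply: Rmult_le_pos; lra.
have Hsa : solution_after n r0 Rb C0 p h bet gam U (source w Dw D2w wt) w Dw D2w wt T0 (CF * D6).
  split.
  - exact: rs_open Hs.
  - exact: rs_annulus Hs.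
  - move=> z r [Hz Hr] e He.
    have [d [Hd Hwd]] := rs_cont Hs z r ltac:(split => //; lra) e He.
    by exists d; split => // z' r' [Hz' Hr'] h1 h2; apply: Hwd => //; split => //; lra.
  - by move=> r Hr; apply: (rs_C2 Hs); lra.
  - by move=> z r Hz Hr; apply: source_equation;
      apply: (rs_t Hs) => //; lra.
  - exact: Hsrc.
have Hsup y s : U y -> t - rho * rho <= s <= t -> Rabs (w y s) <= M1 * Q.
  move=> Hy Hs'.
  apply: Rle_trans (HS U (source w Dw D2w wt) w Dw D2w wt T0 S (CF * D6) D7 Hsa HS0 HCFD HD7
    HwS HwD y s (closure_sub _ _ _ Hy) ltac:(lra)) _.
  rewrite /M1 Rmult_assoc; apply: Rmult_le_compat_l; first lra.
  have h1 : exp (- eta * (s - T0)) <= exp eta * exp (- eta * (t - T0)).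
    rewrite -exp_plus.
    have hr1 : rho * rho <= 1 by nra.
    have := Rmult_le_compat_l eta (t - s) 1 Heta0 ltac:(lra).
    by move=> ?; apply: exp_le_exp; lra.
  have h2 := Rmult_le_compat_r S _ _ HS0 h1.
  have h3 := Rmult_le_pos _ _ (Rlt_le _ _ HE0) HD6.
  have h4 := Rmult_le_pos _ _ (Rlt_le _ _ HE0) HD7.
  have h5 := Rmult_le_pos _ _ (Rlt_le _ _ HCF) HES.
  have h6 := Rmult_le_pos _ _ (Rlt_le _ _ HCF) HD7.
  by rewrite /Q; lra.
have HMQ : 0 <= M1 * Q by apply: Rmult_le_pos; lra.
have HD6Q : D6 <= Q by rewrite /Q; lra.
have Hgrad : vnorm (Dw x t) <= CG * (M1 + CF) * Q / rho.
  apply: Rle_trans (HG U w Dw D2w wt V DV x t rho (M1 * Q) (CF * Q) Hs HbU Hrho ltac:(lra) HMQ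
    ltac:(apply: Rmult_le_pos; lra) Hsup _) _.
    move=> y s Hy Hs'; apply: Rle_trans (Hsrc y s Hy ltac:(lra)) _.
    by apply: Rmult_le_compat_l; lra.
  by apply: Req_le; rewrite /Rdiv; ring.
have Hri : 1 <= / rho by rewrite -Rinv_1; apply: Rinv_le_contravar; lra.
have up y : 0 <= y -> y <= y / rho by move=> Hy; rewrite /Rdiv; nra.
have Hxa := rs_annulus Hs x Hx.
have [HVx _] := HV x t Hx ltac:(lra).
have Hxn : vnorm x <= Rb by rewrite /annulus in Hxa; lra.
have Hwb : vnorm (vscal (w x t) (vscal (bc (vnorm x)) x)) <= Kc * Rb * M1 * Q / rho.
  rewrite !vnorm_scal; apply: Rle_trans (up _ _); last by rewrite Rmult_assoc; apply: Rmult_le_pos; nra.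
  have h1 := Hsup x t Hx ltac:(lra).
  have h2 : Rabs (bc (vnorm x)) * vnorm x <= Kc * Rb.
    apply: Rmult_le_compat => //; [exact: Rabs_pos|exact: vnorm_ge0|].
    by apply: Hc; rewrite /annulus in Hxa; lra.
  have -> : Kc * Rb * M1 * Q = M1 * Q * (Kc * Rb) by ring.
  apply: Rmult_le_compat => //; first exact: Rabs_pos.
  by apply: Rmult_le_pos; [exact: Rabs_pos|exact: vnorm_ge0].
have Hv2 : vnorm (velocity n r0 Rb p h bc mt me w Dw V x t) <= C / rho * Q.
  have hin := vnorm_vsub_le n _ _ _ _ Hgrad Hwb.
  have h1 W := matvec_norm_le n (radA r0 Rb p h x) W KA (Rlt_le _ _ HKA) (fun i j => HA x i j Hxa).
  have h2 := matvec_norm_le n (radm mt me x) (V x t) Km (Rlt_le _ _ HKm) (fun i j => Hm x i j Hxa).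
  apply: Rle_trans (vnorm_vadd_le n _ _ _ _ (h1 _) h2) _; rewrite -/a -/m.
  apply: (Rle_trans _ (a * (CG * (M1 + CF) * Q / rho + Kc * Rb * M1 * Q / rho) + m * (Q / rho))).
    apply: Rplus_le_compat; apply: Rmult_le_compat_l => //.
    by apply: Rle_trans HVx _; apply: Rle_trans HD6Q _; exact: up.
  have : 0 <= Q / rho by apply: Rdiv_le_0_compat; lra.
  by rewrite /C /Rdiv => ?; lra.
have HQr : Q <= Q / rho by exact: up.
have E : (C + 1) / rho * Q = C / rho * Q + Q / rho by rewrite /Rdiv; ring.
rewrite -/Q E; split; first lra.
have -> : C / rho * Q + Q / rho = Q / rho + C / rho * Q by ring.
by apply: vnorm_vsub_le => //; lra.
Qed.

End VelocityBound.

(** * Coefficients of the linearized two-phase system *)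

Lemma Rsup_of_lub E : (exists y, E y) -> bound E -> is_lub E (Rsup_of E).
Proof.
move=> Hne Hb; apply: epsilon_spec; have [m Hm] := completeness E Hb Hne; by exists m.
Qed.

Lemma Rsup_of_ge E y : bound E -> E y -> y <= Rsup_of E.
Proof. by move=> Hb Hy; have [H _] := Rsup_of_lub E (ex_intro _ y Hy) Hb; exact: H. Qed.

Lemma Rsup_of_le E m : (exists y, E y) -> (forall y, E y -> y <= m) -> Rsup_of E <= m.
Proof. by move=> Hne Hm; have [_ H] := Rsup_of_lub E Hne (ex_intro _ m Hm); exact: H. Qed.

Lemma Rsup_img_ge sl sh F s : (forall s, sl <= s <= sh -> continuity_pt F s) ->
  sl <= s <= sh -> F s <= Rsup_of (img (Iv sl sh) F).
Proof.
move=> HF Hs; apply: Rsup_of_ge; last by exists s.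
have [M [HM _]] := continuity_ab_maj F sl sh ltac:(lra) HF.
by exists (F M) => y [r [Hr ->]]; apply: HM.
Qed.

Lemma Rinf_img_le sl sh F s : (forall s, sl <= s <= sh -> continuity_pt F s) ->
  sl <= s <= sh -> Rinf_of (img (Iv sl sh) F) <= F s.
Proof.
move=> HF Hs; rewrite /Rinf_of.
suff : - F s <= Rsup_of (fun y => img (Iv sl sh) F (- y)) by lra.
apply: Rsup_of_ge; last by exists s; rewrite Ropp_involutive.
have [m [Hm _]] := continuity_ab_min F sl sh ltac:(lra) HF.
by exists (- F m) => y [r [Hr E]]; have := Hm r Hr; lra.
Qed.

Lemma Rinf_img_pos sl sh F : sl <= sh -> (forall s, sl <= s <= sh -> continuity_pt F s) ->
  (forall s, sl <= s <= sh -> 0 < F s) -> 0 < Rinf_of (img (Iv sl sh) F).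
Proof.
move=> Hsl HF Hpos.
have [m [Hm Hmi]] := continuity_ab_min F sl sh Hsl HF.
have := Hpos m Hmi; rewrite /Rinf_of.
suff : Rsup_of (fun y => img (Iv sl sh) F (- y)) <= - F m by lra.
apply: Rsup_of_le; first by exists (- F m), m; rewrite Ropp_involutive.
by move=> y [r [Hr E]]; have := Hm r Hr; lra.
Qed.

(** At 0 only continuity is available. It gives [f (s / 2) >= 0], and strict growth from [s / 2] to
    [s] gives positivity. *)
Lemma increasing_pos f : (forall s, 0 <= s <= 1 -> cont_rel (fun y => 0 <= y <= 1) f s) ->
  Ck01 1 f -> f 0 = 0 -> (forall s, 0 < s < 1 -> exists l, derivable_pt_lim f s l /\ 0 < l) ->
  forall s, 0 < s < 1 -> 0 < f s.
Proof.
move=> Hc [f' [Hf' _]] H0 Hpos s Hs.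
have Hp r : 0 < r < 1 -> 0 < f' r.
  by move=> Hr; have [l [Hl Hl0]] := Hpos r Hr; rewrite (uniqueness_limite _ _ _ _ (Hf' r Hr) Hl).
have Hinc a b : 0 < a -> a < b -> b < 1 -> f a < f b.
  move=> Ha Hab Hb.
  have [c [E Hcab]] := MVT_cor2 f f' a b Hab ltac:(by move=> c Hcc; apply: Hf'; lra).
  by have := Hp c ltac:(lra); nra.
have Hhalf : 0 <= f (s / 2).
  apply: Rnot_lt_le => Hneg.
  have [d [Hd H]] := Hc 0 ltac:(lra) (- f (s / 2)) ltac:(lra).
  pose y := Rmin d (s / 2) / 2.
  have Hm : 0 < Rmin d (s / 2) by apply: Rmin_pos; lra.
  have h1 := Rmin_l d (s / 2); have h2 := Rmin_r d (s / 2).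
  have := H y ltac:(rewrite /y; lra) ltac:(rewrite /y Rminus_0_r Rabs_pos_eq; lra).
  have := Hinc y (s / 2) ltac:(rewrite /y; lra) ltac:(rewrite /y; lra) ltac:(lra).
  by rewrite H0; split_Rabs; lra.
have := Hinc (s / 2) s ltac:(lra) ltac:(lra) ltac:(lra); lra.
Qed.

Lemma decreasing_pos f : (forall s, 0 <= s <= 1 -> cont_rel (fun y => 0 <= y <= 1) f s) ->
  Ck01 1 f -> f 1 = 0 -> (forall s, 0 < s < 1 -> exists l, derivable_pt_lim f s l /\ l < 0) ->
  forall s, 0 < s < 1 -> 0 < f s.
Proof.
move=> Hc [f' [Hf' Kf']] H1 Hneg s Hs.
have Hd r l : derivable_pt_lim f (1 - r) l -> derivable_pt_lim (fun r => f (1 - r)) r (- l).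
  move=> Hl; have E : derivable_pt_lim (fun r => 1 - r) r (-1).
    by apply/is_derive_Reals; auto_derive => //; ring.
  have := derivable_pt_lim_comp _ _ _ _ _ E Hl.
  by have -> : l * -1 = - l by ring.
have -> : f s = (fun r => f (1 - r)) (1 - s) by rewrite /=; congr f; ring.
apply: (increasing_pos (fun r => f (1 - r))); last lra.
- move=> r Hr e He; have [d [Hd' H]] := Hc (1 - r) ltac:(lra) e He; exists d; split => // y Hy Hyr.
  by apply: (H (1 - y)); [lra|move: Hyr; split_Rabs; lra].
- exists (fun r => - f' (1 - r)); split; first by move=> r Hr; apply: Hd; apply: Hf'; lra.
  move=> r Hr; apply: continuity_pt_opp; apply: (continuity_pt_comp (fun r => 1 - r) f').
    by apply: derivable_continuous_pt; apply: ex_derive_Reals_0; auto_derive.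
  by apply: Kf'; lra.
- by rewrite Rminus_0_r.
move=> r Hr; have [l [Hl Hl0]] := Hneg (1 - r) ltac:(lra).
by exists (- l); split; [exact: Hd|lra].
Qed.

Lemma Ck01_continuous k f s : Ck01 k f -> 0 < s < 1 -> continuity_pt f s.
Proof.
case: k => [H /H //|k [f' [Hf' _]] Hs].
by apply: derivable_continuous_pt; exists (f' s); exact: Hf'.
Qed.

(** The given [dF] and the derivative hidden in [Ck01] agree on the open interval only, which is
    enough to transfer differentiability there. *)
Lemma Ck01_second k F dF : Ck01 k.+2 F -> (forall s, 0 < s < 1 -> derivable_pt_lim F s (dF s)) ->
  exists d2F, forall s, 0 < s < 1 ->
    continuity_pt dF s /\ derivable_pt_lim dF s (d2F s) /\ continuity_pt d2F s.
Proof.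
move=> [F' [HF' [F'' [HF'' KF'']]]] HdF; exists F'' => s Hs.
have Hd : derivable_pt_lim dF s (F'' s).
  apply: (derivable_pt_lim_locally_ext F' dF s 0 1) => //; last exact: HF''.
  by move=> r Hr; exact: uniqueness_limite (HF' r Hr) (HdF r Hr).
split; first by apply: derivable_continuous_pt; exists (F'' s).
by split => //; exact: Ck01_continuous KF'' Hs.
Qed.

Lemma C1I_pow a b f k : C1I a b f -> C1I a b (fun r => f r ^ k).
Proof. by move=> Hf; elim: k => [|k IH]; [exact: C1I_const|exact: C1I_mul]. Qed.

(** For [c = 0], a phase at rest, the argument is constantly 0, where [rpow] is 0 for every
    exponent, negative ones included. *)
Lemma C1I_rpow a b c f al : 0 <= c -> (forall r, 0 < f r) -> C1I a b f ->
  C1I a b (fun r => rpow (c * f r) al).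
Proof.
move=> [Hc|<-] Hf Cf; last first.
  apply: (C1I_ext _ _ (fun=> 0)); last exact: C1I_const.
  by move=> r; rewrite /rpow Rmult_0_l; case: Rlt_dec => // h; lra.
have Hcf r : 0 < c * f r by exact: Rmult_lt_0_compat.
apply: (C1I_ext _ _ (fun r => Rpower (c * f r) al)).
  by move=> r; rewrite /rpow; case: Rlt_dec => // h; have := Hcf r; lra.
by apply: C1I_Rpower => //; apply: C1I_mul => //; exact: C1I_const.
Qed.

Lemma C1I_gfun a b (g : gdata) c f : 0 <= c -> (forall r, 0 < f r) -> C1I a b f ->
  C1I a b (fun r => gfun g (c * f r)).
Proof.
move=> Hc Hf Cf; apply: C1I_add; first exact: C1I_const.
elim: g.2 => [|q l IH] /=; first exact: C1I_const.
by apply: C1I_add => //; apply: C1I_mul; [exact: C1I_const|exact: C1I_rpow].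
Qed.

Lemma C1I_gder a b (g : gdata) c f : 0 <= c -> (forall r, 0 < f r) -> C1I a b f ->
  C1I a b (fun r => gder g (c * f r)).
Proof.
move=> Hc Hf Cf; rewrite /gder.
elim: g.2 => [|q l IH] /=; first exact: C1I_const.
by apply: C1I_add => //; apply: C1I_mul; [exact: C1I_const|exact: C1I_rpow].
Qed.

Lemma rpow_ge0 s a : 0 <= rpow s a.
Proof. by rewrite /rpow; case: Rlt_dec => h /=; [exact/Rlt_le/exp_pos|lra]. Qed.

Lemma rpow_mono s t a : 0 <= a -> s <= t -> rpow s a <= rpow t a.
Proof.
move=> Ha Hst; rewrite /rpow; case: Rlt_dec => Hs /=; last first.
  by case: Rlt_dec => h /=; [exact/Rlt_le/exp_pos|lra].
by case: Rlt_dec => Ht /=; [apply: Rle_Rpower_l|lra].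
Qed.

Lemma rpow_mul s a : 0 <= s -> rpow s (a - 1) * s = rpow s a.
Proof.
move=> Hs; rewrite /rpow; case: Rlt_dec => H /=; last by have -> : s = 0 by [lra]; ring.
by rewrite -{2}(Rpower_1 s H) -Rpower_plus; congr Rpower; ring.
Qed.

Lemma admissible_pos_exps (l : seq (R * R)) a : 0 <= a -> incr_exps a l -> incr_exps 0 l.
Proof. by move=> Ha; case: l => //= q l [H1 H2]; split => //; lra. Qed.

Lemma gfun_bounds g s t : admissible g -> 0 <= s -> s <= t -> 0 < g.1 <= gfun g s /\ gfun g s <= gfun g t.
Proof.
move=> [H0 [H1 H2]] Hs Hst; rewrite /gfun.
elim: g.2 H1 H2 => [|q l IH] /=; first by lra.
move=> [Hq Hl] [Hq2 Hl2].
have Hl2' := admissible_pos_exps l _ (Rlt_le _ _ Hq2) Hl2.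
have := IH Hl Hl2'.
have := Rmult_le_compat_l _ _ _ Hq (rpow_mono s t q.2 (Rlt_le _ _ Hq2) Hst).
have := Rmult_le_pos _ _ Hq (rpow_ge0 s q.2); lra.
Qed.

(** For exponents below 1 the derivative of [g] blows up at 0, but [g'(s) s] is a sum of terms
    [a alpha s^alpha], which are nondecreasing. *)
Lemma gder_bounds g s t : admissible g -> 0 <= s -> s <= t ->
  0 <= gder g s * s /\ gder g s * s <= gder g t * t.
Proof.
move=> [H0 [H1 H2]] Hs Hst; rewrite /gder.
elim: g.2 H1 H2 => [|q l IH] /=; first by lra.
move=> [Hq Hl] [Hq2 Hl2].
have Hl2' := admissible_pos_exps l _ (Rlt_le _ _ Hq2) Hl2.
have := IH Hl Hl2'.
rewrite !Rmult_plus_distr_r !Rmult_assoc !rpow_mul; try lra.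
have Hqq : 0 <= q.1 * q.2 by apply: Rmult_le_pos; lra.
have := Rmult_le_compat_l _ _ _ Hqq (rpow_mono s t q.2 (Rlt_le _ _ Hq2) Hst).
have := Rmult_le_pos _ _ Hqq (rpow_ge0 s q.2); rewrite !Rmult_assoc; lra.
Qed.

(** * Matrix products and the inverse of [B] *)

Lemma mat_ext n (M M' : mat n) : (forall i j, M i j = M' i j) -> M = M'.
Proof. by move=> H; do 2 apply: functional_extensionality => ?; exact: H. Qed.

Lemma radm_mul n al ga al' ga' (x : vec n) i j :
  matmul (radm al ga x) (radm al' ga' x) i j
  = radm (fun r => al r * al' r)
      (fun r => al r * ga' r + ga r * al' r + ga r * ga' r * (r * r)) x i j.
Proof.
rewrite /matmul [RHS]/radm vnorm_sq.
rewrite /radm; set a := al _; set g := ga _; set a' := al' _; set g' := ga' _.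
transitivity (sumI (fun k => a * a' * (idmat n i k * idmat n j k) + a * g' * x j * (idmat n i k * x k)
   + g * a' * x i * (idmat n j k * x k) + g * g' * x i * x j * (x k * x k))).
  by apply: sumI_ext => k; rewrite (idmatC n k j); ring.
by rewrite !sumI_add !sumI_scal !sumI_idl (idmatC n j) -/(dot x x); ring.
Qed.

Lemma matvec_matmul n (M M' : mat n) (x : vec n) :
  matvec M (matvec M' x) = matvec (matmul M M') x.
Proof.
apply: functional_extensionality => i; rewrite /matvec /matmul.
transitivity (sumI (fun j => sumI (fun k => M i j * M' j k * x k))).
  by apply: sumI_ext => j; rewrite -sumI_scal; apply: sumI_ext => k; ring.
by rewrite sumI_exch; apply: sumI_ext => k; rewrite sumI_scalr.
Qed.

Lemma matmul_assoc n (M M' M'' : mat n) :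
  matmul M (matmul M' M'') = matmul (matmul M M') M''.
Proof.
apply: mat_ext => i j.
exact: (f_equal (fun v => v i) (matvec_matmul n M M' (fun k => M'' k j))).
Qed.

Lemma matmul_idl n (M : mat n) : matmul (idmat n) M = M.
Proof.
by apply: mat_ext => i j; exact: sumI_idl.
Qed.

Lemma matmul_idr n (M : mat n) : matmul M (idmat n) = M.
Proof.
apply: mat_ext => i j.
rewrite -[RHS](sumI_idr n j (fun k => M i k)); apply: sumI_ext => k.
by rewrite (idmatC n j).
Qed.

(** Identifies the right inverse picked by [epsilon] in [Amat] with the explicit one. *)
Lemma right_inverse_unique n (B A M : mat n) :
  matmul A B = idmat n -> matmul B M = idmat n -> M = A.
Proof. by move=> HA HM; rewrite -(matmul_idr n A) -HM matmul_assoc HA matmul_idl. Qed.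

Lemma radA_inverse n r0 Rb C0 p h bc (Hrd : radial_data r0 Rb C0 p h bc) (x : vec n) :
  annulus r0 Rb x ->
  let B := radm p (fun r => (h r - p r) / (clamp r0 Rb r * clamp r0 Rb r)) x in
  matmul (radA r0 Rb p h x) B = idmat n /\ matmul B (radA r0 Rb p h x) = idmat n.
Proof.
rewrite /annulus => Hx; have [Hr _] := rd_r Hrd.
have H1 := rd_p0 Hrd (vnorm x); have H2 := rd_ph Hrd (vnorm x).
by split; apply: mat_ext => i j;
  rewrite radm_mul /radm clamp_id; try lra; field; repeat split; lra.
Qed.

(** Two derivatives, because [b] contains [F'] and is itself differentiated in [div (A b)]. *)
Record fractional_flow (F dF d2F : R -> R) : Prop := FractionalFlow {
  ff_pos : forall s, 0 < s < 1 -> 0 < F s;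
  ff_D : forall s, 0 < s < 1 -> derivable_pt_lim F s (dF s);
  ff_D2 : forall s, 0 < s < 1 -> derivable_pt_lim dF s (d2F s);
  ff_D2c : forall s, 0 < s < 1 -> continuity_pt d2F s }.

Lemma ff_c F dF d2F s : fractional_flow F dF d2F -> 0 < s < 1 -> continuity_pt F s.
Proof. by case=> _ H _ _ Hs; apply: derivable_continuous_pt; exists (dF s); exact: H. Qed.

Lemma ff_Dc F dF d2F s : fractional_flow F dF d2F -> 0 < s < 1 -> continuity_pt dF s.
Proof. by case=> _ _ H _ Hs; apply: derivable_continuous_pt; exists (d2F s); exact: H. Qed.

Section Coefficients.
Context (n : nat) (Hn : (2 <= n)%nat) (g1 g2 : gdata) (Hg1 : admissible g1) (Hg2 : admissible g2).
Context (F1 F2 dF1 dF2 d2F1 d2F2 : R -> R).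
Context (HF1 : fractional_flow F1 dF1 d2F1) (HF2 : fractional_flow F2 dF2 d2F2).
Context (r0 c1 c2 s0 Rmax Rb sl sh : R) (Shat : R -> R).
Context (Hr0 : 0 < r0) (HRb : r0 < Rb < Rmax) (Hsl : 0 < sl) (Hsh : sh < 1) (HS0 : Shat r0 = s0).
Context (HScont : forall eps, 0 < eps -> exists d, 0 < d /\
              forall r, r0 <= r < r0 + d -> Rabs (Shat r - s0) < eps).
Context (HSode : forall r, r0 < r < Rmax ->
     derivable_pt_lim Shat r
       (Gsc g2 (c2 * Rpower r (1 - INR n)) * F2 (Shat r)
        - Gsc g1 (c1 * Rpower r (1 - INR n)) * F1 (Shat r))).
Context (HSbd : forall r, r0 <= r <= Rb -> sl <= Shat r <= sh).

Let cl := clamp r0 Rb.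
Let Hcl r : r0 <= cl r <= Rb.
Proof. by apply: clamp_in; lra. Qed.
Let Ccl : C1I r0 Rb cl.
Proof. by apply: C1I_clamp; lra. Qed.
Let HsI s : sl <= s <= sh -> 0 < s < 1.
Proof. by move=> Hs; lra. Qed.

Let St (r : R) := Shat (cl r).
Let rn (r : R) := Rpower (cl r) (1 - INR n).
Local Notation spd c r := (Rabs c * rn r).

Let HSt r : sl <= St r <= sh.
Proof. exact: HSbd. Qed.

Let Hrn r : 0 < rn r.
Proof. exact: exp_pos. Qed.

Let Crn : C1I r0 Rb rn.
Proof. by apply: C1I_Rpower => // r; have := Hcl r; lra. Qed.

Let Cu c : C1I r0 Rb (fun r => Rabs c * rn r).
Proof. by apply: C1I_mul => //; exact: C1I_const. Qed.

Let Cg (g : gdata) c : C1I r0 Rb (fun r => gfun g (spd c r)).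
Proof. by apply: C1I_gfun => //; exact: Rabs_pos. Qed.

Let Cgd (g : gdata) c : C1I r0 Rb (fun r => gder g (spd c r) * (spd c r)).
Proof. by apply: C1I_mul => //; apply: C1I_gder => //; exact: Rabs_pos. Qed.

(** At [r0] there is only continuity from the right; at the other radii up to [Rb < Rmax] the ODE
    gives differentiability. The clamp never leaves this interval. *)
Lemma saturation_continuity : continuity St.
Proof.
have Hloc c : r0 <= c <= Rb -> forall eps, 0 < eps -> exists d, 0 < d /\
    forall y, r0 <= y <= Rb -> Rabs (y - c) < d -> Rabs (Shat y - Shat c) < eps.
  move=> Hc eps He; case: (Req_dec c r0) => [->|Hne].
    have [d [Hd H]] := HScont eps He; exists d; split => // y Hy Hyc.
    by rewrite HS0; apply: H; move: Hyc; split_Rabs; lra.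
  have Hd : continuity_pt Shat c.
    by apply: derivable_continuous_pt; eexists; apply: HSode; lra.
  have [d [Hd0 H]] := proj1 (continuity_pt_eps _ _) Hd eps He.
  by exists d; split => // y _; exact: H.
move=> r; apply/continuity_pt_eps => eps He.
have [d [Hd H]] := Hloc (cl r) (Hcl r) eps He; exists d; split => // y Hy.
apply: H; first exact: Hcl.
by apply: Rle_lt_trans Hy; apply: (clamp_lip r0 Rb); lra.
Qed.

(** The derivative is the right-hand side of the ODE, which is continuous because [St] is. *)
Let CSt : C1I r0 Rb St.
Proof.
pose u c r := c * rn r.
pose f r := gfun g2 (spd c2 r) * u c2 r * F2 (St r) - gfun g1 (spd c1 r) * u c1 r * F1 (St r).
have cont F : C1I r0 Rb F -> continuity F by case=> ? [].
have Cu' c : continuity (u c) by apply: cont; apply: C1I_mul => //; exact: C1I_const.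
have CF F dF d2F : fractional_flow F dF d2F -> continuity (fun r => F (St r)).
  move=> HF r; apply: (continuity_pt_comp St F); first exact: saturation_continuity.
  by apply: ff_c HF _; exact: HsI.
exists f; split; first exact: saturation_continuity.
split.
  apply: continuity_minus; apply: continuity_mult.
  - by apply: continuity_mult => //; exact: cont (Cg _ _).
  - exact: CF HF2.
  - by apply: continuity_mult => //; exact: cont (Cg _ _).
  - exact: CF HF1.
move=> r Hr.
have -> : f r = Gsc g2 (c2 * Rpower r (1 - INR n)) * F2 (Shat r)
        - Gsc g1 (c1 * Rpower r (1 - INR n)) * F1 (Shat r).
  rewrite /f /u /Gsc /St /rn /cl clamp_id; last lra.
  by rewrite !Rabs_mult (Rabs_pos_eq (Rpower _ _)) //; exact/Rlt_le/exp_pos.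
apply: (derivable_pt_lim_locally_ext Shat St r r0 Rb _ Hr); last by apply: HSode; lra.
by move=> z Hz; rewrite /St /cl clamp_id //; lra.
Qed.

Let CF F dF d2F : fractional_flow F dF d2F -> C1I r0 Rb (fun r => F (St r)).
Proof.
move=> HF; apply: (C1I_comp r0 Rb (fun s => 0 < s < 1) F dF) => //.
- exact: ff_D HF.
- by move=> s; exact: ff_Dc HF.
by move=> r; exact: HsI.
Qed.

Let CdF F dF d2F : fractional_flow F dF d2F -> C1I r0 Rb (fun r => dF (St r)).
Proof.
move=> HF; apply: (C1I_comp r0 Rb (fun s => 0 < s < 1) dF d2F) => //.
- exact: ff_D2 HF.
- exact: ff_D2c HF.
by move=> r; exact: HsI.
Qed.

(** Eigenvalue of [B] orthogonally to [x]. The steady velocities are parallel to [x], so the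
    rank-one parts of the Jacobians act along [x] only and enter only [radial_coef]. *)
Definition tangential_coef (r : R) : R :=
  F1 (St r) * gfun g1 (spd c1 r) + F2 (St r) * gfun g2 (spd c2 r).

Definition radial_coef (r : R) : R :=
  tangential_coef r
  + (F1 (St r) * (gder g1 (spd c1 r) * (spd c1 r))
     + F2 (St r) * (gder g2 (spd c2 r) * (spd c2 r))).

Definition drift_coef (r : R) : R :=
  dF2 (St r) * gfun g2 (spd c2 r) * (c2 / cl r ^ n)
  - dF1 (St r) * gfun g1 (spd c1 r) * (c1 / cl r ^ n).

(** This and [source_radial] are the coefficients of [A] times [F1] times the Jacobian of the first
    phase, in the very form produced by [radm_mul]. *)
Definition source_tangential (r : R) : R := / tangential_coef r * (F1 (St r) * gfun g1 (spd c1 r)).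

Definition source_radial (r : R) : R :=
  / tangential_coef r * (F1 (St r) * (gder g1 (spd c1 r) * (spd c1 r) / (cl r * cl r)))
  + (/ radial_coef r - / tangential_coef r) / (cl r * cl r) * (F1 (St r) * gfun g1 (spd c1 r))
  + (/ radial_coef r - / tangential_coef r) / (cl r * cl r)
    * (F1 (St r) * (gder g1 (spd c1 r) * (spd c1 r) / (cl r * cl r))) * (r * r).

(** The speeds [|c| r^(1-n)] are largest at [r0], which is why the constants [d1c], [d2c], [d3c] are
    evaluated there. *)
Let Hu c r : 0 <= Rabs c * rn r <= Rabs c * rho n r0.
Proof.
have Hc := Rabs_pos c; split; first by apply: Rmult_le_pos => //; exact/Rlt_le.
apply: Rmult_le_compat_l => //; rewrite /rn /rho.
have Hn1 : 1 <= INR n by rewrite -[1]/(INR 1); apply: le_INR; apply/leP; exact: ltnW.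
have -> : 1 - INR n = - (INR n - 1) by ring.
rewrite !Rpower_Ropp; apply: Rinv_le_contravar; first exact: exp_pos.
by apply: Rle_Rpower_l; have := Hcl r; lra.
Qed.

Let C0 := C0c g1 g2 n r0 c1 c2 F1 F2 sl sh.
Let C1 := C1c g1 g2 F1 F2 sl sh.
Let C2 := C2c g1 g2 n r0 c1 c2 dF1 dF2 sl sh.

Let HF1p r : 0 < F1 (St r).
Proof. by apply: ff_pos HF1 _ _; exact: HsI. Qed.
Let HF2p r : 0 < F2 (St r).
Proof. by apply: ff_pos HF2 _ _; exact: HsI. Qed.

Let Hgb g c r : admissible g -> 0 < gfun g (spd c r) <= gfun g (Rabs c * rho n r0).
Proof.
by move=> Hg; have [h1 h2] := Hu c r; have [] := gfun_bounds g _ _ Hg h1 h2; lra.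
Qed.
Let Hgdb g c r : admissible g -> 0 <= gder g (spd c r) * (spd c r)
  <= gder g (Rabs c * rho n r0) * (Rabs c * rho n r0).
Proof.
by move=> Hg; have [h1 h2] := Hu c r; have [] := gder_bounds g _ _ Hg h1 h2; lra.
Qed.

Let Hp0 r : 0 < tangential_coef r.
Proof.
have := Rmult_lt_0_compat _ _ (HF1p r) (proj1 (Hgb g1 c1 r Hg1)).
have := Rmult_lt_0_compat _ _ (HF2p r) (proj1 (Hgb g2 c2 r Hg2)); rewrite /tangential_coef; lra.
Qed.

Let Hph r : tangential_coef r <= radial_coef r.
Proof.
have := Rmult_le_pos _ _ (Rlt_le _ _ (HF1p r)) (proj1 (Hgdb g1 c1 r Hg1)).
have := Rmult_le_pos _ _ (Rlt_le _ _ (HF2p r)) (proj1 (Hgdb g2 c2 r Hg2)); rewrite /radial_coef; lra.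
Qed.

Let HFc F dF d2F : fractional_flow F dF d2F -> forall s, sl <= s <= sh -> continuity_pt F s.
Proof. by move=> HF s Hs; apply: ff_c HF _; exact: HsI. Qed.
Let HdFc F dF d2F : fractional_flow F dF d2F ->
  forall s, sl <= s <= sh -> continuity_pt (fun s => Rabs (dF s)) s.
Proof.
move=> HF s Hs; apply: (continuity_pt_comp dF Rabs); last exact: Rcontinuity_abs.
by apply: ff_Dc HF _; exact: HsI.
Qed.

(** [C0] is a product of sums; it dominates the sum of products because the cross terms are
    nonnegative. *)
Let HhC r : radial_coef r <= C0.
Proof.
have h1 := Rsup_img_ge sl sh F1 (St r) (HFc _ _ _ HF1) (HSt r).
have h2 := Rsup_img_ge sl sh F2 (St r) (HFc _ _ _ HF2) (HSt r).
rewrite /C0 /C0c /d4c /d1c /d3c /mu1c /radial_coef /tangential_coef.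
have [a1 b1] := Hgb g1 c1 r Hg1; have [a2 b2] := Hgb g2 c2 r Hg2.
have [a3 b3] := Hgdb g1 c1 r Hg1; have [a4 b4] := Hgdb g2 c2 r Hg2.
have p1 := HF1p r; have p2 := HF2p r.
move: (Rsup_of _) (Rsup_of _) (F1 _) (F2 _) h1 h2 p1 p2 => m1 m2 f1 f2 h1 h2 p1 p2.
move: (gfun g1 _) (gfun g1 _) (gfun g2 _) (gfun g2 _) (gder g1 _ * _) (gder g1 _ * _)
  (gder g2 _ * _) (gder g2 _ * _) a1 b1 a2 b2 a3 b3 a4 b4 => G1 g1' G2 g2' D1 d1 D2 d2 *.
nra.
Qed.

Let HC0 : 0 < C0.
Proof. by have := Hp0 0; have := Hph 0; have := HhC 0; lra. Qed.

Let Hslsh : sl <= sh.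
Proof. by have := HSt 0; lra. Qed.

(** The second inequality means [kappa0 >= 1 / 2], on which the decay rate relies. *)
Let HC1 : 0 < C1 <= C0.
Proof.
have p1 := Rinf_img_pos sl sh F1 Hslsh (HFc _ _ _ HF1) (fun s Hs => ff_pos _ _ _ HF1 s (HsI s Hs)).
have p2 := Rinf_img_pos sl sh F2 Hslsh (HFc _ _ _ HF2) (fun s Hs => ff_pos _ _ _ HF2 s (HsI s Hs)).
have h1 := Rsup_img_ge sl sh F1 (St 0) (HFc _ _ _ HF1) (HSt 0).
have h2 := Rsup_img_ge sl sh F2 (St 0) (HFc _ _ _ HF2) (HSt 0).
have h3 := Rinf_img_le sl sh F1 (St 0) (HFc _ _ _ HF1) (HSt 0).
have h4 := Rinf_img_le sl sh F2 (St 0) (HFc _ _ _ HF2) (HSt 0).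
have Hg0 g c : admissible g -> 0 < gfun g 0 <= gfun g (Rabs c * rho n r0).
  move=> Hg; have [h5 h6] := Hu c 0.
  by have [] := gfun_bounds g 0 _ Hg (Rle_refl 0) (Rle_trans _ _ _ h5 h6); lra.
have k1 := Hg0 g1 c1 Hg1; have k2 := Hg0 g2 c2 Hg2.
have [a3 b3] := Hgdb g1 c1 0 Hg1; have [a4 b4] := Hgdb g2 c2 0 Hg2.
have m1 := Rmin_l (gfun g1 0) (gfun g2 0).
have m0 : 0 < Rmin (gfun g1 0) (gfun g2 0) by apply: Rmin_pos; lra.
rewrite /C1 /C0 /C1c /C0c /d0c /d4c /d1c /d3c /mu1c /mu2c; split.
  by apply: Rmult_lt_0_compat; lra.
by apply: Rmult_le_compat; lra.
Qed.

Let Htc : C1I r0 Rb tangential_coef.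
Proof. by apply: C1I_add; apply: C1I_mul => //; [exact: CF HF1|exact: CF HF2]. Qed.

Let Hrc : C1I r0 Rb radial_coef.
Proof.
apply: C1I_add => //.
by apply: C1I_add; apply: C1I_mul => //; [exact: CF HF1|exact: CF HF2].
Qed.

Let Hcln r : cl r ^ n <> 0.
Proof. by apply: pow_nonzero; have := Hcl r; lra. Qed.
Let Hclsq r : cl r * cl r <> 0.
Proof. by have := Hcl r; nra. Qed.

Let Hdc : C1I r0 Rb drift_coef.
Proof.
have Cc c : C1I r0 Rb (fun r => c / cl r ^ n).
  by apply: C1I_div => //; [exact: C1I_const|exact: C1I_pow].
apply: C1I_sub; apply: C1I_mul => //; apply: C1I_mul => //; [exact: CdF HF2|exact: CdF HF1].
Qed.

Lemma coefficients_radial_data : radial_data r0 Rb C0 tangential_coef radial_coef drift_coef.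
Proof. by split => //; lra. Qed.

Let Cclsq : C1I r0 Rb (fun r => cl r * cl r).
Proof. exact: C1I_mul. Qed.

Let CFd : C1I r0 Rb (fun r => F1 (St r) * (gder g1 (spd c1 r) * (spd c1 r) / (cl r * cl r))).
Proof. by apply: C1I_mul; [exact: CF HF1|exact: C1I_div]. Qed.

Lemma source_tangential_C1I : C1I r0 Rb source_tangential.
Proof.
apply: C1I_mul; first exact: C1I_inv_p coefficients_radial_data.
by apply: C1I_mul => //; exact: CF HF1.
Qed.

Lemma source_radial_C1I : C1I r0 Rb source_radial.
Proof.
have h1 := C1I_inv_p _ _ _ _ _ _ coefficients_radial_data.
have h2 := C1I_radA2 _ _ _ _ _ _ coefficients_radial_data.
have h3 : C1I r0 Rb (fun r => F1 (St r) * gfun g1 (spd c1 r)).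
  by apply: C1I_mul => //; exact: CF HF1.
apply: C1I_add; last by apply: C1I_mul; [exact: C1I_mul|apply: C1I_mul; exact: C1I_id].
by apply: C1I_add; exact: C1I_mul.
Qed.

Let Hrn_pow r : r0 <= r <= Rb -> rn r = r / r ^ n.
Proof.
move=> Hr; rewrite /rn /cl clamp_id // /Rminus Rpower_plus Rpower_Ropp Rpower_1; last lra.
by rewrite Rpower_pow; last lra.
Qed.

(** Reason: [|b . x| <= |b| |x| <= C2 Rb]. The bound is left in the shape [N - n] with
    [N = n + C2 Rb]. *)
Lemma drift_coef_bound r : r0 < r < Rb -> Rabs (drift_coef r * (r * r)) <= INR n + C2 * Rb - INR n.
Proof.
move=> Hr; have -> : INR n + C2 * Rb - INR n = C2 * Rb by ring.
have -> : drift_coef r * (r * r) = (dF2 (St r) * (gfun g2 (spd c2 r) * (c2 * rn r))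
    - dF1 (St r) * (gfun g1 (spd c1 r) * (c1 * rn r))) * r.
  rewrite /drift_coef {2 4}Hrn_pow; last lra.
  rewrite {3 4}Hrn_pow; last lra.
  rewrite /cl clamp_id; last lra.
  by field; apply: pow_nonzero; lra.
apply: Rabs_mult_le; last by rewrite Rabs_pos_eq; lra.
have [q1 q1'] := Hgb g1 c1 r Hg1; have [q2 q2'] := Hgb g2 c2 r Hg2.
have hb (g : gdata) c : 0 < gfun g (spd c r) <= gfun g (Rabs c * rho n r0) ->
    Rabs (gfun g (spd c r) * (c * rn r)) <= gfun g (Rabs c * rho n r0) * (Rabs c * rho n r0).
  move=> hg; have [u1 u2] := Hu c r; apply: Rabs_mult_le; first by rewrite Rabs_pos_eq; lra.
  by rewrite Rabs_mult (Rabs_pos_eq (rn r)) //; exact: Rlt_le.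
have h1 := Rsup_img_ge sl sh (fun s => Rabs (dF1 s)) (St r) (HdFc _ _ _ HF1) (HSt r).
have h2 := Rsup_img_ge sl sh (fun s => Rabs (dF2 s)) (St r) (HdFc _ _ _ HF2) (HSt r).
have b1 := hb g1 c1 (conj q1 q1'); have b2 := hb g2 c2 (conj q2 q2').
have e1 := Rabs_mult_le _ _ _ _ h1 b1; have e2 := Rabs_mult_le _ _ _ _ h2 b2.
rewrite /C2 /C2c /d2c /mu3c.
have d1 := Rabs_pos (gfun g1 (spd c1 r) * (c1 * rn r)).
have d2 := Rabs_pos (gfun g2 (spd c2 r) * (c2 * rn r)).
have k1 := Rabs_pos (dF1 (St r)); have k2 := Rabs_pos (dF2 (St r)).
move: (Rsup_of _) (Rsup_of _) h1 h2 e1 e2 => m1 m2 h1 h2 e1 e2.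
have x1 : 0 <= m1 * (gfun g1 (Rabs c1 * rho n r0) * (Rabs c1 * rho n r0)).
  by apply: Rmult_le_pos; lra.
have x2 : 0 <= m2 * (gfun g2 (Rabs c2 * rho n r0) * (Rabs c2 * rho n r0)).
  by apply: Rmult_le_pos; lra.
apply: Rle_trans (Rabs_triang _ _) _; rewrite Rabs_Ropp; lra.
Qed.

Let eta := eta1c g1 g2 n r0 c1 c2 F1 F2 dF1 dF2 sl sh Rb.

(** From [s_R = kappa0 N] one gets [q = C0 / (2 N)], hence [eta1 = 2 N ln (1 + eta0) / (C0 Rb^2)].
    It remains that [ln (1 + eta0) <= eta0 = (r0 / Rb)^(2 kappa0 N) <= (r0 / Rb)^N], by
    [2 kappa0 >= 1] and [r0 < Rb]. *)
Lemma decay_rate_bound : 0 < eta /\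
  eta * C0 * Rpower Rb (INR n + C2 * Rb + 2) <= 2 * (INR n + C2 * Rb) * Rpower r0 (INR n + C2 * Rb).
Proof.
pose N := INR n + C2 * Rb; rewrite -/N.
have HN : 1 <= N.
  have := drift_coef_bound ((r0 + Rb) / 2) ltac:(lra).
  have := Rabs_pos (drift_coef ((r0 + Rb) / 2) * ((r0 + Rb) / 2 * ((r0 + Rb) / 2))).
  have Hn1 : 1 <= INR n by rewrite -[1]/(INR 1); apply: le_INR; apply/leP; exact: ltnW.
  by rewrite /N; lra.
have [HC1p HC10] := HC1.
pose k := kappa0c g1 g2 n r0 c1 c2 F1 F2 sl sh.
have Ek : k = C0 / (2 * C1) by [].
have Hk : 1 / 2 <= k.
  rewrite Ek; apply: (Rmult_le_reg_r (2 * C1)); first lra.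
  by rewrite Rdiv_mult_simpl; lra.
have Es : sRc g1 g2 n r0 c1 c2 F1 F2 dF1 dF2 sl sh Rb = k * N by [].
pose e0 := eta0c g1 g2 n r0 c1 c2 F1 F2 dF1 dF2 sl sh Rb.
have Ee0 : e0 = Rpower (r0 / Rb) (2 * (k * N)) by rewrite -Es.
have He0 : 0 < e0 by rewrite Ee0; exact: exp_pos.
have Eq : qc g1 g2 n r0 c1 c2 F1 F2 dF1 dF2 sl sh Rb = C0 / (2 * N).
  rewrite /qc Es -/k -/C0; field; lra.
have Eeta : eta = ln (1 + e0) * (2 * N) / (C0 * Rb ^ 2).
  by rewrite /eta /eta1c -/e0 Eq; field; lra.
have Hln : 0 < ln (1 + e0) <= e0.
  split; first by rewrite -ln_1; apply: ln_increasing; lra.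
  have := exp_ineq1_le (ln (1 + e0)); rewrite exp_ln; lra.
have Hrp : 0 < r0 / Rb < 1.
  split; first by apply: Rdiv_lt_0_compat; lra.
  apply: (Rmult_lt_reg_r Rb); first lra.
  by rewrite Rdiv_mult_simpl; lra.
have He0N : e0 <= Rpower (r0 / Rb) N.
  rewrite Ee0 /Rpower.
  have Hlnn : ln (r0 / Rb) < 0 by rewrite -ln_1; apply: ln_increasing; lra.
  have : N <= 2 * (k * N) by nra.
  move=> h; have h' : 2 * (k * N) * ln (r0 / Rb) <= N * ln (r0 / Rb) by nra.
  exact: exp_le_exp.
have HRN : Rpower (r0 / Rb) N * Rpower Rb N = Rpower r0 N.
  rewrite Rpower_mult_distr; try lra; congr Rpower; field; lra.
have Hden : 0 < C0 * Rb ^ 2 by apply: Rmult_lt_0_compat => //; nra.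
split; first by rewrite Eeta; apply: Rdiv_lt_0_compat => //; nra.
have -> : Rpower Rb (N + 2) = Rpower Rb N * Rb ^ 2.
  by rewrite Rpower_plus -(Rpower_pow 2); [congr (_ * Rpower _ _); rewrite /=; ring|lra].
have -> : eta * C0 * (Rpower Rb N * Rb ^ 2) = 2 * N * (ln (1 + e0) * Rpower Rb N).
  by rewrite Eeta; field; lra.
apply: Rmult_le_compat_l; first lra.
rewrite -HRN; apply: Rmult_le_compat_r; [exact/Rlt_le/exp_pos|lra].
Qed.

Let Hustar c (x : vec n) : annulus r0 Rb x -> vnorm (ustar c x) = Rabs c * rn (vnorm x).
Proof.
rewrite /annulus => Hx; rewrite Hrn_pow; last lra.
have Hp : 0 < vnorm x ^ n by apply: pow_lt; lra.
by rewrite /ustar vnorm_scal /Rdiv Rabs_mult Rabs_inv (Rabs_pos_eq (vnorm x ^ n)); [ring|lra].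
Qed.

Let Gjac_radm g c (x : vec n) i j : annulus r0 Rb x -> Gjac g (ustar c x) i j
  = radm (fun r => gfun g (spd c r))
      (fun r => gder g (spd c r) * (spd c r) / (cl r * cl r)) x i j.
Proof.
move=> Hx; rewrite /Gjac Hustar // /radm; have Hx' := Hx; rewrite /annulus in Hx'.
have Hr := Hrn (vnorm x).
(* At zero speed the rank-one coefficient vanishes through its factor [|c| rn], in agreement with
   the first branch of [Gjac]. *)
case: Req_EM_T => [E|E] /=; first by rewrite E; field; have := Hcl (vnorm x); lra.
have Ecl : cl (vnorm x) = vnorm x by rewrite /cl clamp_id //; lra.
rewrite Ecl; congr (_ + _); rewrite /ustar /vscal.
have Hp : 0 < vnorm x ^ n by apply: pow_lt; lra.
have Ern : vnorm x ^ n = vnorm x / rn (vnorm x).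
  by rewrite Hrn_pow; [field; lra|lra].
have Hac : Rabs c <> 0 by move=> Hc; apply: E; rewrite Hc; ring.
have Hc2 : c * c = Rabs c * Rabs c by rewrite -Rabs_mult Rabs_pos_eq //; nra.
rewrite Ern.
have -> : gder g (Rabs c * rn (vnorm x)) * (c / (vnorm x / rn (vnorm x)) * x i)
     * (c / (vnorm x / rn (vnorm x)) * x j) / (Rabs c * rn (vnorm x))
  = gder g (Rabs c * rn (vnorm x)) * (c * c) * rn (vnorm x) / (Rabs c * (vnorm x * vnorm x)) * x i * x j.
  by field; repeat split => //; lra.
by rewrite Hc2; field; split => //; lra.
Qed.

Lemma Amat_radA (x : vec n) : annulus r0 Rb x ->
  Amat g1 g2 F1 F2 Shat c1 c2 x = radA r0 Rb tangential_coef radial_coef x.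
Proof.
move=> Hx; have Hx' := Hx; rewrite /annulus in Hx'.
have EB : Bmat g1 g2 F1 F2 Shat c1 c2 x
  = radm tangential_coef (fun r => (radial_coef r - tangential_coef r) / (clamp r0 Rb r * clamp r0 Rb r)) x.
  apply: mat_ext => i j.
  rewrite /Bmat /madd /mscal !Gjac_radm // /radm /radial_coef /tangential_coef /St -/cl.
  have -> : cl (vnorm x) = vnorm x by rewrite /cl clamp_id //; lra.
  by field; lra.
have [HAB HBA] := radA_inverse n _ _ _ _ _ _ coefficients_radial_data x Hx.
rewrite -EB in HAB HBA.
apply: (right_inverse_unique n _ _ _ HAB).
exact: (epsilon_spec (inhabits (fun _ _ => R0))
  (fun M : mat n => matmul (Bmat g1 g2 F1 F2 Shat c1 c2 x) M = idmat n) (ex_intro _ _ HBA)).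
Qed.

Lemma bvec_drift (x : vec n) : annulus r0 Rb x ->
  bvec g1 g2 dF1 dF2 Shat c1 c2 x = vscal (drift_coef (vnorm x)) x.
Proof.
move=> Hx; have Hx' := Hx; rewrite /annulus in Hx'.
apply: functional_extensionality => i; rewrite /bvec /Gvec !Hustar //.
rewrite /vsub /vscal /ustar /vscal /drift_coef /St.
have -> : cl (vnorm x) = vnorm x by rewrite /cl clamp_id //; lra.
by field; apply: pow_nonzero; lra.
Qed.

Lemma Ac_source (x : vec n) (V : vec n -> R -> vec n) t : annulus r0 Rb x ->
  matvec (Amat g1 g2 F1 F2 Shat c1 c2 x) (cvec g1 F1 Shat c1 V x t)
  = matvec (radm source_tangential source_radial x) (V x t).
Proof.
move=> Hx; have Hx' := Hx; rewrite /annulus in Hx'.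
rewrite Amat_radA // /cvec matvec_matmul; congr (matvec _ _).
have -> : mscal (F1 (Shat (vnorm x))) (Gjac g1 (ustar c1 x))
  = radm (fun r => F1 (St r) * gfun g1 (spd c1 r))
      (fun r => F1 (St r) * (gder g1 (spd c1 r) * (spd c1 r) / (cl r * cl r))) x.
  apply: mat_ext => i j.
  rewrite /mscal Gjac_radm // /radm /St.
  have -> : cl (vnorm x) = vnorm x by rewrite /cl clamp_id //; lra.
  by ring.
by apply: mat_ext => i j; rewrite radm_mul.
Qed.

Lemma radial_structure : exists p h bc mt me : R -> R,
  radial_data r0 Rb C0 p h bc /\ C1I r0 Rb mt /\ C1I r0 Rb me /\
  (forall r, r0 < r < Rb -> Rabs (bc r * (r * r)) <= INR n + C2 * Rb - INR n) /\
  forall x : vec n, annulus r0 Rb x ->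
    Amat g1 g2 F1 F2 Shat c1 c2 x = radA r0 Rb p h x /\
    bvec g1 g2 dF1 dF2 Shat c1 c2 x = vscal (bc (vnorm x)) x /\
    forall (V : vec n -> R -> vec n) t,
      matvec (Amat g1 g2 F1 F2 Shat c1 c2 x) (cvec g1 F1 Shat c1 V x t)
      = matvec (radm mt me x) (V x t).
Proof.
exists tangential_coef, radial_coef, drift_coef, source_tangential, source_radial.
split; first exact: coefficients_radial_data.
split; first exact: source_tangential_C1I.
split; first exact: source_radial_C1I.
split; first exact: drift_coef_bound.
move=> x Hx; split; first exact: Amat_radA.
split; first exact: bvec_drift.
by move=> V t; exact: Ac_source.
Qed.

End Coefficients.

(** * Suprema over the closed domain and conclusion *)

Lemma cont_xt_slice n (U : vec n -> Prop) (I : R -> Prop) f t :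
  cont_xt (fun x t => U x /\ I t) f -> I t -> cont_on U (fun x => f x t).
Proof.
move=> H Ht x Hx e He; have [d [Hd Hfd]] := H x t (conj Hx Ht) e He.
by exists d; split => // y Hy Hxy; apply: Hfd => //; rewrite Rminus_diag Rabs_R0.
Qed.

Lemma closure_compact_max n (U : vec n -> Prop) B (f : vec n -> R) :
  (forall x, U x -> vnorm x <= B) -> (exists x, U x) ->
  (forall (X : nat -> vec n) x, (forall k, closure U (X k)) -> closure U x -> vcv X x ->
     Un_cv (fun k => f (X k)) (f x)) ->
  exists x, closure U x /\ forall y, closure U y -> f y <= f x.
Proof.
move=> HB [x0 Hx0] Hf; apply: (seq_compact_max _ _ _ x0); first exact: closure_sub.
move=> X HX; have [phi [x [Hphi Hx]]] := bolzano_weierstrass n X B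
  (fun k => closure_norm _ _ _ _ HB (HX k)).
have Hcx : closure U x by apply: closure_cv Hx => k; exact: HX.
by exists phi, x; split => //; split => //; apply: Hf => // k; exact: HX.
Qed.

Lemma closure_bounded n (U : vec n -> Prop) B (Dom : vec n -> R -> Prop) f t :
  (forall x, U x -> vnorm x <= B) -> (forall x, closure U x -> Dom x t) -> cont_xt Dom f ->
  exists M, 0 <= M /\ forall x, closure U x -> Rabs (f x t) <= M.
Proof.
move=> HB HD Hf; case: (classic (exists x, U x)) => [Hne|Hempty]; last first.
  exists 0; split; first lra.
  by move=> x Hx; exfalso; apply: Hempty; have [y [Hy _]] := Hx 1 Rlt_0_1; exists y.
have [x [Hx Hmax]] := closure_compact_max n U B (fun x => Rabs (f x t)) HB Hne
  ltac:(by move=> X x HX Hx HXx; apply: cv_cvabs;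
    apply: (cont_xt_cv _ _ _ _ (fun=> t) _ _ Hf) => //; [exact: HD|move=> k; exact: HD|exact: Un_cv_const]).
by exists (Rabs (f x t)); split => //; exact: Rabs_pos.
Qed.

(* A point of the closure with maximal norm is not interior. *)
Lemma bdry_nonempty n (U : vec n -> Prop) a b :
  0 < a -> is_open U -> (forall x, U x -> a < vnorm x < b) -> (exists x, U x) -> exists x, bdry U x.
Proof.
move=> Ha HU HB Hne.
have [x [Hx Hmax]] := closure_compact_max n U b (fun x => vnorm x)
  (fun x Hx => ltac:(have := HB x Hx; lra)) Hne (fun X x _ _ H => vcv_vnorm _ _ _ H).
exists x; split => // HUx; have [d [Hd HdU]] := open_line n U x x HU HUx.
have := Hmax _ (closure_sub _ _ _ (HdU (d / 2) ltac:(rewrite Rabs_pos_eq; lra))).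
have -> : vadd x (vscal (d / 2) x) = vscal (1 + d / 2) x by vec_ring.
rewrite vnorm_scal Rabs_pos_eq; last lra.
have := HB x HUx; nra.
Qed.

Lemma closure_bound_of_interior n (U : vec n -> Prop) f t M :
  cont_xt (fun x t => closure U x /\ 0 <= t) f -> 0 <= t -> (forall x, U x -> Rabs (f x t) <= M) ->
  forall x, closure U x -> Rabs (f x t) <= M.
Proof.
move=> Hf Ht HM x Hx; apply: le_epsilon => e He.
have [d [Hd H]] := Hf x t (conj Hx Ht) e He; have [y [Hy Hyx]] := Hx d Hd.
have := H y t (conj (closure_sub _ _ _ Hy) Ht) Hyx ltac:(rewrite Rminus_diag Rabs_R0; lra).
have := HM y Hy; split_Rabs; lra.
Qed.

Lemma exp_decay_small eta A eps : 0 < eta -> 0 <= A -> 0 < eps ->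
  exists T, 0 <= T /\ forall t, T <= t -> A * exp (- eta * t) < eps.
Proof.
move=> Heta HA He.
(* From this time on [A <= eps eta t < eps (1 + eta t) <= eps exp (eta t)]. *)
exists (A / (eps * eta)); split; first by apply: Rdiv_le_0_compat => //; nra.
move=> t Ht.
have h1 := exp_ineq1_le (eta * t).
have h2 : exp (- eta * t) * exp (eta * t) = 1.
  by rewrite -exp_plus -exp_0; congr exp; ring.
have h3 := exp_pos (- eta * t).
have h4 : A <= eps * (eta * t).
  have := Rmult_le_compat_r (eps * eta) _ _ ltac:(nra) Ht; rewrite Rdiv_mult_simpl; [lra|nra].
have h5 : A < eps * exp (eta * t) by nra.
have := Rmult_lt_compat_l _ _ _ h3 h5; nra.
Qed.

Theorem theorem4p9
  (n : nat) (Hn : (2 <= n)%nat)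
  (g1 g2 : gdata) (Hg1 : admissible g1) (Hg2 : admissible g2)
  (f1 f2 pc : R -> R)
  (Hf1c : forall s, 0 <= s <= 1 -> cont_rel (fun y => 0 <= y <= 1) f1 s)
  (Hf2c : forall s, 0 <= s <= 1 -> cont_rel (fun y => 0 <= y <= 1) f2 s)
  (Hf1C1 : Ck01 1 f1) (Hf2C1 : Ck01 1 f2)
  (Hf10 : f1 0 = 0) (Hf21 : f2 1 = 0)
  (Hf1' : forall s, 0 < s < 1 -> exists l, derivable_pt_lim f1 s l /\ 0 < l)
  (Hf2' : forall s, 0 < s < 1 -> exists l, derivable_pt_lim f2 s l /\ l < 0)
  (HpcC1 : Ck01 1 pc) (Hpcpos : forall s, 0 < s < 1 -> 0 < pc s)
  (dF1 dF2 : R -> R)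
  (HdF1 : forall s, 0 < s < 1 -> derivable_pt_lim (Ffun pc f1) s (dF1 s))
  (HdF2 : forall s, 0 < s < 1 -> derivable_pt_lim (Ffun pc f2) s (dF2 s))
  (r0 c1 c2 s0 : R) (Hr0 : 0 < r0) (Hc : 0 < c1 ^ 2 + c2 ^ 2) (Hs0 : 0 < s0 < 1)
  (Rmax : R) (Shat : R -> R) (HRmax : r0 < Rmax)
  (HS0 : Shat r0 = s0)
  (HScont : forall eps, 0 < eps -> exists d, 0 < d /\
              forall r, r0 <= r < r0 + d -> Rabs (Shat r - s0) < eps)
  (HSode : forall r, r0 < r < Rmax ->
     derivable_pt_lim Shat r
       (Gsc g2 (c2 * Rpower r (1 - INR n)) * Ffun pc f2 (Shat r)
        - Gsc g1 (c1 * Rpower r (1 - INR n)) * Ffun pc f1 (Shat r)))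
  (HSrange : forall r, r0 <= r < Rmax -> 0 < Shat r < 1)
  (Rb sl sh : R) (HRb : r0 < Rb < Rmax) (Hsl : 0 < sl) (Hsh : sh < 1)
  (HSbd : forall r, r0 <= r <= Rb -> sl <= Shat r <= sh)
  (U : vec n -> Prop) (HUopen : is_open U)
  (HUsub : forall x, U x -> r0 < vnorm x < Rb)
  (V : vec n -> R -> vec n) (sigma0 : vec n -> R) (g : vec n -> R -> R)
  (* continuity of the data and compatibility *)
  (Hsig0c : cont_xt (fun x t => closure U x /\ t = 0) (fun x _ => sigma0 x))
  (Hgc : cont_xt (fun x t => bdry U x /\ 0 <= t) g)
  (Hcompat : forall x, bdry U x -> sigma0 x = g x 0)
  (* (E1) *)
  (HF1C7 : Ck01 7 (Ffun pc f1)) (HF2C7 : Ck01 7 (Ffun pc f2))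
  (HVC6 : forall i : 'I_n, Cmx 6 (fun x t => U x /\ 0 <= t)
            (fun x t => closure U x /\ 0 <= t) (fun x t => V x t i))
  (HVtC3 : exists Vt : vec n -> R -> vec n,
      (forall x t (i : 'I_n), U x -> 0 < t ->
          derivable_pt_lim (fun s => V x s i) t (Vt x t i)) /\
      forall i : 'I_n, Cmx 3 (fun x t => U x /\ 0 <= t)
            (fun x t => closure U x /\ 0 <= t) (fun x t => Vt x t i))
  (* first and second x-derivatives of V: DV x t i j = d_j V_i, D2V x t i j k = d_k d_j V_i *)
  (DV : vec n -> R -> 'I_n -> 'I_n -> R) (D2V : vec n -> R -> 'I_n -> 'I_n -> 'I_n -> R)
  (HDV : forall x t i j, U x -> 0 < t -> has_partial (fun y => V y t i) x j (DV x t i j))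
  (HD2V : forall x t i j k, U x -> 0 < t ->
            has_partial (fun y => DV y t i j) x k (D2V x t i j k))
  (* Delta_6 < oo and Delta_7 < oo *)
  (Hbd6 : bound (fun y => exists x t, U x /\ 0 < t /\
       y = vnorm (V x t) + sqrt (sumI (fun i => sumI (fun j => DV x t i j ^ 2)))
           + sqrt (sumI (fun i => sumI (fun j => sumI (fun k => D2V x t i j k ^ 2))))))
  (Hbd7 : bound (fun y => exists x t, bdry U x /\ 0 <= t /\ y = Rabs (g x t)))
  (* the classical solution sigma of (Sigma), in C(closure D) and C^{2,1}(D) *)
  (sigma : vec n -> R -> R) (dsig : vec n -> R -> vec n)
  (d2sig : vec n -> R -> 'I_n -> 'I_n -> R) (sigt : vec n -> R -> R)
  (Hsigc : cont_xt (fun x t => closure U x /\ 0 <= t) sigma)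
  (Hdsig : forall x t i, U x -> 0 < t -> has_partial (fun y => sigma y t) x i (dsig x t i))
  (Hd2sig : forall x t i j, U x -> 0 < t ->
              has_partial (fun y => dsig y t i) x j (d2sig x t i j))
  (Hsigt : forall x t, U x -> 0 < t -> derivable_pt_lim (fun s => sigma x s) t (sigt x t))
  (Hdsigc : forall i, cont_xt (fun x t => U x /\ 0 < t) (fun x t => dsig x t i))
  (Hd2sigc : forall i j, cont_xt (fun x t => U x /\ 0 < t) (fun x t => d2sig x t i j))
  (Hsigtc : cont_xt (fun x t => U x /\ 0 < t) sigt)
  (Hpde : forall x t, U x -> 0 < t ->
     exists dv : 'I_n -> R,
       (forall i, has_partial
          (fun y => (vadd
             (matvec (Amat g1 g2 (Ffun pc f1) (Ffun pc f2) Shat c1 c2 y)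
                (vsub (dsig y t) (vscal (sigma y t) (bvec g1 g2 dF1 dF2 Shat c1 c2 y))))
             (matvec (Amat g1 g2 (Ffun pc f1) (Ffun pc f2) Shat c1 c2 y)
                (cvec g1 (Ffun pc f1) Shat c1 V y t))) i) x i (dv i)) /\
       sigt x t = sumI dv)
  (Hbc : forall x t, bdry U x -> 0 < t -> sigma x t = g x t)
  (Hic : forall x, U x -> sigma x 0 = sigma0 x) :
  let A := Amat g1 g2 (Ffun pc f1) (Ffun pc f2) Shat c1 c2 in
  let b := bvec g1 g2 dF1 dF2 Shat c1 c2 in
  let c := cvec g1 (Ffun pc f1) Shat c1 V in
  let v2 := fun x t => vadd (matvec (A x) (vsub (dsig x t) (vscal (sigma x t) (b x))))
                            (matvec (A x) (c x t)) in
  let v1 := fun x t => vsub (V x t) (v2 x t) in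
  let Vsize := fun x t => vnorm (V x t)
       + sqrt (sumI (fun i => sumI (fun j => DV x t i j ^ 2)))
       + sqrt (sumI (fun i => sumI (fun j => sumI (fun k => D2V x t i j k ^ 2)))) in
  let Delta6 := Rsup_of (fun y => exists x t, U x /\ 0 < t /\ y = Vsize x t) in
  let Delta7 := Rsup_of (fun y => exists x t, bdry U x /\ 0 <= t /\ y = Rabs (g x t)) in
  let S0 := Rsup_of (fun y => exists x, U x /\ y = Rabs (sigma0 x)) in
  let eta1 := eta1c g1 g2 n r0 c1 c2 (Ffun pc f1) (Ffun pc f2) dF1 dF2 sl sh Rb in
  (forall U' : vec n -> Prop, is_open U' -> (forall x, closure U' x -> U x) ->
     exists Mt, 0 < Mt /\
       forall t x, 0 < t -> U' x ->
         vnorm (v1 x t) <= Mt * (1 + / sqrt t)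
                          * (exp (- eta1 * t) * S0 + Delta6 + sqrt Delta6 + Delta7) /\
         vnorm (v2 x t) <= Mt * (1 + / sqrt t)
                          * (exp (- eta1 * t) * S0 + Delta6 + sqrt Delta6 + Delta7))
  /\
  ((forall eps, 0 < eps -> exists T, forall t, T <= t ->
      Rabs (Rsup_of (fun y => exists x, U x /\ y = Vsize x t)
            + Rsup_of (fun y => exists x, bdry U x /\ y = Rabs (g x t))) < eps) ->
   forall x, U x ->
     (forall eps, 0 < eps -> exists T, forall t, T <= t -> vnorm (v1 x t) < eps) /\
     (forall eps, 0 < eps -> exists T, forall t, T <= t -> vnorm (v2 x t) < eps)).
Proof.
move=> A b c v2 v1 Vsize Delta6 Delta7 S0 eta1.
have Hf1p := increasing_pos f1 Hf1c Hf1C1 Hf10 Hf1'.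
have Hf2p := decreasing_pos f2 Hf2c Hf2C1 Hf21 Hf2'.
have [d2F1 Hd2F1] := Ck01_second _ _ _ HF1C7 HdF1.
have [d2F2 Hd2F2] := Ck01_second _ _ _ HF2C7 HdF2.
have HFF1 : fractional_flow (Ffun pc f1) dF1 d2F1.
  split => // s Hs; try by have [? []] := Hd2F1 s Hs.
  by apply: Rinv_0_lt_compat; apply: Rmult_lt_0_compat; auto.
have HFF2 : fractional_flow (Ffun pc f2) dF2 d2F2.
  split => // s Hs; try by have [? []] := Hd2F2 s Hs.
  by apply: Rinv_0_lt_compat; apply: Rmult_lt_0_compat; auto.
have [p [h [bc [mt [me [Hrd [Cmt [Cme [HbcN Hsys]]]]]]]]] :=
  radial_structure n Hn g1 g2 Hg1 Hg2 _ _ _ _ _ _ HFF1 HFF2 r0 c1 c2 s0 Rmax Rb sl sh Shat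
    Hr0 HRb Hsl Hsh HS0 HScont HSode HSbd.
have [Heta1 Hetab] := decay_rate_bound n Hn g1 g2 Hg1 Hg2 _ _ _ _ _ _ HFF1 HFF2 r0 c1 c2 Rmax Rb
  sl sh Shat Hr0 HRb Hsl Hsh HSbd.
rewrite -/eta1 in Heta1 Hetab.
have [bet [gam [Kbet [Kgam Hexp]]]] := flux_expansion n _ _ _ _ _ _ Hrd.
have Hn2 : 2 <= INR n by rewrite -[2]/(INR 2); apply: le_INR; exact/leP.
have [C [HC Hvel]] := velocity_bound n _ _ _ _ _ _ Hrd mt me Cmt Cme bet gam Kbet Kgam Hexp Hn2
  _ eta1 HbcN (Rlt_le _ _ Heta1) Hetab.
have HUb x : U x -> vnorm x <= Rb by move=> /HUsub; lra.
have HUpd x t : U x -> v2 x t = velocity n r0 Rb p h bc mt me sigma dsig V x t.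
  move=> /HUsub Hx; have [EA [Eb Ec]] := Hsys x Hx.
  by rewrite /v2 /velocity /flux /A /b /c Ec EA Eb.
have Hsol : radial_solution n r0 Rb p h bc mt me U sigma dsig d2sig sigt V DV.
  split => //.
  - move=> t Ht; split.
    + by move=> x i Hx; exact: Hdsig.
    + by move=> x i j Hx; exact: Hd2sig.
    + by move=> i; exact: (cont_xt_slice n U (fun t => 0 < t) _ t (Hdsigc i) Ht).
    + by move=> i j; exact: (cont_xt_slice n U (fun t => 0 < t) _ t (Hd2sigc i j) Ht).
  move=> x t Hx Ht; have [dv [Hdv Edv]] := Hpde x t Hx Ht; exists dv; split => // i.
  apply: (partial_near n U _ _ x i (dv i) HUopen Hx _ (Hdv i)) => y Hy.
  exact: (f_equal (fun v => v i) (HUpd y t Hy)).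
have HVs x t : vnorm (V x t) <= Vsize x t /\ (forall i j, Rabs (DV x t i j) <= Vsize x t).
  have q1 := vnorm_ge0 n (V x t).
  have q2 := sqrt_pos (sumI (fun i => sumI (fun j => DV x t i j ^ 2))).
  have q3 := sqrt_pos (sumI (fun i => sumI (fun j => sumI (fun k => D2V x t i j k ^ 2)))).
  split; first by rewrite /Vsize; lra.
  by move=> i j; have := entry_le_frobenius n (DV x t) i j; rewrite /Vsize; lra.
have HVs0 x t : 0 <= Vsize x t by have [? _] := HVs x t; have := vnorm_ge0 n (V x t); lra.
have HD6 x t : U x -> 0 < t -> Vsize x t <= Delta6.
  by move=> Hx Ht; apply: Rsup_of_ge => //; exists x, t.
(* [Rsup_of] of an empty set is arbitrary; a boundary point makes the suprema of [|g|] genuine and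
   nonnegative. *)
have Hbdry0 : (exists x, U x) -> exists x, bdry U x.
  by move=> Hne; apply: (bdry_nonempty n U r0 Rb).
have HD7 x t : bdry U x -> 0 <= t -> Rabs (g x t) <= Delta7.
  by move=> Hx Ht; apply: Rsup_of_ge => //; exists x, t.
(* The boundary condition is given at positive times; continuity of [sigma] carries the bound to
   time 0. *)
have Hclb M T : 0 <= T -> (forall x t, bdry U x -> T <= t -> Rabs (g x t) <= M) ->
    forall x t, bdry U x -> T <= t -> Rabs (sigma x t) <= M.
  move=> HT HM x t Hx Ht; case: (Rle_lt_dec t 0) => Ht0; last by rewrite Hbc //; exact: HM.
  apply: le_epsilon => e He.
  have Hcl : closure U x by case: Hx.
  have Htt : 0 <= t by lra.
  have [d [Hd H]] := Hsigc x t (conj Hcl Htt) e He.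
  have Htd : 0 <= t + d / 2 by lra.
  have := H x (t + d / 2) (conj Hcl Htd) ltac:(rewrite vnorm0; lra) ltac:(rewrite Rabs_pos_eq; lra).
  by rewrite Hbc //; [have := HM x (t + d / 2) Hx ltac:(lra); split_Rabs; lra|lra].
have HbS : bound (fun y => exists x, U x /\ y = Rabs (sigma0 x)).
  have [M [_ HM]] := closure_bounded n U Rb _ _ 0 HUb (fun x Hx => conj Hx erefl) Hsig0c.
  by exists M => y [x [Hx ->]]; apply: HM; exact: closure_sub.
split.
  move=> U' HU'o HU'.
  have [rho [Hrho HrhoU]] := uniform_interior_radius n U U' Rb HUopen HUb HU'.
  pose rho' := Rmin (rho / 2) 1.
  have Hrho' : 0 < rho' by apply: Rmin_pos; lra.
  have Hrho1 : rho' <= 1 by exact: Rmin_r.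
  have Hrho2 : rho' <= rho / 2 by exact: Rmin_l.
  have Hir : 0 < / rho' by exact: Rinv_0_lt_compat.
  exists (C * (/ rho' + 2)); split; first nra.
  move=> t x Ht Hx'.
  have Hx : U x by apply: HU'; exact: closure_sub.
  have HS00 : 0 <= S0.
    by apply: Rle_trans (Rabs_pos (sigma0 x)) _; apply: Rsup_of_ge => //; exists x.
  have HD60 : 0 <= Delta6 by apply: Rle_trans (HVs0 x t) (HD6 x t Hx Ht).
  have HD70 : 0 <= Delta7.
    have [z Hz] := Hbdry0 (ex_intro _ x Hx).
    by apply: Rle_trans (Rabs_pos _) (HD7 z 0 Hz (Rle_refl 0)).
  have Hst : 0 < sqrt t by exact: sqrt_lt_R0.
  have Hsq := sqrt_sqrt t (Rlt_le _ _ Ht).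
  (* [r^2 <= t / 4] keeps the parabolic cylinder at positive times; the cost
     [/ r <= / rho' + 2 / sqrt t] is the source of the factor [1 + / sqrt t]. *)
  pose r := Rmin rho' (sqrt t / 2).
  have Hr : 0 < r by apply: Rmin_pos; lra.
  have Hr1 : r <= rho' by exact: Rmin_l.
  have Hr2 : r <= sqrt t / 2 by exact: Rmin_r.
  have Hir2 : / r <= / rho' + 2 * / sqrt t.
    have Hit : 0 < / sqrt t by exact: Rinv_0_lt_compat.
    rewrite /r /Rmin; case: Rle_dec => _; first lra.
    have -> : / (sqrt t / 2) = 2 * / sqrt t by field; lra.
    lra.
  have HV0 y s : U y -> 0 < s -> vnorm (V y s) <= Delta6 /\ forall i j, Rabs (DV y s i j) <= Delta6.
    move=> Hy Hs; have [h1 h2] := HVs y s; have h3 := HD6 y s Hy Hs.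
    by split; [lra|move=> i j; have := h2 i j; lra].
  have Hini : forall y, closure U y -> Rabs (sigma y 0) <= S0.
    apply: closure_bound_of_interior => //; first lra.
    by move=> y Hy; rewrite Hic //; apply: Rsup_of_ge => //; exists y.
  have Hball y : dist y x <= r -> U y.
    by move=> Hy; apply: (HrhoU x y Hx'); lra.
  have Hrr : r * r < t - 0 by nra.
  have := Hvel U sigma dsig d2sig sigt V DV 0 S0 Delta6 Delta7 Hsol (Rle_refl 0) HS00 HD60 HD70
    HV0 Hini (Hclb _ 0 (Rle_refl 0) HD7) x t r Hball (conj Hr (Rle_trans _ _ _ Hr1 Hrho1)) Hrr.
  rewrite -HUpd // Rminus_0_r.
  pose Q := exp (- eta1 * t) * S0 + Delta6 + Delta7.
  have HQ : 0 <= Q.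
    by have := Rmult_le_pos _ _ (Rlt_le _ _ (exp_pos (- eta1 * t))) HS00; rewrite /Q; lra.
  have Hfin : C / r * Q <= C * (/ rho' + 2) * (1 + / sqrt t)
      * (exp (- eta1 * t) * S0 + Delta6 + sqrt Delta6 + Delta7).
    apply: Rmult_le_compat => //; last by have := sqrt_pos Delta6; rewrite /Q; lra.
      by apply: Rdiv_le_0_compat; lra.
    rewrite /Rdiv Rmult_assoc; apply: Rmult_le_compat_l; first lra.
    have Hit : 0 < / sqrt t by exact: Rinv_0_lt_compat.
    by apply: Rle_trans Hir2 _; nra.
  by rewrite -/Q => -[h1 h2]; split; apply: Rle_trans Hfin.
move=> Hlim x Hx.
have [d [Hd HdU]] := HUopen x Hx.
pose r := Rmin (d / 2) (1 / 2).
have Hr : 0 < r by apply: Rmin_pos; lra.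
have Hr1 : r <= d / 2 by exact: Rmin_l.
have Hr2 : r <= 1 / 2 by exact: Rmin_r.
have HCr : 0 < C / r by exact: Rdiv_lt_0_compat.
have Hdecay eps : 0 < eps -> exists T, forall t, T <= t -> vnorm (v1 x t) < eps /\ vnorm (v2 x t) < eps.
  (* Each of the three terms of the bound will be at most [e], so that their sum stays below
     [4 e]. *)
  move=> He; pose e := eps / (4 * (C / r)).
  have He0 : 0 < e by apply: Rdiv_lt_0_compat; lra.
  have [T0 HT0] := Hlim e He0.
  (* [T >= 1] keeps the later times positive, where [Vsize] is bounded by [Delta6] and its suprema
     over [U] are genuine. *)
  have [T [HT1 HT2]] : exists T, 1 <= T /\ T0 <= T.
    by exists (Rabs T0 + 1); have := Rabs_pos T0; have := Rle_abs T0; lra.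
  have [z Hz] := Hbdry0 (ex_intro _ x Hx).
  (* The hypothesis bounds only the sum of two suprema; the points [x] and [z] show both to be
     nonnegative, hence each is below [e]. *)
  have Hslice t : T <= t -> (forall y, U y -> Vsize y t <= e) /\ (forall y, bdry U y -> Rabs (g y t) <= e).
    move=> Ht.
    have B6 : bound (fun y => exists x, U x /\ y = Vsize x t).
      by exists Delta6 => w [y [Hy ->]]; apply: HD6 => //; lra.
    have B7 : bound (fun y => exists x, bdry U x /\ y = Rabs (g x t)).
      by exists Delta7 => w [y [Hy ->]]; apply: HD7 => //; lra.
    have G6 y : U y -> Vsize y t <= Rsup_of (fun y => exists x, U x /\ y = Vsize x t).
      by move=> Hy; apply: Rsup_of_ge => //; exists y.
    have G7 y : bdry U y -> Rabs (g y t) <= Rsup_of (fun y => exists x, bdry U x /\ y = Rabs (g x t)).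
      by move=> Hy; apply: Rsup_of_ge => //; exists y.
    have := HT0 t ltac:(lra); have := G6 x Hx; have := G7 z Hz.
    have := HVs0 x t; have := Rabs_pos (g z t).
    move: (Rsup_of _) (Rsup_of _) G6 G7 => s6 s7 G6 G7 k1 k2 k3 k4 k5.
    have [k6 k7] := Rabs_def2 _ _ k5.
    split=> y Hy; [have := G6 y Hy|have := G7 y Hy]; lra.
  have HT0' : 0 <= T by lra.
  (* Restart at [T]: the size [S] of [sigma] at that time is finite by compactness, and its
     contribution decays at the rate [eta1] from there on. *)
  have [S [HS HSb]] := closure_bounded n U Rb _ _ T HUb (fun x Hx => conj Hx HT0') Hsigc.
  have [T' [HT' Hexpd]] := exp_decay_small eta1 S e Heta1 HS He0.
  exists (T + T' + 1) => t Ht.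
  have HVT y s : U y -> T < s -> vnorm (V y s) <= e /\ forall i j, Rabs (DV y s i j) <= e.
    move=> Hy Hs; have [h1 h2] := HVs y s; have [h3 _] := Hslice s ltac:(lra); have h4 := h3 y Hy.
    by split; [lra|move=> i j; have := h2 i j; lra].
  have HgT y s : bdry U y -> T <= s -> Rabs (g y s) <= e.
    by move=> Hy Hs; have [_ h3] := Hslice s Hs; exact: h3.
  have Hball y : dist y x <= r -> U y by move=> Hy; apply: HdU; lra.
  have Hrr : r * r < t - T by nra.
  have Hr1' : 0 < r <= 1 by lra.
  have := Hvel U sigma dsig d2sig sigt V DV T S e e Hsol ltac:(lra) HS (Rlt_le _ _ He0) (Rlt_le _ _ He0)
    HVT HSb (Hclb e T ltac:(lra) HgT) x t r Hball Hr1' Hrr.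
  rewrite -HUpd // -/(v1 x t) => -[h1 h2].
  have h3 := Hexpd (t - T) ltac:(lra).
  have h4 : C / r * (exp (- eta1 * (t - T)) * S + e + e) < eps.
    have E : C / r * (4 * e) = eps by rewrite /e; field; lra.
    have := Rmult_lt_compat_l _ _ _ HCr h3; lra.
  lra.
by split=> eps He; have [T HT] := Hdecay eps He; exists T => t Ht; have [] := HT t Ht.
Qed.
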